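(* Let $P_0$ be a discrete probability distribution, let $X_1,X_2,\ldots$ be i.i.d. from $P_0$, and let $\alpha_0(u)=\#\{x: 1/P_0\{x\}\le u\}$ for $u>1$. Assume that there exist $\sigma_0\in(0,1)$, a continuously differentiable slowly varying function $L_0$, and constants $\beta_0<\sigma_0$ and $C>0$ such that $|\alpha_0(u)-u^{\sigma_0}L_0(u)|\le Cu^{\beta_0}$ for every $u>1$, and such that for every $\delta>0$ there is a constant $C_\delta$ with $|L_0'(u)|\le C_\delta u^{-1+\delta}$ for every $u>1$. Fix $M\ge0$, and let $\Pi_\sigma$ be a prior distribution on $(0,1)$ with a bounded Lebesgue density that is positive and continuous at $\sigma_0$. Let $\Pi_n(\sigma\in\cdot\mid X_1,\ldots,X_n)$ be the posterior distribution of $\sigma$, i.e. the distribution on $(0,1)$ with density relative to $\Pi_\sigma$ proportional to $\sigma\mapsto p_\sigma(N_{n,1},\ldots,N_{n,K_n})$, and let $\hat\sigma_n$ be the maximizer of $p_\sigma(N_{n,1},\ldots,N_{n,K_n})$ over $\sigma\in[0,1]$. Then, as $n\to\infty$, in probability, $$\sup_B\Bigl|\Pi_n(\sigma\in B\mid X_1,\ldots,X_n)-N\Bigl(\hat\sigma_n,\frac1{\alpha_0(n)\tau_2^2}\Bigr)(B)\Bigr|\to0,$$ where the supremum is over all Borel sets $B\subset(0,1)$ and $\tau_2^2=-E_0'(\sigma_0)$. In particular, the posterior distribution of $\sigma$ contracts to $\sigma_0$, i.e. $\Pi_n(|\sigma-\sigma_0|>\epsilon\mid X_1,\ldots,X_n)\to0$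 in probability for every $\epsilon>0$. Furthermore, the posterior mean $\tilde\sigma_n=\mathbb E(\sigma\mid X_1,\ldots,X_n)$ satisfies $\sqrt{\alpha_0(n)}(\tilde\sigma_n-\hat\sigma_n)\to0$ in probability.
   Context: A positive measurable function $L$ is slowly varying (at $\infty$) if $L(tu)/L(t)\to 1$ as $t\to\infty$ for every $u>0$. Likelihood: $K_n$ is the number of distinct values among $X_1,\ldots,X_n$ and $N_{n,1},\ldots,N_{n,K_n}$ are the multiplicities of these distinct values. For $a^{[n]}=a(a+1)\cdots(a+n-1)$, $a^{[0]}=1$, $$p_\sigma(N_{n,1},\ldots,N_{n,K_n})=\frac{\prod_{i=1}^{K_n-1}(M+i\sigma)}{(M+1)^{[n-1]}}\prod_{j=1}^{K_n}(1-\sigma)^{[N_{n,j}-1]}.$$ This is the marginal likelihood of the partition in the Bayesian model $\sigma\sim\Pi_\sigma$, $P\mid\sigma$ a Pitman–Yor process with type $\sigma$, precision $M$ and atomless center measure, $X_1,\ldots,X_n\mid P,\sigma$ i.i.d. from $P$. The posterior is studied under the assumption that $X_1,\ldots,X_n$ are i.i.d. from $P_0$; all probabilistic limits are under this law. Constant: $$E_0(\sigma)=\frac{\Gamma(1-\sigma_0)}{\sigma}-\sum_{m=1}^\infty\frac{\Gamma(m+1-\sigma_0)}{m!(m-\sigma)},\qquad \tau_2^2=-E_0'(\sigma_0).$$ $N(\mu,v)(B)$ is the probability of $B$ under the normal distribution with mean $\mu$ and variance $v$. *)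

(* Defs.v *)
From HB Require Import structures.
From mathcomp Require Import all_boot all_order all_algebra finmap.
From mathcomp Require Import all_classical all_reals all_analysis.

Set Implicit Arguments.
Unset Strict Implicit.
Unset Printing Implicit Defensive.

Import Order.TTheory GRing.Theory Num.Theory.
Import numFieldNormedType.Exports.

Local Open Scope classical_set_scope.
Local Open Scope ring_scope.

(* Functions are considered on ]1, +oo[, the range on which the counting
   function alpha0 below is compared with u `^ sigma0 * L0 u. *)
Definition slowly_varying (R : realType) (L : R -> R) : Prop :=
  [/\ measurable_fun (`]1, +oo[ : set R) L,
      forall t, 1 < t -> 0 < L t &
      forall u, 0 < u -> (L (t * u) / L t) @[t --> +oo%R] --> (1 : R)].

Definition continuously_differentiable (R : realType) (L : R -> R) : Prop :=
  (forall u, 1 < u -> derivable L u 1) /\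
  (forall u, 1 < u -> {for u, continuous (derive1 L)}).

Definition discrete_probability (R : realType) (d : measure_display)
    (T : measurableType d) (P0 : probability T R) : Prop :=
  (forall x : T, measurable [set x]) /\
  exists2 D : set T, countable D & P0 D = 1%E.

Definition mutually_independent (R : realType) (d d' : measure_display)
    (Omega : measurableType d) (T : measurableType d') (P : probability Omega R)
    (X : nat -> {RV P >-> T}) : Prop :=
  forall (J : {fset nat}) (A : nat -> set T),
    (forall i, measurable (A i)) ->
    P (\bigcap_(i in [set` J]) (X i @^-1` A i)) =
    (\prod_(i <- J) P (X i @^-1` A i))%E.

Definition iid_from (R : realType) (d d' : measure_display)
    (Omega : measurableType d) (T : measurableType d') (P : probability Omega R)
    (X : nat -> {RV P >-> T}) (P0 : probability T R) : Prop :=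
  mutually_independent X /\
  forall i (A : set T), measurable A -> distribution P (X i) A = P0 A.

(* Points of mass zero have 1 / P0 {x} = +oo and are not counted; the explicit
   positivity condition is needed because 0^-1 = 0 in R. The set is finite, as
   it has at most u elements. *)
Definition alpha0 (R : realType) (d : measure_display) (T : measurableType d)
    (P0 : probability T R) (u : R) : R :=
  #|` fset_set [set x : T | 0 < fine (P0 [set x]) /\
                            1 / fine (P0 [set x]) <= u] |%:R.

Definition rising (R : realType) (a : R) (n : nat) : R :=
  \prod_(i < n) (a + i%:R).

(* undup s lists the distinct values of the sample s, and count_mem x s is the
   multiplicity of x. *)
Definition num_distinct (T : eqType) (s : seq T) : nat := size (undup s).

Definition likelihood (R : realType) (T : eqType) (M : R) (s : seq T)
    (sigma : R) : R :=
  (\prod_(1 <= i < num_distinct s) (M + i%:R * sigma)) /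
    rising (M + 1) (size s).-1 *
  \prod_(x <- undup s) rising (1 - sigma) (count_mem x s).-1.

Definition posterior_density (R : realType) (T : eqType)
    (Pi : probability (measurableTypeR R) R) (M : R) (s : seq T) (sigma : R) : R :=
  likelihood M s sigma /
  Rintegral Pi `]0, 1[ (fun t => likelihood M s t).

Definition posterior (R : realType) (T : eqType)
    (Pi : probability (measurableTypeR R) R) (M : R) (s : seq T) (B : set R) : R :=
  Rintegral Pi (B `&` `]0, 1[) (fun t => posterior_density Pi M s t).

Definition posterior_mean (R : realType) (T : eqType)
    (Pi : probability (measurableTypeR R) R) (M : R) (s : seq T) : R :=
  Rintegral Pi `]0, 1[ (fun t => t * posterior_density Pi M s t).

Definition is_maximizer (R : realType) (f : R -> R) (x : R) : Prop :=
  x \in `[0, 1] /\ forall y, y \in `[0, 1] -> f y <= f x.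

Definition Gamma (R : realType) (a : R) : R :=
  Rintegral lebesgue_measure `]0, +oo[ (fun x : R => x `^ (a - 1) * expR (- x)).

Definition E0 (R : realType) (sigma0 sigma : R) : R :=
  Gamma (1 - sigma0) / sigma -
  limn (fun n => \sum_(1 <= m < n)
          (Gamma (m%:R + 1 - sigma0) / (m`!%:R * (m%:R - sigma)))).

Definition tau2_sq (R : realType) (sigma0 : R) : R :=
  - derive1 (E0 sigma0) sigma0.

(* N(mu, v)(B); normal_prob takes the standard deviation. *)
Definition normal_of_variance (R : realType) (mu v : R) (B : set R) : R :=
  fine (normal_prob mu (Num.sqrt v) B).

(* mu_ext P is the outer probability, which agrees with P on measurable sets:
   the Y n are not assumed measurable. (The sample partition is measurable only
   up to a null set when the diagonal of T * T is not measurable.) *)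
Definition cvg_in_probability (R : realType) (d : measure_display)
    (Omega : measurableType d) (P : probability Omega R)
    (Y : nat -> Omega -> R) (c : R) : Prop :=
  forall eps : R, 0 < eps ->
    mu_ext P [set w | eps < `|Y n w - c|] @[n --> \oo] --> 0%E.

(* Main.v *)
Require Import Defs.
From HB Require Import structures.
From mathcomp Require Import all_boot all_order all_algebra finmap.
From mathcomp Require Import all_classical all_reals all_analysis.
From mathcomp Require Import measurable_realfun ring lra zify.
(**
Write a_n = alpha0(n), c_m = Gamma(m + 1 - sigma0) / m! and let Z_m be the
number of values observed at least m times, so that K_n = Z_1.

The likelihood is a product of nonnegative factors that are affine in sigma,
with score close to K_n / sigma - sum_(m >= 1) Z_(m+1) / (m - sigma).
Regular variation of alpha0 and dominated convergence give
E Z_(m+1) / a_n --> c_m. The counts of distinct atoms are negatively correlated,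
so Var Z_m <= E Z_m and a law of large numbers follows; the sum over large m is
controlled by Markov's inequality and the Potter bounds. Hence the score divided
by a_n tends to c_0 / sigma - sum_m c_m / (m - sigma). Its sign changes at sigma0,
because c_m / (m - sigma0) = (c_(m-1) - c_m) / sigma0 telescopes, and minus its
derivative at sigma0 is tau2_sq.

A product of affine factors is log-concave and its curvature varies by a factor
close to 1 on a fixed small neighbourhood of sigma0. The likelihood is therefore
squeezed, around its maximizer, between two Gaussian shapes of variance close
to 1 / (a_n tau2_sq), and is exponentially small elsewhere. Comparing the
posterior and the normal densities with the weight 1 + |x - sigma_hat| / s, for
s ^ 2 = 1 / (a_n tau2_sq), yields the total variation bound and the bound on
the posterior mean together.
*)

Set Implicit Arguments.
Unset Strict Implicit.
Unset Printing Implicit Defensive.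
Import Order.TTheory GRing.Theory Num.Theory.
Import numFieldNormedType.Exports.
Local Open Scope classical_set_scope.
Local Open Scope ring_scope.

(** No uniform law of large numbers is used. For a fixed radius r, the score is controlled at sigma0
    - r and sigma0 + r and the curvature at sigma0 alone. Log-concavity then encloses the maximizer.
    Each factor is affine with its zero outside ]0, 1[, so its relative change over a short interval
    is bounded whatever the number of factors; this transports the curvature from sigma0 to the
    maximizer and controls every Taylor remainder. What is left is an error proportional to the
    radius parameter d, which is made small after n has gone to infinity.

    The limits of the means come from an exchange of sum and integral: a binomial tail is an
    integral of a binomial mass over the success probability, so that summing over the atoms puts
    their counting function under a Gamma-type integral.

    Since the partition of the sample need not be measurable, the atoms are arranged in a fixed
    sequence of cells, of which the first J n contain all n draws up to probability 1 / n. Outside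
    small measurable events, every random quantity is a count over these cells. *)

Ltac nz := repeat (apply/andP; split); try (by []); try (by rewrite gt_eqF); try (by rewrite gt_eqF ?powR_gt0).

(** * Regular variation *)

Section RegularVariation.
Variable R : realType.
Implicit Types (h a L : R -> R) (t u x : R).

Lemma eq_ler x y : x = y -> x <= y.
Proof. by move->. Qed.

Lemma powRDp x r s : 0 < x -> x `^ (r + s) = x `^ r * x `^ s.
Proof. by move=> x0; rewrite powRD// (gt_eqF x0) implybT. Qed.

Lemma powRVp x r : 0 < x -> (x^-1) `^ r = (x `^ r)^-1.
Proof.
by move=> x0; rewrite -powR_inv1 ?ltW// -powRrM mulN1r powRN.
Qed.

Lemma le_powR x y r : 0 <= r -> 0 <= x -> x <= y -> x `^ r <= y `^ r.
Proof.
by move=> r0 x0 xy; apply: ge0_ler_powR => //; rewrite nnegrE// (le_trans x0).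
Qed.

Lemma gt1_ltr_powR x (r s : R) : 1 < x -> r < s -> x `^ r < x `^ s.
Proof.
move=> x1 rs; have x0 : 0 < x by lra.
rewrite -[s](subrK r) powRDp// ltr_pMl ?powR_gt0//.
have sr : 0 < s - r by lra.
by have := gt0_ltr_powR sr _ _ x1; rewrite powR1; apply; rewrite nnegrE ltW.
Qed.

Lemma near_pinfty_ex (P : R -> Prop) : (\forall t \near +oo, P t) ->
  exists2 t0, 1 <= t0 & forall t, t0 <= t -> P t.
Proof.
case=> A [_ HA]; exists (Num.max 1 (A + 1)); first by rewrite le_max lexx.
by move=> t; rewrite ge_max => /andP[_ At]; apply: HA; lra.
Qed.

Lemma powR_near_pinfty_gt (r A : R) : 0 < r -> \forall t \near +oo, A < t `^ r.
Proof.
move=> r0; near=> t.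
have t0 : 0 < t by near: t; apply: nbhs_pinfty_gt; exact: num_real.
have At : (Num.max 1 A) `^ r^-1 < t by near: t; apply: nbhs_pinfty_gt; exact: num_real.
have := gt0_ltr_powR r0 _ _ At.
rewrite -powRrM mulVf ?gt_eqF// powRr1 ?le_max ?ler01//.
by move=> /(_ (powR_ge0 _ _) (ltW t0)); rewrite gt_max => /andP[].
Unshelve. all: by end_near. Qed.

(** Repeated halving carries any point into [[t0, 2 * t0]], and [h] does not increase on the way.
    All power bounds for regularly varying functions are instances, with [h] a function multiplied
    or divided by a power. *)
Lemma doubling_lb h t0 K : 0 < t0 ->
  (forall t, t0 <= t -> h t <= h (2 * t)) ->
  (forall t, t0 <= t <= 2 * t0 -> K <= h t) ->
  forall t, t0 <= t -> K <= h t.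
Proof.
move=> t00 hd hK.
have key n t : t0 <= t <= 2 ^+ n.+1 * t0 -> K <= h t.
  elim: n t => [|n IH] t; first by rewrite expr1; exact: hK.
  move=> /andP[t0t tn]; have [t2|t2] := leP t (2 * t0); first by apply: hK; rewrite t0t.
  have t'0 : t0 <= t / 2 by lra.
  apply: (le_trans (IH (t / 2) _)).
    by rewrite t'0/= ler_pdivrMr//; move: tn; rewrite exprS; lra.
  by have := hd _ t'0; rewrite mulrCA divff ?mulr1.
move=> t t0t; apply: (key (Num.truncn (t / t0))); rewrite t0t/=.
rewrite -ler_pdivrMr//.
have tt : 0 <= t / t0 by rewrite divr_ge0// ltW// (lt_le_trans t00).
apply: (le_trans (ltW (truncnS_gt _))).
by rewrite -natrX ler_nat; apply: ltnW; apply: ltn_expl.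
Qed.

Lemma slowly_varying_lb L (e : R) : 0 < e -> slowly_varying L ->
  (forall u, 1 < u -> {for u, continuous L}) ->
  exists2 c, 0 < c & \forall t \near +oo, c * t `^ (- e) <= L t.
Proof.
move=> e0 [_ Lpos Lsv] Lc.
have e2 : (2 : R) `^ (- e) < 1.
  by rewrite powRN invf_lt1 ?powR_gt0// -[ltLHS](powRr0 2) gt1_ltr_powR// ltr1n.
have : \forall t \near +oo, 2 `^ (- e) <= L (t * 2) / L t /\ 1 < t.
  near=> t; split; last by near: t; apply: nbhs_pinfty_gt; exact: num_real.
  near: t; have /cvgrPdist_lt := Lsv 2 (ltr0Sn R 1).
  move=> /(_ (1 - 2 `^ (- e))); rewrite subr_gt0 => /(_ e2).
  by apply: filterS => t; rewrite ltr_norml => /andP[_]; lra.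
move=> /near_pinfty_ex[t0 t01 H].
have t0gt1 : 1 < t0 by have [] := H t0 (lexx _).
have t00 : 0 < t0 by lra.
have [||c c01 Hc] := @EVT_min R L t0 (2 * t0); first by lra.
  apply: continuous_in_subspaceT => x /set_mem /=.
  by rewrite in_itv/= => /andP[xt _]; apply: Lc; lra.
have Lc0 : 0 < L c by apply: Lpos; move: c01; rewrite in_itv/=; lra.
exists (L c * t0 `^ e); first by rewrite mulr_gt0// powR_gt0.
exists t0; split; first exact: num_real.
move=> t /ltW t0t.
have tp : 0 < t by lra.
rewrite powRN ler_pdivrMr ?powR_gt0//.
apply: (@doubling_lb (fun x => L x * x `^ e) t0 (L c * t0 `^ e) t00 _ _ t t0t).
- move=> x t0x; have [Hx x1] := H _ t0x.
  rewrite /= powRM//; last by lra.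
  rewrite mulrA ler_wpM2r ?powR_ge0//.
  move: Hx; rewrite powRN ler_pdivlMr ?Lpos// mulrC [x * 2]mulrC.
  by rewrite ler_pdivrMr ?powR_gt0//; apply.
- move=> x /andP[xt0 x2]; apply: ler_pM; [exact: ltW|exact: powR_ge0| |].
    by apply: Hc; rewrite in_itv/= xt0.
  apply: le_powR; lra.
Unshelve. all: by end_near. Qed.

(** The error u ^ b has to be negligible against u ^ s L u. Half of the gap s - b pays for the
    possible decay of [L], and the other half makes the quotient vanish. *)
Lemma regularly_varying a L s b C : slowly_varying L ->
  (forall u, 1 < u -> {for u, continuous L}) -> b < s ->
  (forall u, 1 < u -> `|a u - u `^ s * L u| <= C * u `^ b) ->
  forall u, 0 < u -> a (t * u) / a t @[t --> +oo] --> u `^ s.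
Proof.
move=> Lsv Lc bs aL u u0.
have [_ Lpos Lsv'] := Lsv.
pose e := (s - b) / 2; have e0 : 0 < e by rewrite /e; lra.
have [c c0 Hc] := slowly_varying_lb e0 Lsv Lc.
(* The ratio of [a] to its leading term. Once it tends to 1, a (t u) / a t differs from u ^ s only
   by factors tending to 1. *)
pose q t := a t / (t `^ s * L t).
have q1 : q t @[t --> +oo] --> (1 : R).
  apply/cvgrPdist_le => eps eps0.
  have Hp := @powR_near_pinfty_gt e (`|C| / (c * eps)) e0.
  near=> t.
  have t1 : 1 < t by near: t; apply: nbhs_pinfty_gt; exact: num_real.
  have t0 : 0 < t by lra.
  have tsL : 0 < t `^ s * L t by rewrite mulr_gt0 ?powR_gt0 ?Lpos.
  have -> : 1 - q t = - (a t - t `^ s * L t) / (t `^ s * L t).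
    have tL := Lpos _ t1; have ts := powR_gt0 s t0.
    by rewrite /q; field; nz.
  rewrite normrM normrN [X in _ * X]gtr0_norm ?invr_gt0// ler_pdivrMr//.
  apply: (le_trans (aL _ t1)).
  apply: (@le_trans _ _ (`|C| * t `^ b)).
    by rewrite ler_wpM2r ?powR_ge0// ler_norm.
  have Lt : c * t `^ (- e) <= L t by near: t.
  apply: (@le_trans _ _ (eps * (t `^ s * (c * t `^ (- e))))); last first.
    by rewrite ler_wpM2l ?(ltW eps0)// ler_wpM2l ?powR_ge0.
  have -> : s = b + e + e by rewrite /e; field.
  rewrite !powRDp// powRN.
  have te : `|C| / (c * eps) < t `^ e by near: t.
  rewrite ltr_pdivrMr ?mulr_gt0// in te.
  rewrite [leRHS](_ : _ = (t `^ e * (c * eps)) * t `^ b).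
    by rewrite ler_wpM2r ?powR_ge0// ltW.
  by field; nz.
have ty : (t * u) @[t --> +oo] --> +oo.
  by apply: gt0_cvgMly => //; exact: cvg_id.
have qu : q (t * u) @[t --> +oo] --> (1 : R) by exact: (cvg_comp _ _ ty q1).
have lim : q (t * u) * (q t)^-1 * (L (t * u) / L t) * u `^ s @[t --> +oo] --> 1 * 1^-1 * 1 * u `^ s.
  apply: cvgM; last exact: cvg_cst.
  by apply: cvgM (Lsv' _ u0); apply: cvgM qu _; apply: cvgV q1; exact: oner_neq0.
rewrite invr1 !mul1r in lim.
apply: cvg_trans lim; apply: near_eq_cvg.
near=> t.
have t1 : 1 < t by near: t; apply: nbhs_pinfty_gt; exact: num_real.
have tu1 : 1 < t * u.
  by rewrite -ltr_pdivrMr//; near: t; apply: nbhs_pinfty_gt; exact: num_real.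
have t0 : 0 < t by lra.
have tuL := Lpos _ tu1; have tL := Lpos _ t1.
rewrite /q invf_div powRM ?ltW//.
(* Where [a t] vanishes, the convention 0^-1 = 0 makes both sides 0. *)
have [at0|at0] := eqVneq (a t) 0; first by rewrite at0 invr0 !(mulr0, mul0r).
have ts := powR_gt0 s t0; have us := powR_gt0 s u0.
by field; nz.
Unshelve. all: by end_near. Qed.

End RegularVariation.

(** * Potter bounds *)

Section Potter.
Variables (R : realType) (a : R -> R) (s0 : R).
Hypothesis (s00 : 0 < s0).
Hypothesis a_ge0 : forall t, 0 <= a t.
Hypothesis a_mono : forall x y, x <= y -> a x <= a y.
Hypothesis a_rv : forall u, 0 < u -> a (t * u) / a t @[t --> +oo] --> u `^ s0.

(** The case u = 1: the ratio a t / a t tends to 1, but it equals 0 wherever [a t] is 0. *)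
Lemma rv_gt0 : \forall t \near +oo, 0 < a t.
Proof.
have /cvgrPdist_lt/(_ 1 ltr01) := a_rv (@ltr01 R).
apply: filterS => t; rewrite powR1 lt0r a_ge0 andbT.
by case: eqP => // ->; rewrite invr0 mulr0 subr0 normr1 ltxx.
Qed.

(** Far out, a doubling multiplies [a] by at most 2 ^ eta. The additional factor 2 ^ eta pays for
    the first octave, where only monotonicity compares [a x] with [a (2 * t)]. *)
Lemma potter_upper eta : s0 < eta ->
  exists2 t0, 1 <= t0 & forall t u, t0 <= t -> 1 <= u ->
    a (t * u) <= 2 `^ eta * u `^ eta * a t.
Proof.
move=> s0eta.
have s00' := s00.
have s2 : (2 : R) `^ s0 < 2 `^ eta by rewrite gt1_ltr_powR// ltr1n.
have : \forall t \near +oo, 0 < a t /\ a (t * 2) / a t <= 2 `^ eta.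
  near=> t; split; first by near: t; exact: rv_gt0.
  near: t; have /cvgrPdist_lt := a_rv (ltr0Sn R 1).
  move=> /(_ (2 `^ eta - 2 `^ s0)); rewrite subr_gt0 => /(_ s2).
  by apply: filterS => t; rewrite ltr_norml => /andP[+ _]; lra.
move=> /near_pinfty_ex[t0 t01 H].
exists t0 => // t u t0t u1; have t00 : 0 < t by lra.
have tu0 : t <= t * u by rewrite ler_peMr// ltW.
have D x : t0 <= x -> a (2 * x) <= 2 `^ eta * a x.
  by move=> t0x; have [ax] := H _ t0x; rewrite ler_pdivrMr// [x * 2]mulrC.
have u0 : 0 < u by lra.
have -> : 2 `^ eta * u `^ eta * a t = (2 `^ eta * a t / t `^ eta) * (t * u) `^ eta.
  by rewrite powRM ?ltW//; field; nz.
rewrite -ler_pdivrMr ?powR_gt0 ?mulr_gt0// -lerN2.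
apply: (@doubling_lb R (fun x => - (a x / x `^ eta)) t
  (- (2 `^ eta * a t / t `^ eta)) t00 _ _ (t * u) tu0).
- move=> x tx; rewrite lerN2 powRM//; last by lra.
  have x0 : 0 < x `^ eta by apply: powR_gt0; lra.
  have t20 := powR_gt0 eta (ltr0Sn R 1).
  rewrite ler_pdivrMr ?mulr_gt0// [leRHS](_ : _ = 2 `^ eta * a x); first by apply: D; lra.
  by field; nz.
- move=> x /andP[tx xt]; rewrite lerN2; apply: ler_pM => //.
  + by rewrite invr_ge0 powR_ge0.
  + by apply: (le_trans (a_mono xt)); apply: D; lra.
  + rewrite lef_pV2 ?posrE ?powR_gt0//; last lra.
    by apply: le_powR; lra.
Unshelve. all: by end_near. Qed.

(** Far out, a doubling multiplies [a] by at least 2 ^ rho. This gives the divergence of [a] and,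
    through [mean_tail_le], the decay in m that makes the series of the score converge uniformly in
    n. *)
Lemma potter_lower rho : 0 < rho < s0 ->
  exists2 t0, 1 <= t0 & forall s t, t0 <= s -> s <= t ->
    a s <= 2 `^ rho * (s / t) `^ rho * a t.
Proof.
move=> /andP[rho0 rhos0].
have s2 : (2 : R) `^ rho < 2 `^ s0 by rewrite gt1_ltr_powR// ltr1n.
have : \forall t \near +oo, 0 < a t /\ 2 `^ rho <= a (t * 2) / a t.
  near=> t; split; first by near: t; exact: rv_gt0.
  near: t; have /cvgrPdist_lt := a_rv (ltr0Sn R 1).
  move=> /(_ (2 `^ s0 - 2 `^ rho)); rewrite subr_gt0 => /(_ s2).
  by apply: filterS => t; rewrite ltr_norml => /andP[_]; lra.
move=> /near_pinfty_ex[t0 t01 H].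
exists t0 => // s t t0s st; have s0' : 0 < s by lra.
have t0' : 0 < t by lra.
have t2 := powR_gt0 rho (ltr0Sn R 1).
have srho := powR_gt0 rho s0'; have trho := powR_gt0 rho t0'.
have -> : 2 `^ rho * (s / t) `^ rho * a t = a t / t `^ rho * (2 * s) `^ rho.
  by rewrite !powRM ?powRVp ?invr_ge0 ?ltW//; field; nz.
rewrite -ler_pdivrMr ?powR_gt0 ?mulr_gt0//.
apply: (@doubling_lb R (fun x => a x / x `^ rho) s (a s / (2 * s) `^ rho) s0' _ _ t st).
  - move=> x sx; have [ax Hx] := H x (le_trans t0s sx).
    have x0 : 0 < x by lra.
    rewrite powRM ?(ltW x0)// ler_pdivrMr ?mulr_gt0 ?powR_gt0//.
    rewrite [leRHS](_ : _ = a (2 * x) / 2 `^ rho); last first.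
      by field; nz.
    by rewrite ler_pdivlMr// mulrC -ler_pdivlMr// [2 * x]mulrC.
  - move=> x /andP[sx xs]; apply: ler_pM => //.
    + by rewrite invr_ge0 powR_ge0.
    + exact: a_mono.
    + rewrite lef_pV2 ?posrE ?powR_gt0//; try lra.
      by apply: le_powR; lra.
Unshelve. all: by end_near. Qed.

Lemma rv_cvgy : a t @[t --> +oo] --> +oo.
Proof.
have s00' := s00.
have /potter_lower[t0 t01 H] : 0 < s0 / 2 < s0 by lra.
have [t1 t11 H1] := near_pinfty_ex rv_gt0.
pose s := Num.max t0 t1.
have as0 : 0 < a s by apply: H1; rewrite le_max lexx orbT.
have sp : 0 < s by rewrite lt_max; apply/orP; left; lra.
have c0 : 0 < a s / (2 `^ (s0 / 2) * s `^ (s0 / 2)).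
  by rewrite divr_gt0// mulr_gt0// powR_gt0.
apply/cvgryPge => A.
have hp : 0 < s0 / 2 by lra.
have Hp := @powR_near_pinfty_gt R (s0 / 2) (A / (a s / (2 `^ (s0 / 2) * s `^ (s0 / 2)))) hp.
near=> t.
have st : s <= t by near: t; apply: nbhs_pinfty_ge; exact: num_real.
have := H s t; rewrite le_max lexx => /(_ isT st).
have tp : 0 < t by lra.
rewrite powRM ?(ltW sp) ?invr_ge0 ?(ltW tp)// powRVp// => Ht.
have : A / (a s / (2 `^ (s0 / 2) * s `^ (s0 / 2))) < t `^ (s0/2) by near: t.
rewrite ltr_pdivrMr// => /ltW /le_trans; apply.
rewrite mulrA ler_pdivrMr ?mulr_gt0 ?powR_gt0//.
rewrite mulrC -ler_pdivlMr ?powR_gt0//.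
by apply: (le_trans Ht); apply: eq_ler; field; nz.
Unshelve. all: by end_near. Qed.

End Potter.

(** * Counts in a sample *)

Section JointTail.
Variable R : realType.
Implicit Types (p q : R) (n a b m : nat).

(* The probability that n independent draws fall at least a times in a cell of
   mass p and at least b times in a disjoint cell of mass q. *)
Fixpoint joint_tail p q n a b : R :=
  if n is n'.+1 then
    p * joint_tail p q n' a.-1 b + q * joint_tail p q n' a b.-1
    + (1 - p - q) * joint_tail p q n' a b
  else ((a == 0) && (b == 0))%N%:R.

(* The probability, as a polynomial in p, that a binomial (n, p) variable is at
   least m. *)
Fixpoint bin_tail n m : {poly R} :=
  match n, m with
  | _, 0%N => 1
  | 0%N, m'.+1 => 0
  | n'.+1, m'.+1 => 'X * bin_tail n' m' + (1 - 'X) * bin_tail n' m'.+1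
  end.

Lemma bin_tail0 n : bin_tail n 0 = 1. Proof. by case: n. Qed.

Lemma joint_tailr0 p q n a : joint_tail p q n a 0 = (bin_tail n a).[p].
Proof.
elim: n a => [|n IH] [|a] /=; rewrite ?eqxx ?hornerE//= !IH ?bin_tail0 ?hornerE//=.
- by ring.
- by ring.
Qed.

Lemma joint_tailC p q n a b : joint_tail p q n a b = joint_tail q p n b a.
Proof.
elim: n a b => [|n IH] a b /=; first by rewrite andbC.
by rewrite !IH; ring.
Qed.

Lemma joint_tail0l p q n b : joint_tail p q n 0 b = (bin_tail n b).[q].
Proof. by rewrite joint_tailC joint_tailr0. Qed.

Section Bounds.
Variables p q : R.
Hypotheses (p0 : 0 <= p) (q0 : 0 <= q) (pq1 : p + q <= 1).

Lemma joint_tail_ge0 n a b : 0 <= joint_tail p q n a b.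
Proof.
elim: n a b => [|n IH] a b /=; first by rewrite ler0n.
have pq' := pq1.
by rewrite !addr_ge0// mulr_ge0//; lra.
Qed.

Lemma joint_tail_antil n a b : joint_tail p q n a b <= joint_tail p q n a.-1 b.
Proof.
have pq' := pq1.
elim: n a b => [|n IH] a b /=; first by case: a.
by rewrite !lerD// ler_wpM2l//; lra.
Qed.

End Bounds.

(* Induction on n: the defect of the recursion is p q (g' - g) (h' - h) >= 0. *)
Lemma joint_tail_neg_corr p q n a b : 0 <= p -> 0 <= q -> p + q <= 1 ->
  joint_tail p q n a b <= joint_tail p q n a 0 * joint_tail p q n 0 b.
Proof.
move=> p0 q0 pq1; elim: n a b => [|n IH] a b /=.
  by rewrite -natrM ler_nat mulnb andbT.
set g := joint_tail p q n a 0; set h := joint_tail p q n 0 b.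
set g' := joint_tail p q n a.-1 0; set h' := joint_tail p q n 0 b.-1.
have gg : 0 <= g' - g by rewrite subr_ge0 /g /g' joint_tail_antil.
have hh : 0 <= h' - h.
  rewrite subr_ge0 /h /h' joint_tailC [leRHS]joint_tailC joint_tail_antil//.
  by rewrite addrC.
apply: (@le_trans _ _ (p * (g' * h) + q * (g * h') + (1 - p - q) * (g * h))).
  by rewrite !lerD// ler_wpM2l//; try exact: IH; lra.
have := mulr_ge0 (mulr_ge0 p0 q0) (mulr_ge0 gg hh).
by rewrite -subr_ge0 => H; rewrite -subr_ge0; move: H; rewrite subr0; congr (_ <= _); ring.
Qed.

Lemma bin_tail_ge0 n m p : 0 <= p <= 1 -> 0 <= (bin_tail n m).[p].
Proof.
by move=> /andP[p0 p1]; rewrite -(joint_tailr0 p 0) joint_tail_ge0// addr0.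
Qed.

End JointTail.

(** * Probabilities and means as real numbers *)

Section RealProbability.
Variables (R : realType) (d : measure_display) (T : measurableType d).
Variable P : probability T R.

Lemma fine_probU (A B : set T) : measurable A -> measurable B -> A `&` B = set0 ->
  fine (P (A `|` B)) = fine (P A) + fine (P B).
Proof. by move=> mA mB AB; rewrite measureU// fineD ?fin_num_measure. Qed.

Lemma fine_probC (A : set T) : measurable A -> fine (P (~` A)) = 1 - fine (P A).
Proof. by move=> mA; rewrite probability_setC// fineB ?fin_num_measure. Qed.

Lemma le_fine_prob (A B : set T) : measurable A -> measurable B -> A `<=` B ->
  fine (P A) <= fine (P B).
Proof.
by move=> mA mB AB; rewrite fine_le ?fin_num_measure// le_measure ?inE.
Qed.

Lemma fine_prob_le1 (A : set T) : measurable A -> fine (P A) <= 1.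
Proof.
move=> mA; rewrite -lee_fin fineK ?fin_num_measure//; exact: probability_le1.
Qed.

Lemma fine_prob_ge0 (A : set T) : 0 <= fine (P A).
Proof. exact: fine_ge0. Qed.

End RealProbability.

Section Means.
Variables (R : realType) (d : measure_display) (T : measurableType d).
Variable P : probability T R.
Implicit Types (f g : T -> R) (e : R).

(** Integrability is part of the predicate, so that linearity, monotonicity and Markov's inequality
    apply without side conditions. *)
Definition has_mean f e : Prop :=
  P.-integrable setT (EFin \o f) /\ \int[P]_x f x = e.

Lemma has_mean_indic (A : set T) : measurable A -> has_mean \1_A (fine (P A)).
Proof.
move=> mA; split; first exact: integrable_indic.
by rewrite /Rintegral integral_indic// setIT.
Qed.

Lemma has_meanD f g e e' : has_mean f e -> has_mean g e' ->
  has_mean (fun x => f x + g x) (e + e').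
Proof.
move=> [fi <-] [gi <-]; split; last by rewrite RintegralD.
by rewrite (_ : EFin \o _ = (EFin \o f) \+ (EFin \o g))//; exact: integrableD.
Qed.

Lemma has_meanZ f e c : has_mean f e -> has_mean (fun x => c * f x) (c * e).
Proof.
move=> [fi <-]; split; last by rewrite RintegralZl.
by rewrite (_ : EFin \o _ = (fun x => c%:E * (EFin \o f) x)%E)//; exact: integrableZl.
Qed.

Lemma has_mean_cst c : has_mean (fun=> c) c.
Proof.
have := has_meanZ c (has_mean_indic measurableT).
rewrite probability_setT mulr1 => -[H1 H2]; split.
  by apply: eq_integrable H1 => // x _; rewrite /= indicT mulr1.
by rewrite -[RHS]H2; apply: eq_Rintegral => x _; rewrite indicT mulr1.
Qed.

Lemma has_mean_sum (I : Type) (r : seq I) (f : I -> T -> R) (e : I -> R) :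
  (forall i, has_mean (f i) (e i)) ->
  has_mean (fun x => \sum_(i <- r) f i x) (\sum_(i <- r) e i).
Proof.
move=> H; elim: r => [|i r IH].
  by rewrite big_nil; under eq_fun do rewrite big_nil; exact: has_mean_cst.
by rewrite big_cons; under eq_fun do rewrite big_cons; exact: has_meanD.
Qed.

Lemma le_has_mean f g e e' : has_mean f e -> has_mean g e' ->
  (forall x, f x <= g x) -> e <= e'.
Proof. by move=> [fi <-] [gi <-] fg; apply: le_Rintegral. Qed.

Lemma markov_has_mean f e (t : R) (S : set T) : measurable S -> has_mean f e ->
  (forall x, 0 <= f x) -> 0 < t -> (forall x, S x -> t <= f x) ->
  fine (P S) <= e / t.
Proof.
move=> mS fe f0 t0 Sf.
rewrite ler_pdivlMr// mulrC; apply: le_has_mean (has_meanZ t (has_mean_indic mS)) fe _.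
move=> x; rewrite indicE; case: (boolP (x \in S)) => [/set_mem xS|_].
  by rewrite mulr1; exact: Sf.
by rewrite mulr0.
Qed.

(** The covariances are at most 0 and the variance of an indicator is at most its mean, so the
    variance of the sum is at most its mean [e]. *)
Lemma chebyshev_neg_corr (J : nat) (F : nat -> set T) (t : R) (S : set T) :
  measurable S -> (forall k, measurable (F k)) -> 0 < t ->
  (forall i j, (i < J)%N -> (j < J)%N -> i != j ->
     fine (P (F i `&` F j)) <= fine (P (F i)) * fine (P (F j))) ->
  let e := \sum_(k < J) fine (P (F k)) in
  (forall x, S x -> t <= `|\sum_(k < J) \1_(F k) x - e|) ->
  fine (P S) <= e / t ^+ 2.
Proof.
move=> mS mF t0 neg e St.
pose Z x : R := \sum_(k < J) \1_(F k) x.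
have mZ : has_mean Z e by apply: has_mean_sum => k; exact: has_mean_indic.
pose v := \sum_(i < J) \sum_(j < J) fine (P (F i `&` F j)).
have mZ2 : has_mean (fun x => Z x ^+ 2) v.
  rewrite (_ : (fun x => Z x ^+ 2) =
    (fun x => \sum_(i < J) \sum_(j < J) \1_(F i `&` F j) x)).
    apply: has_mean_sum => i; apply: has_mean_sum => j.
    by apply: has_mean_indic; exact: measurableI.
  apply/funext => x; rewrite expr2 /Z mulr_suml; apply: eq_bigr => i _.
  by rewrite mulr_sumr; apply: eq_bigr => j _; rewrite indicI.
have mdev : has_mean (fun x => (Z x - e) ^+ 2) (v + (- (2 * e) * e + e ^+ 2)).
  rewrite (_ : (fun x => _) = (fun x => Z x ^+ 2 + (- (2 * e) * Z x + e ^+ 2))).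
    by apply: has_meanD => //; apply: has_meanD (has_mean_cst _); exact: has_meanZ.
  by apply/funext => x; ring.
(* The diagonal contributes [e]; the other terms are bounded by products of means, and adding the
   missing diagonal products completes [e ^+ 2]. *)
have ve : v <= e + e ^+ 2.
  rewrite expr2 {2}/e mulr_suml /e -big_split/=; apply: ler_sum => i _.
  rewrite (bigD1 i)//= setIid mulr_sumr.
  rewrite lerD2l [leRHS](bigD1 i)//= ler_wpDl ?mulr_ge0 ?fine_prob_ge0//.
  by apply: ler_sum => j ji; apply: neg; rewrite // eq_sym.
have t2 : 0 < t ^+ 2 by rewrite exprn_gt0.
apply: (le_trans (markov_has_mean mS mdev _ t2 _)).
- by move=> x; exact: sqr_ge0.
- move=> x Sx; rewrite -[leRHS]real_normK ?num_real// lerXn2r ?nnegrE ?(ltW t0)//.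
  exact: St.
- by rewrite ler_pM2r ?invr_gt0//; move: ve; rewrite expr2; lra.
Qed.

End Means.

(** * Joint law of the counts of two disjoint sets *)

Section Counts.
Variables (R : realType) (d d' : measure_display).
Variables (Omega : measurableType d) (T : measurableType d').
Variables (P : probability Omega R) (P0 : probability T R).
Variable X : nat -> {RV P >-> T}.
Hypothesis iidX : iid_from X P0.

Let pr (S : set Omega) : R := fine (P S).

Definition hits (U : set T) n (w : Omega) : nat := \sum_(i < n) (X i w \in U).

Let E (U V : set T) n a b : set Omega :=
  [set w | (a <= hits U n w)%N /\ (b <= hits V n w)%N].

(** Constraints on the draws n, ..., N - 1. Carrying them through the induction means that
    independence is used once, as a product formula for all N draws. *)
Let G n N (A : nat -> set T) : set Omega :=
  [set w | forall k, (n <= k < N)%N -> A k (X k w)].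

Lemma measurable_RV_preimage k (B : set T) : measurable B -> measurable (X k @^-1` B).
Proof. by move=> mB; rewrite -[_ @^-1` _]setTI; exact: measurable_funPT. Qed.

Let mG n N A : (forall i, measurable (A i)) -> measurable (G n N A).
Proof.
move=> mA; rewrite (_ : G n N A = \bigcap_(k in [set k | (n <= k < N)%N]) X k @^-1` A k)//.
by apply: bigcap_measurableType => // k _; exact: measurable_RV_preimage.
Qed.

Let hitsS U n w : hits U n.+1 w = (hits U n w + (X n w \in U))%N.
Proof. by rewrite /hits big_ord_recr. Qed.

Let prG N A : (forall i, measurable (A i)) ->
  pr (G 0 N A) = \prod_(0 <= k < N) fine (P0 (A k)).
Proof.
move=> mA; have [ind dist] := iidX.
have -> : G 0 N A = \bigcap_(i in [set` [fset k in iota 0 N]%fset]) X i @^-1` A i.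
  apply/seteqP; split => w /= H k.
    by rewrite /= !inE mem_iota add0n => Hk; exact: H.
  by move=> Hk; apply: H; rewrite /= !inE mem_iota add0n.
rewrite /pr ind// /index_iota subn0.
rewrite (perm_big (iota 0 N)) /=; last first.
  by apply: uniq_perm; [exact: fset_uniq|exact: iota_uniq|move=> i; rewrite !inE].
under eq_bigr => i _ do rewrite -[P _]/(distribution P (X i) (A i)) dist//.
rewrite (_ : (\prod_(i <- iota 0 N) P0 (A i))%E = (\prod_(i <- iota 0 N) fine (P0 (A i)))%:E)//.
rewrite -prodEFin; apply: eq_bigr => i _; rewrite fineK// fin_num_measure//.
Qed.

(** Draw n lies in [U], in [V] or in the rest [W]. The three cases match the three terms of
    [joint_tail]; each turns draw n into one more constraint in [G], until n = 0 leaves a product of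
    probabilities. Measurability comes with the same decomposition. *)
Lemma prob_joint (U V : set T) n a b N A : measurable U -> measurable V ->
  U `&` V = set0 -> (n <= N)%N -> (forall i, measurable (A i)) ->
  measurable (E U V n a b `&` G n N A) /\
  pr (E U V n a b `&` G n N A) =
    joint_tail (fine (P0 U)) (fine (P0 V)) n a b * \prod_(n <= k < N) fine (P0 (A k)).
Proof.
move=> mU mV UV; elim: n a b A => [|n IH] a b A nN mA.
  have E0 : E U V 0 a b = if ((a == 0) && (b == 0))%N then setT else set0.
    rewrite /E /hits; apply/seteqP; split=> w /=; rewrite !big_ord0 !leqn0.
      by case=> /eqP -> /eqP ->; rewrite eqxx.
    by case: ifP => // /andP[-> ->].
  rewrite E0 /=; case: ifP => _; rewrite ?setTI ?set0I ?mul0r ?mul1r.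
    by split; [exact: mG|exact: prG].
  by split=> //; rewrite /pr measure0.
pose W := ~` (U `|` V).
have mW : measurable W by apply: measurableC; exact: measurableU.
(* [G n.+1] leaves draw n free; [B S] requires it to lie in [S]. *)
pose B (S : set T) k := if k == n then S else A k.
have mB S i : measurable S -> measurable (B S i) by rewrite /B; case: ifP.
have dE : E U V n.+1 a b `&` G n.+1 N A =
   (E U V n a.-1 b `&` G n N (B U)) `|` (E U V n a b.-1 `&` G n N (B V)) `|`
   (E U V n a b `&` G n N (B W)).
  apply/seteqP; split => w.
    rewrite /E /G /= !hitsS => -[[Ha Hb] HG].
    have HB S : S (X n w) -> forall k, (n <= k < N)%N -> B S k (X k w).
      move=> HS k /andP[nk kN]; rewrite /B; case: eqP => [->//|/eqP kn].
      by apply: HG; rewrite kN ltn_neqAle eq_sym kn nk.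
    case: (asboolP (U (X n w))) => HU; [|case: (asboolP (V (X n w))) => HV].
    - have nV : X n w \notin V.
        by apply/negP => /set_mem HV; have : (U `&` V) (X n w) := conj HU HV; rewrite UV.
      left; left; split; last exact: HB.
      move: Ha Hb; rewrite (mem_set HU) (negbTE nV) addn0 addn1.
      by split=> //; case: (a) Ha.
    - have nU : X n w \notin U by apply/negP => /set_mem.
      left; right; split; last exact: HB.
      move: Ha Hb; rewrite (mem_set HV) (negbTE nU) addn0 addn1.
      by split=> //; case: (b) Hb.
    - have nU : X n w \notin U by apply/negP => /set_mem.
      have nV : X n w \notin V by apply/negP => /set_mem.
      right; split; last by apply: HB => -[].
      by move: Ha Hb; rewrite (negbTE nU) (negbTE nV) !addn0.
  have nn : (n <= n < N)%N by rewrite leqnn nN.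
  have HA S : G n N (B S) w -> G n.+1 N A w.
    move=> HG k /andP[nk kN]; have := HG k; rewrite /B (ltnW nk) kN => /(_ isT).
    by rewrite gtn_eqF.
  have Hn S : G n N (B S) w -> S (X n w).
    by move=> /(_ n nn); rewrite /B eqxx.
  rewrite /E /= !hitsS; case=> [[|]|] [[Ha Hb] HG]; (split; last exact: HA HG).
  - rewrite (mem_set (Hn _ HG)) addn1; split; last exact: (leq_trans Hb (leq_addr _ _)).
    by case: (a) Ha.
  - rewrite (mem_set (Hn _ HG)) addn1; split; first exact: (leq_trans Ha (leq_addr _ _)).
    by case: (b) Hb.
  - by split; [exact: (leq_trans Ha (leq_addr _ _))|exact: (leq_trans Hb (leq_addr _ _))].
have nN' : (n <= N)%N := ltnW nN.
have [m1 e1] := IH a.-1 b (B U) nN' (fun i => mB U i mU).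
have [m2 e2] := IH a b.-1 (B V) nN' (fun i => mB V i mV).
have [m3 e3] := IH a b (B W) nN' (fun i => mB W i mW).
have prodB S : \prod_(n <= k < N) fine (P0 (B S k)) =
    fine (P0 S) * \prod_(n.+1 <= k < N) fine (P0 (A k)).
  rewrite big_ltn// /B eqxx; congr (_ * _); apply: eq_big_nat => k /andP[nk _].
  by rewrite gtn_eqF.
have nn : (n <= n < N)%N by rewrite leqnn nN.
have Hn S w : G n N (B S) w -> S (X n w).
  by move=> /(_ n nn); rewrite /B eqxx.
have P0W : fine (P0 W) = 1 - fine (P0 U) - fine (P0 V).
  by rewrite /W fine_probC ?fine_probU ?opprD ?addrA//; exact: measurableU.
rewrite dE; split; first by do 2?apply: measurableU.
rewrite /pr fine_probU//; last first.
- apply/seteqP; split => // w [[|] [_ HG] [_ HG']]; have := Hn _ _ HG'; apply.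
  + by left; exact: Hn HG.
  + by right; exact: Hn HG.
- exact: measurableU.
rewrite fine_probU//; last first.
  apply/seteqP; split => // w [[_ HG] [_ HG']].
  have : (U `&` V) (X n w) by split; [exact: Hn HG|exact: Hn HG'].
  by rewrite UV.
by rewrite -/(pr _) -/(pr (E U V n a b.-1 `&` _)) -/(pr (E U V n a b `&` _)) e1 e2 e3 !prodB P0W /=; ring.
Qed.

Lemma measurable_hits (U : set T) n m : measurable U ->
  measurable [set w | (m <= hits U n w)%N].
Proof.
move=> mU; have [+ _] := @prob_joint U set0 n m 0 n (fun=> setT) mU measurable0 (setI0 _) (leqnn _) (fun=> measurableT).
rewrite (_ : _ `&` _ = [set w | (m <= hits U n w)%N])//.
apply/seteqP; split => w /=; first by case=> -[].
by move=> H; split=> //; split.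
Qed.

Lemma prob_hits2 (U V : set T) n a b : measurable U -> measurable V -> U `&` V = set0 ->
  fine (P ([set w | (a <= hits U n w)%N] `&` [set w | (b <= hits V n w)%N])) =
  joint_tail (fine (P0 U)) (fine (P0 V)) n a b.
Proof.
move=> mU mV UV.
have [_] := @prob_joint U V n a b n (fun=> setT) mU mV UV (leqnn _) (fun=> measurableT).
rewrite big_geq// mulr1 => <-; rewrite /pr; congr (fine (P _)).
by apply/seteqP; split => w /=; [move=> H; split|case].
Qed.

Lemma prob_hits (U : set T) n m : measurable U ->
  fine (P [set w | (m <= hits U n w)%N]) = (bin_tail R n m).[fine (P0 U)].
Proof.
move=> mU; have := prob_hits2 n m 0 mU measurable0 (setI0 _).
rewrite joint_tailr0 => <-; congr (fine (P _)).
by apply/seteqP; split => w /=; [split|case].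
Qed.

Lemma neg_corr_hits (U V : set T) n a b : measurable U -> measurable V -> U `&` V = set0 ->
  fine (P ([set w | (a <= hits U n w)%N] `&` [set w | (b <= hits V n w)%N])) <=
  fine (P [set w | (a <= hits U n w)%N]) * fine (P [set w | (b <= hits V n w)%N]).
Proof.
move=> mU mV UV; rewrite prob_hits2// !prob_hits//.
rewrite -(joint_tailr0 (fine (P0 U)) (fine (P0 V))) -(joint_tail0l (fine (P0 U)) (fine (P0 V))).
apply: joint_tail_neg_corr; rewrite ?fine_prob_ge0//.
by rewrite -fine_probU//; apply: fine_prob_le1; exact: measurableU.
Qed.

End Counts.

(** * The Gamma function and the coefficients of the limiting score *)

Section GammaIntegral.
Variable R : realType.
Local Notation mu := (@lebesgue_measure R).
Implicit Types (a c x : R) (f F : R -> R).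

Lemma FTC_closed f F a c : a < c ->
  (forall x, a <= x <= c -> is_derive x 1 F (f x)) ->
  (forall x, a <= x <= c -> {for x, continuous f}) ->
  (\int[mu]_(x in `[a, c]) (f x)%:E)%E = (F c - F a)%:E.
Proof.
move=> ac dF cf.
have cF x : a <= x <= c -> {for x, continuous F}.
  by move=> /dF dFx; apply: differentiable_continuous; apply/derivable1_diffP; exact: ex_derive.
rewrite (@continuous_FTC2 _ f F)//.
- by apply: continuous_in_subspaceT => x /set_mem /=; rewrite in_itv/=; exact: cf.
- split.
  + move=> x; rewrite in_itv/= => /andP[ax xc].
    by have /dF dFx : a <= x <= c by rewrite !ltW//; exact: ex_derive.
  + by apply: cvg_at_right_filter; apply: cF; rewrite lexx ltW.
  + by apply: cvg_at_left_filter; apply: cF; rewrite lexx ltW.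
- move=> x; rewrite in_itv/= => /andP[ax xc].
  have /dF dFx : a <= x <= c by rewrite !ltW.
  by rewrite derive1E derive_val.
Qed.

Lemma is_derive_powR a x : 0 < x -> is_derive x 1 (@powR R ^~ a) (a * x `^ (a - 1)).
Proof.
move=> x0; apply: DeriveDef.
  by apply: derivable_powR; rewrite in_itv/= x0.
by rewrite -derive1E powR_derive1// in_itv/= x0.
Qed.

Lemma continuous_powR a x : 0 < x -> {for x, continuous (@powR R ^~ a)}.
Proof.
move=> x0; apply: differentiable_continuous; apply/derivable1_diffP.
by have d := is_derive_powR a x0; exact: ex_derive.
Qed.

(** The m-th power of c x / m.+1 <= expR (c x / m.+1); the successor avoids a division by 0 for m =
    0. *)
Lemma pow_le_expR (m : nat) c x : 0 < c -> 0 <= x ->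
  x ^+ m <= (m.+1%:R / c) ^+ m * expR (c * x).
Proof.
move=> c0 x0.
have h : x <= m.+1%:R / c * expR (c * x / m.+1%:R).
  have := expR_ge1Dx (c * x / m.+1%:R) => H.
  have {}H : c * x / m.+1%:R <= expR (c * x / m.+1%:R) by apply: le_trans H; rewrite lerDr.
  rewrite mulrAC ler_pdivlMr// mulrC [leRHS]mulrC -ler_pdivrMr ?ltr0n//.
apply: (le_trans (lerXn2r _ _ _ h)).
- by rewrite nnegrE.
- by rewrite nnegrE mulr_ge0 ?expR_ge0 ?divr_ge0// ltW.
- rewrite exprMn ler_wpM2l ?exprn_ge0 ?divr_ge0//; first exact: ltW.
  rewrite -expRM_natr ler_expR -mulrA ler_piMr ?mulr_ge0//; first exact: ltW.
  by rewrite ler_pdivrMl ?ltr0n// mulr1 ler_nat.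
Qed.

Lemma measurable_gamma_fun a c (D : set R) : measurable D ->
  measurable_fun D (fun x => x `^ (a - 1) * expR (- (c * x))).
Proof.
move=> mD; apply: measurable_funS measurableT _ _ => //.
apply: measurable_funM; first exact: measurable_powR.
by apply: measurableT_comp => //; apply: measurableT_comp => //.
Qed.

Lemma integrable_expRN c : 0 < c ->
  mu.-integrable `]0, +oo[ (fun x => (expR (- (c * x)))%:E).
Proof.
move=> c0; have Hi := integrable_exponential_pdf c0.
have : mu.-integrable `]0, +oo[ (fun x => (c^-1)%:E * (exponential_pdf c x)%:E)%E.
  by apply: integrableZl => //; exact: integrableS Hi.
apply: eq_integrable => // x; rewrite inE/= in_itv/= andbT => x0.
by rewrite exponential_pdfE ?ltW// -EFinM mulrA mulVf ?gt_eqF// mul1r mulNr.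
Qed.

(** For a < 1 the integrand is unbounded at 0, so the fundamental theorem is applied on compact
    intervals and the bound passes to the monotone limit. *)
Lemma powR_integral01 a : 0 < a ->
  (\int[mu]_(x in `]0%R, 1%R]) (x `^ (a - 1))%:E <= (a^-1)%:E)%E.
Proof.
move=> a0.
(* With [k.+2] each interval is nondegenerate, as [FTC_closed] requires. *)
pose F (k : nat) := `[k.+2%:R^-1 : R, 1]%classic.
have UF : \bigcup_k F k = `]0 : R, 1]%classic.
  apply/seteqP; split => x /=.
    by case=> k _; rewrite /F /= !in_itv/= => /andP[kx ->]; rewrite andbT (lt_le_trans _ kx).
  rewrite in_itv/= => /andP[x0 x1].
  exists (Num.truncn x^-1) => //; rewrite /F/= in_itv/= x1 andbT.
  rewrite invf_ple ?posrE//; apply: ltW; apply: (lt_le_trans (truncnS_gt _)).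
  by rewrite ler_nat.
have nd : nondecreasing_seq F.
  move=> k l kl; rewrite subsetEset => x; rewrite /F /= !in_itv/= => /andP[kx ->].
  by rewrite andbT (le_trans _ kx)// lef_pV2 ?posrE// ler_nat.
have mf D : measurable D -> measurable_fun D (fun x => (x `^ (a - 1))%:E).
  move=> mD; apply/measurable_EFinP; by apply: measurable_funS measurableT _ _ => //.
have cv : (\int[mu]_(x in F k) (x `^ (a - 1))%:E)%E @[k --> \oo] -->
    (\int[mu]_(x in `]0%R, 1%R]) (x `^ (a - 1))%:E)%E.
  rewrite -UF; apply: ge0_nondecreasing_set_cvg_integral => [//|k|k|k x _]; rewrite ?lee_fin ?powR_ge0//.
    by rewrite /F; exact: measurable_itv.
  by apply: mf; rewrite /F; exact: measurable_itv.
rewrite -(cvg_lim _ cv)//; apply: lime_le; first by apply/cvg_ex; eexists; exact: cv.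
apply: nearW => k.
have -> : (\int[mu]_(x in F k) (x `^ (a - 1))%:E)%E = (1 `^ a / a - k.+2%:R^-1 `^ a / a)%:E.
  apply: (@FTC_closed _ (fun x => x `^ a / a)).
  - by rewrite invf_lt1// ltr1n.
  - move=> x /andP[kx _]; have x0 : 0 < x by apply: lt_le_trans kx.
    have d := is_derive_powR a x0.
    by apply: is_derive_eq; rewrite scaler0 add0r /GRing.scale/=; field; nz.
  - by move=> x /andP[kx _]; apply: continuous_powR; apply: lt_le_trans kx.
rewrite lee_fin powR1 mul1r gerBl divr_ge0 ?powR_ge0//; exact: ltW.
Qed.

(** For a <= 1 the power is singular at 0 but at most 1 beyond 1; for a > 1 it is at most 1 + x ^ m
    and half of the exponential rate absorbs it. The rate is a parameter because the dominating
    functions for the binomial masses decay like expR (- x / 2). *)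
Lemma integrable_gamma a c : 0 < a -> 0 < c ->
  mu.-integrable `]0, +oo[ (fun x => (x `^ (a - 1) * expR (- (c * x)))%:E).
Proof.
move=> a0 c0.
have mg : measurable_fun (`]0, +oo[ : set R) (fun x => (x `^ (a - 1) * expR (- (c * x)))%:E).
  by apply/measurable_EFinP; exact: measurable_gamma_fun.
have [a1|a1] := leP a 1.
  apply/integrableP; split=> //.
  have f0 x : (0 <= (x `^ (a - 1) * expR (- (c * x)))%:E)%E.
    by rewrite lee_fin mulr_ge0 ?powR_ge0 ?expR_ge0.
  under eq_integral => x _ do rewrite gee0_abs//.
  have U01 : `]0, +oo[%classic = `]0, 1]%classic `|` `]1, +oo[%classic :> set R.
    apply/seteqP; split => x /=; rewrite !in_itv/= ?andbT.
      by move=> x0; have [x1|x1] := leP x 1; [left|right]; rewrite ?x0.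
    by case=> [/andP[]//|]; lra.
  rewrite U01 ge0_integral_setU//=; last 2 first.
  - by apply: measurable_funS mg => //; rewrite U01.
  - apply/disj_setPS => x /= []; rewrite !in_itv/= andbT => /andP[_]; lra.
  apply: lte_add_pinfty.
    apply: (@le_lt_trans _ _ (\int[mu]_(x in `]0%R, 1%R]) (x `^ (a - 1))%:E)%E).
      apply: ge0_le_integral => //.
      + by apply/measurable_EFinP; exact: measurable_gamma_fun.
      + apply/measurable_EFinP; by apply: measurable_funS measurableT _ _ => //.
      + move=> x; rewrite /= in_itv/= => /andP[x0 _].
        rewrite lee_fin ler_piMr ?powR_ge0// -expR0 ler_expR oppr_le0 mulr_ge0//; exact: ltW.
    by apply: (le_lt_trans (powR_integral01 a0)); rewrite ltry.
  apply: (@le_lt_trans _ _ (\int[mu]_(x in `]1%R, +oo[) (expR (- (c * x)))%:E)%E).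
    apply: ge0_le_integral => //.
    + by apply/measurable_EFinP; exact: measurable_gamma_fun.
    + apply/measurable_EFinP; by apply: measurableT_comp => //; apply: measurableT_comp => //.
    + move=> x; rewrite /= in_itv/= andbT => x1.
      rewrite lee_fin ler_piMl ?expR_ge0//.
      have h : a - 1 <= 0 by lra.
      by rewrite -[leRHS](powRr0 x); exact: (ler_powR (ltW x1) h).
  have /integrableP[_] : mu.-integrable `]1, +oo[ (fun x => (expR (- (c * x)))%:E).
    apply: integrableS (integrable_expRN c0) => //.
    by move=> x /=; rewrite !in_itv/= !andbT; lra.
  by under eq_integral => x _ do rewrite gee0_abs ?lee_fin ?expR_ge0//.
have c2 : 0 < c / 2 by lra.
pose m := Num.truncn a.
pose K := 1 + (m.+1%:R / (c / 2)) ^+ m.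
have Ki : mu.-integrable `]0, +oo[ (fun x => K%:E * (expR (- (c / 2 * x)))%:E)%E.
  by apply: integrableZl => //; exact: integrable_expRN.
apply: le_integrable Ki => //.
move=> x; rewrite /= in_itv/= andbT => x0.
have K0 : 1 <= K by rewrite /K lerDl exprn_ge0// divr_ge0// ltW.
rewrite !ger0_norm ?lee_fin ?mulr_ge0 ?powR_ge0 ?expR_ge0//; last lra.
have -> : - (c * x) = - (c / 2 * x) + - (c / 2 * x) by field.
rewrite expRD mulrA ler_wpM2r ?expR_ge0//.
rewrite expRN ler_pdivrMr ?expR_gt0//.
apply: (@le_trans _ _ (1 + x ^+ m)).
  have [x1|x1] := leP x 1.
    apply: (@le_trans _ _ 1); last by rewrite lerDl exprn_ge0// ltW.
    have h : x `^ (a - 1) <= 1 `^ (a - 1) by apply: le_powR; lra.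
    by rewrite powR1 in h.
  apply: (@le_trans _ _ (x ^+ m)); last by rewrite lerDr.
  rewrite -powR_mulrn ?(ltW x0)//.
  have h : a - 1 <= m%:R by have := truncnS_gt a; rewrite -natr1 -/m; lra.
  exact: (ler_powR (ltW x1) h).
rewrite /K mulrDl mul1r lerD//; last by apply: pow_le_expR => //; exact: ltW.
by rewrite -[leLHS]expR0 ler_expR; apply: mulr_ge0; exact: ltW.
Qed.

Lemma integrable_Gamma a : 0 < a ->
  mu.-integrable `]0, +oo[ (fun x => (x `^ (a - 1) * expR (- x))%:E).
Proof.
move=> a0; apply: eq_integrable (integrable_gamma a0 ltr01) => //.
by move=> x _; rewrite mul1r.
Qed.

Lemma EFin_Gamma a : 0 < a ->
  (\int[mu]_(x in `]0%R, +oo[) (x `^ (a - 1) * expR (- x))%:E)%E = (Gamma a)%:E.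
Proof.
move=> a0; rewrite /Gamma /Rintegral fineK//.
by apply: integrable_fin_num => //; exact: integrable_Gamma.
Qed.

(** On ]0, 1] the integrand is at least expR (- 1). Larger arguments are reached through the
    functional equation, see [gcoef_gt0]. *)
Lemma Gamma_gt0 a : 0 < a <= 1 -> 0 < Gamma a.
Proof.
move=> /andP[a0 a1]; apply: (@lt_le_trans _ _ (expR (- 1))); first exact: expR_gt0.
rewrite -lee_fin -EFin_Gamma//.
apply: (@le_trans _ _ (\int[mu]_(x in `]0%R, 1%R]) (x `^ (a - 1) * expR (- x))%:E)%E).
  apply: (@le_trans _ _ (\int[mu]_(x in `]0%R, 1%R]) (expR (- 1))%:E)%E).
    by rewrite integral_cst//= lebesgue_measure_itv/= lte_fin ltr01 oppr0 adde0 mule1.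
  apply: ge0_le_integral => //.
  - have /integrableP[mG _] := integrable_Gamma a0.
    by apply: measurable_funS mG => // x /=; rewrite !in_itv/= andbT => /andP[].
  - move=> x; rewrite /= in_itv/= => /andP[x0 x1].
    rewrite lee_fin; apply: (@le_trans _ _ (expR (- x))); first by rewrite ler_expR lerN2.
    rewrite ler_peMl ?expR_ge0//.
    have h : a - 1 <= 0 by lra.
    have x01 : 0 < x <= 1 by rewrite x0.
    by rewrite -[leLHS](powRr0 x); exact: (ger_powR x01 h).
apply: ge0_subset_integral => //.
- by case/integrableP: (integrable_Gamma a0).
- by move=> x _; rewrite lee_fin mulr_ge0 ?powR_ge0 ?expR_ge0.
- by move=> x /=; rewrite !in_itv/= andbT => /andP[].
Qed.

(** Integration by parts on [1 / (k + 2), k + 2], with primitive - x ^ a expR (- x); the boundary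
    terms [D k] vanish in the limit. *)
Lemma GammaS a : 0 < a -> Gamma (a + 1) = a * Gamma a.
Proof.
move=> a0; have a10 : 0 < a + 1 by lra.
pose F (k : nat) := `[k.+2%:R^-1 : R, k.+2%:R]%classic.
have UF : \bigcup_k F k = `]0 : R, +oo[%classic.
  apply/seteqP; split => x /=.
    by case=> k _; rewrite /F /= !in_itv/= andbT => /andP[kx _]; rewrite (lt_le_trans _ kx).
  rewrite in_itv/= andbT => x0.
  exists (Num.truncn (x^-1 + x)) => //; rewrite /F/= in_itv/=.
  have h : x^-1 + x <= (Num.truncn (x^-1 + x)).+2%:R.
    by apply: ltW; apply: (lt_le_trans (truncnS_gt _)); rewrite ler_nat.
  have xV : 0 < x^-1 by rewrite invr_gt0.
  rewrite invf_ple ?posrE//; apply/andP; split; lra.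
have nd : nondecreasing_seq F.
  move=> k l kl; rewrite subsetEset => x; rewrite /F /= !in_itv/= => /andP[kx xk].
  by rewrite (le_trans _ kx) ?(le_trans xk)//= ?lef_pV2 ?posrE// ler_nat.
have mF k : measurable (F k) by rewrite /F; exact: measurable_itv.
have FS k : F k `<=` `]0, +oo[%classic.
  by move=> x Fx; rewrite -UF; exists k.
have cv b : 0 < b -> \int[mu]_(x in F k) (x `^ (b - 1) * expR (- x)) @[k --> \oo] --> Gamma b.
  move=> b0; apply: fine_cvg; rewrite -EFin_Gamma// -UF.
  apply: ge0_nondecreasing_set_cvg_integral => // k.
    by apply: measurable_funS (FS k) _ => //; case/integrableP: (integrable_Gamma b0).
  by move=> x _; rewrite lee_fin mulr_ge0 ?powR_ge0 ?expR_ge0.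
pose D k := k.+2%:R^-1 `^ a * expR (- k.+2%:R^-1) - k.+2%:R `^ a * expR (- k.+2%:R) : R.
have ID k : \int[mu]_(x in F k) (x `^ (a + 1 - 1) * expR (- x)) =
    a * \int[mu]_(x in F k) (x `^ (a - 1) * expR (- x)) + D k.
  have ib b : 0 < b -> mu.-integrable (F k) (EFin \o (fun x => x `^ (b - 1) * expR (- x))).
    by move=> b0; apply: integrableS (integrable_Gamma b0) => //; rewrite /F; exact: measurable_itv.
  have mFk := mF k.
  pose g x := a * (x `^ (a - 1) * expR (- x)).
  have ig : mu.-integrable (F k) (EFin \o g).
    have -> : EFin \o g = (fun x : R => a%:E * (x `^ (a - 1) * expR (- x))%:E)%E by [].
    by apply: integrableZl => //; exact: ib.
  have gE : \int[mu]_(x in F k) g x = a * \int[mu]_(x in F k) (x `^ (a - 1) * expR (- x)).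
    by rewrite -RintegralZl//; exact: ib.
  suff e : \int[mu]_(x in F k) (x `^ (a + 1 - 1) * expR (- x)) - \int[mu]_(x in F k) g x = D k.
    by rewrite -gE -e [RHS]addrC subrK.
  rewrite -RintegralB//; last exact: ib.
  rewrite /Rintegral.
  have -> : (\int[mu]_(x in F k) (x `^ (a + 1 - 1) * expR (- x) - g x)%:E)%E =
      (- (k.+2%:R `^ a * expR (- k.+2%:R)) - - (k.+2%:R^-1 `^ a * expR (- k.+2%:R^-1)))%:E.
    apply: (@FTC_closed _ (fun x => - (x `^ a * expR (- x)))).
  - by rewrite (@lt_trans _ _ 1) ?invf_lt1 ?ltr1n// ltr1n.
  - move=> x /andP[kx _]; have x0 : 0 < x by apply: lt_le_trans kx.
    have d := is_derive_powR a x0.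
    by apply: is_derive_eq; rewrite /g addrK /GRing.scale/=; ring.
  - move=> x /andP[kx _]; have x0 : 0 < x by apply: lt_le_trans kx.
    have c1 := @continuous_powR (a + 1 - 1) x x0.
    have c2 := @continuous_powR (a - 1) x x0.
    have c3 : {for x, continuous (fun x => expR (- x))}.
      by apply: continuous_comp; [exact: continuousN|exact: continuous_expR].
    by apply: continuousB; [exact: continuousM|apply: continuousM; [exact: cst_continuous|exact: continuousM]].
  by rewrite /D opprK addrC.
have D0 : D k @[k --> \oo] --> (0 : R).
  have kV : k.+2%:R^-1 @[k --> \oo] --> (0 : R).
    by have /(cvg_comp _ _ (cvg_addnr 1)) := @cvg_harmonic R; under eq_fun do rewrite /= addn1.
  rewrite -[0]subr0; apply: cvgB.
    apply: (@squeeze_cvgr _ _ _ _ (fun=> 0) (fun k => k.+2%:R^-1 `^ a)).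
    - apply: nearW => k; rewrite mulr_ge0 ?powR_ge0 ?expR_ge0//=.
      by rewrite ler_piMr ?powR_ge0// -[leRHS]expR0 ler_expR oppr_le0.
    - exact: cvg_cst.
    - by have /cvg_at_rightP := powR_cvg0 a0; apply; split.
  (* [K] bounds x ^ a by half of the exponential; the other half is at most 2 / x. *)
  pose m := Num.truncn a; pose K : R := (m.+2%:R / 2^-1) ^+ m.+1.
  apply: (@squeeze_cvgr _ _ _ _ (fun=> 0) (fun k => K * 2 * k.+2%:R^-1)).
  - apply: nearW => k; rewrite mulr_ge0 ?powR_ge0 ?expR_ge0//=.
    set x : R := k.+2%:R; have x1 : 1 <= x by rewrite ler1n.
    have x0 : 0 < x by lra.
    have am : a <= m.+1%:R by exact: ltW (truncnS_gt _).
    have xa : x `^ a <= K * expR (2^-1 * x).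
      apply: le_trans (pow_le_expR m.+1 _ (ltW x0)); last by lra.
      by rewrite -powR_mulrn ?(ltW x0)//; exact: (ler_powR x1 am).
    apply: (@le_trans _ _ (K * expR (2^-1 * x) * expR (- x))).
      by rewrite ler_wpM2r ?expR_ge0.
    have K0 : 0 <= K by rewrite /K exprn_ge0// divr_ge0.
    rewrite -mulrA -expRD -mulrA ler_wpM2l//.
    have -> : 2^-1 * x + - x = - (2^-1 * x) by field.
    rewrite expRN -[leRHS]invrK lef_pV2 ?posrE ?expR_gt0 ?invr_gt0 ?mulr_gt0 ?invr_gt0//.
    rewrite invfM invrK; apply: le_trans (expR_ge1Dx _); lra.
  - exact: cvg_cst.
  - by rewrite -(mulr0 (K * 2)); apply: cvgM kV; exact: cvg_cst.
have lim : \int[mu]_(x in F k) (x `^ (a + 1 - 1) * expR (- x)) @[k --> \oo] --> a * Gamma a.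
  under eq_cvg => k do rewrite ID.
  by rewrite -[a * Gamma a]addr0; apply: cvgD => //; apply: cvgM; [exact: cvg_cst|exact: cv].
exact: (cvg_unique _ (cv _ a10) lim).
Qed.

End GammaIntegral.

Section NonnegSeries.
Variable R : realType.
Implicit Types (u : nat -> R) (K : R).

Lemma partial_sum_nd u : (forall m, (0 < m)%N -> 0 <= u m) ->
  nondecreasing_seq (fun n => \sum_(1 <= m < n) u m).
Proof.
move=> u0; apply/nondecreasing_seqP => n.
case: n => [|n]; first by rewrite !big_geq.
by rewrite [leRHS]big_nat_recr//= lerDl u0.
Qed.

Lemma bounded_series_cvg u K : (forall m, (0 < m)%N -> 0 <= u m) ->
  (forall n, \sum_(1 <= m < n) u m <= K) -> cvgn (fun n => \sum_(1 <= m < n) u m).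
Proof.
move=> u0 uK; apply: nondecreasing_is_cvgn; first exact: partial_sum_nd.
by exists K => _ [n _ <-].
Qed.

(** Serves the termwise differentiation of [E0], where the remainders of all terms can be summed
    explicitly. *)
Lemma is_derive_quadratic (f : R -> R) (s D K del : R) : 0 < del ->
  (forall h, `|h| < del -> `|f (s + h) - f s - h * D| <= K * h ^+ 2) ->
  is_derive s 1 f D.
Proof.
move=> del0 H.
suff lim : h^-1 *: (f (h *: 1 + s) - f s) @[h --> 0^'] --> D.
  by apply: DeriveDef; [apply: cvgP lim|exact: (cvg_lim _ lim)].
apply/cvgrPdist_le => e e0; near=> h.
have h0 : h != 0 by near: h; exact: nbhs_dnbhs_neq.
have hd : `|h| < del by near: h; apply: dnbhs0_lt.
have hK : `|h| < e / (`|K| + 1).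
  by near: h; apply: dnbhs0_lt; rewrite divr_gt0// ltr_wpDl.
have := H h hd => Hh.
have -> : D - h^-1 *: (f (h *: 1 + s) - f s) = - (h^-1 * (f (s + h) - f s - h * D)).
  by rewrite /GRing.scale/= mulr1 [h + s]addrC; field.
rewrite normrN normrM normfV ler_pdivrMl ?normr_gt0//.
apply: (le_trans Hh); rewrite -real_normK ?num_real// expr2 mulrA [leRHS]mulrC ler_wpM2r//.
apply: (@le_trans _ _ ((`|K| + 1) * `|h|)).
  by rewrite ler_wpM2r// (le_trans (ler_norm _))// lerDl.
by rewrite mulrC -ler_pdivlMr ?(ltW hK)// ltr_wpDl.
Unshelve. all: by end_near. Qed.

End NonnegSeries.

Section GammaCoefficients.
Variables (R : realType) (s0 : R).
Hypothesis s01 : 0 < s0 < 1.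
Implicit Types m n : nat.

Definition gcoef m : R := Gamma (m%:R + 1 - s0) / m`!%:R.

Lemma gcoefS m : gcoef m.+1 = gcoef m * (m.+1%:R - s0) / m.+1%:R.
Proof.
rewrite /gcoef; have /andP[s00 s11] := s01.
have m0 : 0 <= m%:R :> R by [].
have -> : m.+1%:R + 1 - s0 = (m%:R + 1 - s0) + 1 by rewrite -natr1; ring.
rewrite GammaS; last by lra.
rewrite factS natrM -natr1.
have f0 : (m`!%:R : R) != 0 by rewrite pnatr_eq0 -lt0n fact_gt0.
have m1 : (m%:R + 1 : R) != 0 by rewrite gt_eqF//; lra.
by field; rewrite m1 f0.
Qed.

Lemma gap_gt0 m : (0 < m)%N -> 0 < m%:R - s0.
Proof.
have /andP[s00 s11] := s01.
by case: m => // m _; rewrite -natr1; have m0 : 0 <= m%:R :> R by []; lra.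
Qed.

Lemma gcoef_gt0 m : 0 < gcoef m.
Proof.
have /andP[s00 s11] := s01.
elim: m => [|m IH].
  by rewrite /gcoef divr_gt0 ?ltr0n// Gamma_gt0// add0r; lra.
by rewrite gcoefS divr_gt0 ?ltr0n// mulr_gt0// gap_gt0.
Qed.

Lemma gcoef_ge0 m : 0 <= gcoef m. Proof. exact: ltW (gcoef_gt0 m). Qed.

Lemma gap_ge0 m : (0 < m)%N -> 0 <= m%:R - s0.
Proof. by move=> m0; exact: ltW (gap_gt0 m0). Qed.

Lemma gcoef_telescope n :
  \sum_(1 <= m < n.+1) gcoef m / (m%:R - s0) = (gcoef 0 - gcoef n) / s0.
Proof.
have /andP[s00 s11] := s01.
elim: n => [|n IH]; first by rewrite big_geq// subrr mul0r.
rewrite big_nat_recr//= IH gcoefS.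
have g := gap_gt0 (ltn0Sn n).
have n0 : n.+1%:R != 0 :> R by rewrite pnatr_eq0.
by move: (n.+1%:R) g n0 => x g n0; field; nz.
Qed.

Lemma gcoef_sum_le n : \sum_(1 <= m < n) gcoef m / (m%:R - s0) <= gcoef 0 / s0.
Proof.
have /andP[s00 s11] := s01.
have g0 := gcoef_gt0.
case: n => [|n]; first by rewrite big_geq// divr_ge0// ltW.
by rewrite gcoef_telescope ler_wpM2r ?invr_ge0 ?(ltW s00)// gerBl ltW.
Qed.

(** If all coefficients were at least [e], the bounded sums of [gcoef_sum_le] would dominate [e]
    times the harmonic series. Hence the telescoping sum exhausts [gcoef 0 / s0], which fixes the
    sign of the limiting score to the right of [s0]. *)
Lemma gcoef_small e : 0 < e -> exists n, gcoef n < e.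
Proof.
move=> e0; apply: contrapT => /forallNP H.
have {}H n : e <= gcoef n by rewrite leNgt; apply/negP/H.
have /andP[s00 s11] := s01.
apply: (@dvg_harmonic R).
apply: nondecreasing_is_cvgn.
  by apply: nondecreasing_series => // n _ _; rewrite /harmonic/= invr_ge0.
exists (gcoef 0 / s0 / e) => _ [n _ <-].
rewrite /= /series/= ler_pdivlMr// mulr_suml.
apply: le_trans (gcoef_sum_le n.+1); rewrite big_add1/=.
apply: ler_sum => i _; rewrite /harmonic/= mulrC; apply: ler_pM.
- exact: ltW.
- by rewrite invr_ge0.
- exact: H.
- by rewrite lef_pV2 ?posrE ?gap_gt0// gerBl ltW.
Qed.

(** Termwise derivative of [E0] at [s0]. The second order remainder of each term is at most a
    constant times h ^ 2 gcoef m / (m - s0), and these bounds have bounded sums. *)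
Lemma tau2_sq_cvg : \sum_(1 <= m < n) gcoef m / (m%:R - s0) ^+ 2 @[n --> \oo] -->
  tau2_sq s0 - gcoef 0 / s0 ^+ 2.
Proof.
have /andP[s00 s11] := s01.
(* Within this radius both s0 + h and each m - (s0 + h) keep at least half of their values at h =
   0. *)
pose del := Num.min (s0 / 2) ((1 - s0) / 2).
have del0 : 0 < del by rewrite lt_min !divr_gt0// subr_gt0.
have gh h m : `|h| < del -> (0 < m)%N -> (m%:R - s0) / 2 <= m%:R - (s0 + h).
  rewrite lt_min => /andP[_ hd] m0; have := gap_gt0 m0.
  have m1 : 1 <= m%:R :> R by rewrite ler1n.
  by have := ler_norm h; lra.
have gh0 h m : `|h| < del -> (0 < m)%N -> 0 < m%:R - (s0 + h).
  by move=> hd m0; apply: lt_le_trans (gh h m hd m0); rewrite divr_gt0// gap_gt0.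
pose S h n := \sum_(1 <= m < n) gcoef m / (m%:R - (s0 + h)).
have Scvg h : `|h| < del -> cvgn (S h).
  move=> hd; apply: (@bounded_series_cvg _ _ (2 * (gcoef 0 / s0))).
    by move=> m m0; rewrite divr_ge0 ?gcoef_ge0 ?(ltW (gh0 _ _ _ _)).
  move=> n; apply: (@le_trans _ _ (2 * \sum_(1 <= m < n) gcoef m / (m%:R - s0))).
    rewrite mulr_sumr; apply: ler_sum_nat => m /andP[m0 _].
    rewrite mulrCA ler_wpM2l ?gcoef_ge0//.
    by rewrite -[leRHS]invrK lef_pV2 ?posrE ?invr_gt0 ?mulr_gt0 ?invr_gt0 ?gh0 ?gap_gt0// invfM invrK mulrC gh.
  by rewrite ler_pM2l// gcoef_sum_le.
pose Q n := \sum_(1 <= m < n) gcoef m / (m%:R - s0) ^+ 2.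
have Qcvg : cvgn Q.
  apply: (@bounded_series_cvg _ _ ((1 - s0)^-1 * (gcoef 0 / s0))).
    by move=> m m0; rewrite divr_ge0 ?gcoef_ge0 ?exprn_ge0 ?gap_ge0.
  move=> n; apply: (@le_trans _ _ ((1 - s0)^-1 * \sum_(1 <= m < n) gcoef m / (m%:R - s0))).
    rewrite mulr_sumr; apply: ler_sum_nat => m /andP[m0 _].
    rewrite mulrCA ler_wpM2l ?gcoef_ge0//.
    rewrite expr2 invfM ler_wpM2r ?invr_ge0 ?gap_ge0// lef_pV2 ?posrE ?gap_gt0 ?subr_gt0//.
    by rewrite lerB// ler1n.
  by rewrite ler_pM2l ?invr_gt0 ?subr_gt0// gcoef_sum_le.
have E0S h : E0 s0 (s0 + h) = gcoef 0 / (s0 + h) - limn (S h).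
  rewrite /E0 /gcoef fact0 divr1 add0r; congr (_ - limn _); apply/funext => n.
  apply: eq_bigr => m _.
  by rewrite invfM mulrA.
have key : is_derive s0 1 (E0 s0) (- (gcoef 0 / s0 ^+ 2) - limn Q).
  (* The first summand bounds the remainder of gcoef 0 / sigma, the second that of the series. *)
  pose K := gcoef 0 * (2 / s0 ^+ 3) + 2 * (1 - s0)^-1 ^+ 2 * (gcoef 0 / s0).
  apply: (@is_derive_quadratic _ _ _ _ K del) => // h hd.
  have := E0S 0; rewrite addr0 => ->; rewrite E0S.
  have c0 := Scvg 0; rewrite normr0 in c0; have {}c0 := c0 del0.
  have ch := Scvg h hd.
  have sh : s0 / 2 <= s0 + h.
    by move: hd; rewrite lt_min => /andP[hd _]; have := ler_norm (- h); rewrite normrN; lra.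
  have sh0 : 0 < s0 + h by lra.
  (* The exact second order remainders of 1 / (m - sigma) at [s0]. *)
  pose W n := \sum_(1 <= m < n) gcoef m * h ^+ 2 / ((m%:R - (s0 + h)) * (m%:R - s0) ^+ 2).
  have WE : W = (fun n => S h n - S 0 n - h * Q n).
    apply/funext => n; rewrite /W /S /Q mulr_sumr -!sumrB.
    apply: eq_big_nat => m /andP[m0 _].
    have g1 := gh0 h m hd m0; have g2 := gap_gt0 m0.
    by rewrite addr0; field; rewrite !gt_eqF.
  have Wl : W n @[n --> \oo] --> limn (S h) - limn (S 0) - h * limn Q.
    by rewrite WE; apply: cvgB; [exact: cvgB|apply: cvgM; [exact: cvg_cst|]].
  have Wb n : `|W n| <= h ^+ 2 * (2 * (1 - s0)^-1 ^+ 2 * (gcoef 0 / s0)).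
    rewrite ger0_norm; last first.
      rewrite /W big_nat_cond; apply: sumr_ge0 => m /andP[/andP[m0 _] _].
      have g3 := ltW (gh0 h m hd m0).
      by rewrite divr_ge0// mulr_ge0// ?sqr_ge0 ?gcoef_ge0.
    apply: (@le_trans _ _ (h ^+ 2 * (2 * (1 - s0)^-1 ^+ 2 *
       \sum_(1 <= m < n) gcoef m / (m%:R - s0)))); last first.
      rewrite !ler_wpM2l ?sqr_ge0 ?mulr_ge0 ?exprn_ge0 ?invr_ge0 ?subr_ge0 ?(ltW s11)//.
      exact: gcoef_sum_le.
    rewrite mulr_sumr mulr_sumr; apply: ler_sum_nat => m /andP[m0 _].
    have g1 := gh h m hd m0; have g2 := gap_gt0 m0; have g3 := gh0 h m hd m0.
    have gc := gcoef_gt0 m.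
    rewrite -mulrA mulrCA ler_wpM2l ?sqr_ge0//.
    rewrite [leRHS]mulrCA ler_wpM2l ?gcoef_ge0//.
    have -> : 2 * (1 - s0)^-1 ^+ 2 / (m%:R - s0) = ((m%:R - s0) / 2 * (1 - s0) ^+ 2)^-1.
      by field; rewrite !gt_eqF// subr_gt0.
    have g4 : 0 < 1 - s0 by lra.
    have p1 : 0 < (m%:R - (s0 + h)) * (m%:R - s0) ^+ 2 by rewrite mulr_gt0 ?exprn_gt0.
    have p2 : 0 < (m%:R - s0) / 2 * (1 - s0) ^+ 2 by rewrite mulr_gt0 ?exprn_gt0 ?divr_gt0.
    rewrite lef_pV2 ?posrE//.
    apply: ler_pM => //.
    - by rewrite ltW// divr_gt0.
    - by rewrite exprn_ge0// ltW.
    - by rewrite lerXn2r ?nnegrE ?(ltW g4) ?(ltW g2)// lerB ?ler1n.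
  have -> : gcoef 0 / (s0 + h) - limn (S h) - (gcoef 0 / s0 - limn (S 0)) -
     h * (- (gcoef 0 / s0 ^+ 2) - limn Q) =
     gcoef 0 * h ^+ 2 / ((s0 + h) * s0 ^+ 2) - (limn (S h) - limn (S 0) - h * limn Q).
    by field; rewrite !gt_eqF.
  apply: (le_trans (ler_normB _ _)); rewrite /K [leRHS]mulrDl lerD//.
    rewrite ger0_norm; last first.
      exact: divr_ge0 (mulr_ge0 (gcoef_ge0 0) (sqr_ge0 h)) (mulr_ge0 (ltW sh0) (sqr_ge0 s0)).
    rewrite -mulrA -[leRHS]mulrA ler_wpM2l ?gcoef_ge0// mulrC ler_wpM2r ?sqr_ge0//.
    have -> : 2 / s0 ^+ 3 = (s0 / 2 * s0 ^+ 2)^-1 by field; rewrite gt_eqF.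
    rewrite lef_pV2 ?posrE ?mulr_gt0 ?exprn_gt0 ?invr_gt0//.
    by rewrite ler_wpM2r ?sqr_ge0.
  rewrite -(cvg_lim _ Wl)// -lim_norm; last by apply/cvg_ex; eexists; exact: Wl.
  rewrite mulrC; apply: limr_le; last by apply: nearW => n; exact: Wb.
  by apply/cvg_ex; eexists; apply: cvg_norm; exact: Wl.
have -> : tau2_sq s0 - gcoef 0 / s0 ^+ 2 = limn Q.
  by rewrite /tau2_sq derive1E derive_val; ring.
exact: Qcvg.
Qed.

End GammaCoefficients.

(** * Expected numbers of frequent values *)

Section BinomialTail.
Variable R : realType.
Implicit Types (p x s : R) (n m : nat).
Local Notation t := (bin_tail R).
Local Notation mu := (@lebesgue_measure R).

(** As a difference of tails it inherits their recursion, from which the derivative of the tail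
    follows by induction; [bin_massE] is the closed form. *)
Definition bin_mass n m : {poly R} := t n m - t n m.+1.

Lemma bin_massS n m : bin_mass n.+1 m.+1 = 'X * bin_mass n m + (1 - 'X) * bin_mass n m.+1.
Proof. by rewrite /bin_mass /=; ring. Qed.

Lemma bin_massS0 n : bin_mass n.+1 0 = (1 - 'X) * bin_mass n 0.
Proof. by rewrite /bin_mass /= !bin_tail0; ring. Qed.

Lemma deriv_bin_tail n m : (t n.+1 m.+1)^`() = (bin_mass n m) *+ n.+1.
Proof.
have dS k l : (t k.+1 l.+1)^`() =
    bin_mass k l + 'X * (t k l)^`() + (1 - 'X) * (t k l.+1)^`().
  by rewrite /= derivD !derivM derivB derivX derivC /bin_mass; ring.
elim: n m => [|n IH] m; rewrite dS.
  by case: m => [|m] /=; rewrite -?[1]/(1%:P) !derivC ?deriv0; ring.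
case: m => [|m].
  by rewrite IH bin_tail0 derivC bin_massS0 [RHS]mulrS mulrnAr mulr0 addr0.
by rewrite !IH [RHS]mulrS bin_massS !mulrnAr [in RHS]mulrnDl addrA.
Qed.

Lemma bin_massE n m x : (bin_mass n m).[x] = 'C(n, m)%:R * x ^+ m * (1 - x) ^+ (n - m).
Proof.
have h1X : (1 - 'X : {poly R}).[x] = 1 - x by rewrite !hornerE.
elim: n m => [|n IH] [|m].
- by rewrite /bin_mass /= ?hornerE bin0; ring.
- by rewrite bin0n /bin_mass /= ?hornerE; ring.
- by rewrite bin_massS0 hornerM h1X IH !bin0 !subn0 exprS; ring.
rewrite bin_massS hornerD !hornerM h1X hornerX !IH binS natrD subSS.
have [mn|nm] := ltnP m n.
  by rewrite -(subnSK mn) !exprS; ring.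
by rewrite (@bin_small n m.+1)// exprS; ring.
Qed.

Lemma bin_tail_horner0 n m : (t n m.+1).[0] = 0.
Proof.
by elim: n m => [|n IH] m /=; rewrite !hornerE// IH ?(mulr0, mul0r, addr0).
Qed.

(* The derivative of the tail in p is n.+1 times the mass at m. *)
Lemma bin_tail_integral n m p : 0 <= p ->
  (\int[mu]_(s in `[0%R, (n.+1%:R * p)%R]) ((bin_mass n m).[s / n.+1%:R])%:E)%E =
  ((t n.+1 m.+1).[p])%:E.
Proof.
rewrite le_eqVlt => /predU1P[<-|p0].
  rewrite mulr0 bin_tail_horner0 set_itv1 integral_set1//.
have N0 : 0 < n.+1%:R :> R by rewrite ltr0n.
have -> : (t n.+1 m.+1).[p] = (t n.+1 m.+1).[n.+1%:R * p / n.+1%:R] - (t n.+1 m.+1).[0 / n.+1%:R].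
  by rewrite mul0r bin_tail_horner0 subr0 mulrAC divff ?gt_eqF// mul1r.
apply: (@FTC_closed _ _ (fun s => (t n.+1 m.+1).[s / n.+1%:R])).
- by rewrite mulr_gt0.
- move=> s _.
  have d1 : is_derive s 1 (fun s : R => s / n.+1%:R) n.+1%:R^-1.
    by apply: is_derive_eq; rewrite ?scaler0 ?addr0 ?add0r /GRing.scale/= mulr1.
  have d2 := is_derive_poly (t n.+1 m.+1) (s / n.+1%:R).
  have := @is_derive1_comp _ (horner (t n.+1 m.+1)) (fun s : R => s / n.+1%:R) s _ _ d2 d1.
  rewrite deriv_bin_tail hornerMn -mulr_natr => d.
  by apply: is_derive_eq; field; nz.
- move=> s _.
  apply: (@continuous_comp _ _ _ (fun s : R => s / n.+1%:R) (horner (bin_mass n m))).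
    by apply: mulrr_continuous.
  exact: continuous_horner.
Qed.

Lemma bin_tail_le1 n m p : 0 <= p <= 1 -> (t n m).[p] <= 1.
Proof.
move=> /andP[p0 p1]; elim: n m => [|n IH] [|m] /=; rewrite ?hornerE//.
rewrite ?hornerE; have := IH m; have := IH m.+1.
have p1' : 0 <= 1 - p by lra.
by move=> /(ler_wpM2l p1') + /(ler_wpM2l p0); lra.
Qed.

Lemma bin_tail_markov n m p : 0 <= p <= 1 -> m%:R * (t n m).[p] <= n%:R * p.
Proof.
move=> /andP[p0 p1]; elim: n m => [|n IH] [|m] /=; rewrite ?hornerE ?mul0r ?mulr0//.
  by rewrite mulr_ge0.
rewrite ?hornerE; have := IH m; have := IH m.+1.
have p1' : 0 <= 1 - p by lra.
have tm : (t n m).[p] <= 1 by apply: bin_tail_le1; rewrite p0.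
move=> /(ler_wpM2l p1') + /(ler_wpM2l p0); have := ler_wpM2l p0 tm.
rewrite -!natr1; lra.
Qed.

Lemma bin_tail_min n m p : 0 <= p <= 1 -> (0 < m)%N ->
  (t n m).[p] <= Num.min 1 (n%:R / m%:R * p).
Proof.
move=> p01 m0; rewrite le_min bin_tail_le1//=.
by rewrite mulrAC ler_pdivlMr ?ltr0n// mulrC bin_tail_markov.
Qed.

End BinomialTail.

Section BinomialLimit.
Variable R : realType.
Implicit Types (s x : R) (n m : nat).

Lemma cvg_bin_ratio m :
  'C(n, m)%:R / n.+1%:R ^+ m @[n --> \oo] --> (m`!%:R^-1 : R).
Proof.
elim: m => [|m IH].
  have -> : (fun n => 'C(n, 0)%:R / n.+1%:R ^+ 0 : R) = (fun=> 0`!%:R^-1); last exact: cvg_cst.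
  by apply/funext => n; rewrite bin0 fact0; field.
have h : (n%:R - m%:R) / n.+1%:R @[n --> \oo] --> (1 : R).
  have -> : (fun n => (n%:R - m%:R) / n.+1%:R : R) = (fun n => 1 - (m%:R + 1) * n.+1%:R^-1).
    by apply/funext => n; rewrite -natr1; field; rewrite gt_eqF// ltr_wpDl.
  rewrite -[X in _ --> X]subr0 -(mulr0 (m%:R + 1)).
  by apply: cvgB; [exact: cvg_cst|apply: cvgM; [exact: cvg_cst|exact: cvg_harmonic]].
have -> : (m.+1`!%:R^-1 : R) = m`!%:R^-1 * 1 * m.+1%:R^-1.
  by rewrite factS natrM invfM mulr1 mulrC.
apply: cvg_trans (cvgM (cvgM IH h) (cvg_cst _)).
apply: near_eq_cvg; near=> n.
have mn : (m <= n)%N by near: n; exact: nbhs_infty_ge.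
rewrite /= -natrB// exprS.
have := congr1 (fun k : nat => k%:R : R) (mul_bin_left n m).
rewrite !natrM => e.
have N0 : n.+1%:R != 0 :> R by rewrite pnatr_eq0.
have M0 : m.+1%:R != 0 :> R by rewrite pnatr_eq0.
move: (n.+1%:R) N0 (m.+1%:R) M0 e => N N0 M M0 e.
have -> : 'C(n, m.+1)%:R = (n - m)%:R * 'C(n, m)%:R / M :> R by rewrite -e; field.
have Nm : N ^+ m != 0 by rewrite expf_neq0.
by field; nz.
Unshelve. all: by end_near. Qed.

Lemma expR_bounds x : x < 1 -> expR (- (x / (1 - x))) <= 1 - x <= expR (- x).
Proof.
move=> x1; apply/andP; split; last by have := expR_ge1Dx (- x).
have x1' : 0 < 1 - x by lra.
rewrite expRN -[leRHS]invrK lef_pV2 ?posrE ?expR_gt0 ?invr_gt0//.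
apply: le_trans (expR_ge1Dx _); apply: eq_ler; field; nz.
Qed.

(** Poisson approximation. The power of 1 - s / n.+1 is squeezed by [expR_bounds], whose two
    exponents have the same limit. *)
Lemma cvg_bin_mass m s : 0 < s ->
  (bin_mass R n m).[s / n.+1%:R] @[n --> \oo] --> s ^+ m * expR (- s) / m`!%:R.
Proof.
move=> s0.
have V0 : n.+1%:R^-1 @[n --> \oo] --> (0 : R) by exact: cvg_harmonic.
have x0 : s / n.+1%:R @[n --> \oo] --> (0 : R).
  by rewrite -(mulr0 s); apply: cvgM => //; exact: cvg_cst.
have y0 : (n - m)%:R * (s / n.+1%:R) @[n --> \oo] --> s.
  have : s - (m%:R + 1) * (s / n.+1%:R) @[n --> \oo] --> s - (m%:R + 1) * 0.
    by apply: cvgB; [exact: cvg_cst|apply: cvgM => //; exact: cvg_cst].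
  rewrite mulr0 subr0; apply: cvg_trans; apply: near_eq_cvg; near=> n.
  have mn : (m <= n)%N by near: n; exact: nbhs_infty_ge.
  by rewrite natrB// -natr1; field; rewrite gt_eqF// ltr_wpDl.
have lim : (1 - s / n.+1%:R) ^+ (n - m) @[n --> \oo] --> expR (- s).
  apply: (@squeeze_cvgr _ _ _ _
    (fun n => expR (- ((n - m)%:R * (s / n.+1%:R) / (1 - s / n.+1%:R))))
    (fun n => expR (- ((n - m)%:R * (s / n.+1%:R))))).
  - near=> n.
    have x1 : s / n.+1%:R < 1.
      rewrite ltr_pdivrMr ?ltr0n// mul1r.
      have : (Num.truncn s < n)%N by near: n; exact: nbhs_infty_gt.
      by move=> h; apply: (lt_trans (truncnS_gt _)); rewrite ltr_nat.
    have /andP[h1 h2] := expR_bounds x1.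
    set x := s / n.+1%:R in x1 h1 h2 *; set k := (n - m)%N.
    have -> : - (k%:R * x / (1 - x)) = - (x / (1 - x)) * k%:R by ring.
    have -> : - (k%:R * x) = - x * k%:R by ring.
    have x1' : 0 <= 1 - x by rewrite subr_ge0 ltW.
    by rewrite !expRM_natr !lerXn2r ?nnegrE ?expR_ge0.
  - apply: continuous_cvg; first exact: continuous_expR.
    apply: cvgN; rewrite -[s in X in _ --> X](divr1 s) -[X in _ / X]subr0.
    apply: cvgM => //; apply: cvgV; first by rewrite subr0 oner_neq0.
    by apply: cvgB => //; exact: cvg_cst.
  - by apply: continuous_cvg; [exact: continuous_expR|exact: cvgN].
have -> : s ^+ m * expR (- s) / m`!%:R = m`!%:R^-1 * s ^+ m * expR (- s) by rewrite mulrC mulrA.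
have : 'C(n, m)%:R / n.+1%:R ^+ m * s ^+ m * (1 - s / n.+1%:R) ^+ (n - m) @[n --> \oo] -->
    m`!%:R^-1 * s ^+ m * expR (- s).
  by apply: cvgM lim; apply: cvgM; [exact: cvg_bin_ratio|exact: cvg_cst].
apply: cvg_trans; apply: near_eq_cvg; apply: nearW => n.
rewrite bin_massE exprMn exprVn; congr (_ * _).
by rewrite [in RHS]mulrA mulrAC.
Unshelve. all: by end_near. Qed.

(** A bound free of n, for dominated convergence: 'C(n, m) is at most n.+1 ^ m, which cancels the
    scaling, and [m.*2 < n] gives (n - m) / n.+1 >= 1 / 2, the rate kept in the exponential. *)
Lemma bin_mass_le n m s : (m.*2 < n)%N -> 0 <= s <= n.+1%:R ->
  0 <= (bin_mass R n m).[s / n.+1%:R] <= s ^+ m * expR (- (2^-1 * s)).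
Proof.
move=> mn /andP[s0 sn]; rewrite bin_massE.
have N0 : 0 < n.+1%:R :> R by rewrite ltr0n.
have x0 : 0 <= s / n.+1%:R by rewrite divr_ge0// ltW.
have x1 : s / n.+1%:R <= 1 by rewrite ler_pdivrMr// mul1r.
rewrite !mulr_ge0 ?exprn_ge0 ?subr_ge0//=.
apply: ler_pM; rewrite ?mulr_ge0 ?exprn_ge0 ?subr_ge0//.
  rewrite exprMn mulrCA -[leRHS]mulr1 ler_wpM2l ?exprn_ge0// exprVn ler_pdivrMr ?exprn_gt0// mul1r.
  rewrite -natrX ler_nat.
  have := leq_pmull 'C(n, m) (fact_gt0 m); rewrite mulnC bin_ffact => /leq_trans; apply.
  elim: m {mn} => [|m IH]; first by rewrite ffactn0 expn0.
  by rewrite ffactnSr expnSr leq_mul// (leq_trans (leq_subr _ _)).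
have h := expR_ge1Dx (- (s / n.+1%:R)).
apply: (le_trans (lerXn2r _ _ _ h)); rewrite ?nnegrE ?expR_ge0 ?subr_ge0//.
rewrite -expRM_natr ler_expR mulNr lerN2 mulrAC ler_pdivlMr// -mulrA [leLHS]mulrC -mulrA ler_wpM2l//.
by rewrite ler_pdivrMr// -natrM ler_nat; lia.
Qed.

End BinomialLimit.

Lemma nat_ub (R : realType) (x : R) : exists d : nat, x <= d%:R.
Proof. by exists (Num.truncn x).+1; exact: ltW (truncnS_gt _). Qed.

Lemma powR_expr (R : realType) (x r : R) (l : nat) : 0 <= x ->
  (x ^+ l) `^ r = (x `^ r) ^+ l.
Proof.
move=> x0; elim: l => [|l IH]; first by rewrite !expr0 powR1.
by rewrite !exprS powRM ?exprn_ge0// IH.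
Qed.

Section Occupancy.
Variables (R : realType) (s0 : R) (a : R -> R) (p : nat -> R).
Hypothesis s01 : 0 < s0 < 1.
Hypothesis a_ge0 : forall t, 0 <= a t.
Hypothesis a_mono : forall x y, x <= y -> a x <= a y.
Hypothesis a_rv : forall u, 0 < u -> a (t * u) / a t @[t --> +oo] --> u `^ s0.
Hypothesis p01 : forall k, 0 <= p k <= 1.
Hypothesis count_le : forall (x : R) J, 0 < x -> \sum_(k < J) (x <= p k)%R%:R <= a x^-1.
Hypothesis count_eq : forall (x : R) J, 0 < x -> (forall k, (J <= k)%N -> p k < x) ->
  \sum_(k < J) (x <= p k)%R%:R = a x^-1.
Local Notation mu := (@lebesgue_measure R).

Definition mean_tail n m J := \sum_(k < J) (bin_tail R n m).[p k].

(** By [bin_tail_integral], the tail of cell k is the integral of the mass over s <= n.+1 * p k.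
    Summed over k, the indicators of these ranges count the cells of mass at least s / n.+1, which
    brings in [a] at n.+1 / s. *)
Let piece n m k : R -> R :=
  (fun s => (bin_mass R n m).[s / n.+1%:R]) \_ `]0, n.+1%:R * p k].

Let pieceE n m k s : 0 < s ->
  piece n m k s = (bin_mass R n m).[s / n.+1%:R] * (s / n.+1%:R <= p k)%R%:R.
Proof.
move=> s_gt0; rewrite /piece patchE ler_pdivrMr ?ltr0n// [p k * _]mulrC.
case: ifPn => [|].
  by rewrite inE/= in_itv/= => /andP[_ ->]; rewrite mulr1.
rewrite notin_setE/= in_itv/= s_gt0/= => /negP/negbTE ->.
by rewrite mulr0.
Qed.

Let piece_ge0 n m k s : 0 <= piece n m k s.
Proof.
rewrite /piece patchE; case: ifPn => //.
rewrite inE/= in_itv/= => /andP[s_gt0 sp].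
have /andP[p0 p1] := p01 k.
have x1 : s / n.+1%:R <= 1.
  by rewrite ler_pdivrMr ?ltr0n// mul1r (le_trans sp)// ler_piMr.
by rewrite bin_massE !mulr_ge0 ?exprn_ge0 ?divr_ge0 ?subr_ge0// ltW.
Qed.

Let measurable_bin_mass n m (D : set R) : measurable D ->
  measurable_fun D (fun s : R => (bin_mass R n m).[s / n.+1%:R]).
Proof.
move=> mD; apply: measurable_funS measurableT _ _ => //.
apply: continuous_measurable_fun => s.
apply: (@continuous_comp _ _ _ (fun s : R => s / n.+1%:R) (horner (bin_mass R n m))).
  by apply: mulrr_continuous.
exact: continuous_horner.
Qed.

Let measurable_piece n m k (D : set R) : measurable D -> measurable_fun D (piece n m k).
Proof.
move=> mD; apply: measurable_funS measurableT _ _ => //.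
by apply/(measurable_restrictT _ _).1 => //; exact: measurable_bin_mass.
Qed.

Let integral_piece n m k :
  (\int[mu]_(s in `]0%R, +oo[) (piece n m k s)%:E)%E = ((bin_tail R n.+1 m.+1).[p k])%:E.
Proof.
have /andP[p0 p1] := p01 k.
rewrite -bin_tail_integral//.
rewrite -integral_itv_obnd_cbnd; last by apply/measurable_EFinP; exact: measurable_bin_mass.
rewrite [RHS]integral_mkcond [LHS]integral_mkcond; apply: eq_integral => s _.
rewrite /piece /patch; case: ifPn => h1; case: ifPn => h2 //=.
move: h2; rewrite inE/= in_itv/= => /andP[h _].
by move: h1; rewrite notin_setE/= in_itv/= h.
Qed.

Lemma mean_tail_integral n m J :
  (\int[mu]_(s in `]0%R, +oo[) (\sum_(k < J) piece n m k s)%:E)%E =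
  (mean_tail n.+1 m.+1 J)%:E.
Proof.
under eq_integral => s _ do rewrite -sumEFin.
rewrite ge0_integral_sum//; last 2 first.
- by move=> k; apply/measurable_EFinP; exact: measurable_piece.
- by move=> k s _; rewrite lee_fin piece_ge0.
by rewrite /mean_tail -sumEFin; apply: eq_bigr => k _; exact: integral_piece.
Qed.

(** After division by [a], the integrand is a binomial mass times a (n / s) / a n. It tends to s ^ m
    expR (- s) / m! times s ^ (- s0), and the integral of this limit is Gamma (m + 1 - s0) / m!. *)
Lemma mean_tail_cvg m (J : nat -> nat) :
  (forall n k, (J n <= k)%N -> p k < (n.+1%:R ^+ 2)^-1) ->
  mean_tail n m.+1 (J n) / a n%:R @[n --> \oo] --> gcoef s0 m.
Proof.
move=> Jp; have /andP[s00 s11] := s01.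
(* Above [s0] for the Potter bound, below 1 so that s ^ (m - eta) is integrable at 0 even for m =
   0. *)
pose eta := (1 + s0) / 2.
have s0eta : s0 < eta by rewrite /eta; lra.
have eta1 : eta < 1 by rewrite /eta; lra.
have eta0 : 0 < eta by rewrite /eta; lra.
have [t0 t01 pot] := potter_upper s00 a_ge0 a_mono a_rv s0eta.
have [t1 t11 apos] := near_pinfty_ex (rv_gt0 a_ge0 a_rv).
have [d0 t0d] := nat_ub t0; have [d1 t1d] := nat_ub t1.
(* Dominated convergence asks for a bound at every index, so the sequence is shifted past the
   thresholds of [bin_mass_le], of the Potter bound and of the positivity of [a]. *)
pose n0 := (m.*2 + d0 + d1)%N.+1.
have n0d n : (d0 <= (n + n0).+1)%N /\ (d1 <= (n + n0).+1)%N by rewrite /n0; clear; lia.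
have n0m n : (m.*2 < n + n0)%N by rewrite /n0; clear; lia.
have n0t n : t0 <= (n + n0).+1%:R /\ t1 <= (n + n0).+1%:R.
  have [h0 h1] := n0d n.
  by split; [apply: (le_trans t0d)|apply: (le_trans t1d)]; rewrite ler_nat.
rewrite -(cvg_shiftn n0.+1).
pose f_ n s : \bar R := ((\sum_(k < J (n + n0).+1) piece (n + n0) m k s) / a (n + n0).+1%:R)%:E.
pose f s : \bar R := (s `^ (m%:R + 1 - s0 - 1) * expR (- s) * m`!%:R^-1)%:E.
(* The first summand serves s >= 1, where monotonicity of [a] suffices; the second serves s < 1, by
   the Potter bound. *)
pose g s : \bar R := ((s `^ (m%:R + 1 - 1) * expR (- (2^-1 * s)))%:E +
  (2 `^ eta)%:E * (s `^ (m%:R + 1 - eta - 1) * expR (- (2^-1 * s)))%:E)%E.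
have m0 : 0 <= m%:R :> R by [].
have intf : (\int[mu]_(s in `]0%R, +oo[) f s)%E = (gcoef s0 m)%:E.
  rewrite /f; under eq_integral => s _ do rewrite EFinM.
  rewrite ge0_integralZr//.
  - by rewrite EFin_Gamma -?EFinM//; lra.
  - have /integrableP[] // : mu.-integrable `]0, +oo[ (fun s => (s `^ (m%:R + 1 - s0 - 1) * expR (- s))%:E).
    by apply: integrable_Gamma; lra.
  - by move=> s _; rewrite lee_fin mulr_ge0 ?powR_ge0 ?expR_ge0.
have [] := @dominated_convergence _ _ R mu `]0, +oo[%classic (measurable_itv _) f_ f g.
- move=> n; apply/measurable_EFinP; apply: measurable_funM => //.
  by apply: measurable_sum => k; exact: measurable_piece.
- apply/measurable_EFinP; apply: measurable_funM => //.
  have ms : 0 < m%:R + 1 - s0 by lra.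
  by have /integrableP[/measurable_EFinP mG _] := integrable_Gamma ms.
- apply: aeW => s; rewrite /= in_itv/= andbT => s_gt0.
  apply/fine_cvgP; split; first exact: nearW.
  have ny : (n.+1%:R : R) @[n --> \oo] --> +oo.
    apply/cvgryPge => A; have [dA Ad] := nat_ub A; near=> n.
    have dn : (dA <= n)%N by near: n; exact: nbhs_infty_ge.
    by apply: (le_trans Ad); rewrite ler_nat ltnW.
  have sV : 0 < s^-1 by rewrite invr_gt0.
  have [ds sds] := nat_ub s^-1.
  have lim : (bin_mass R n m).[s / n.+1%:R] * (a (n.+1%:R * s^-1) / a n.+1%:R) @[n --> \oo] -->
      s ^+ m * expR (- s) / m`!%:R * s^-1 `^ s0.
    by apply: cvgM; [exact: cvg_bin_mass|exact: (cvg_comp _ _ ny (a_rv sV))].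
  have fE : s `^ (m%:R + 1 - s0 - 1) * expR (- s) * m`!%:R^-1 =
      s ^+ m * expR (- s) / m`!%:R * s^-1 `^ s0.
    have -> : m%:R + 1 - s0 - 1 = m%:R + - s0 by ring.
    by rewrite powRDp// powR_mulrn ?(ltW s_gt0)// powRVp// powRN; ring.
  rewrite /f fE /f_; rewrite -(cvg_shiftn n0) in lim.
  apply: cvg_trans lim; apply: near_eq_cvg; near=> n => /=.
  under eq_bigr do rewrite pieceE//.
  rewrite -mulr_sumr -mulrA; congr (_ * (_ / _)).
  have N0 : 0 < (n + n0).+1%:R :> R by rewrite ltr0n.
  (* For fixed [s], the level s / n eventually exceeds the masses of the omitted cells, which are
     below the inverse square of the index. *)
  rewrite count_eq ?divr_gt0// ?invf_div// => k /Jp; move/lt_trans; apply.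
  rewrite ltr_pdivlMr//.
  have sn : s^-1 < (n + n0).+1%:R.
    have dn : (ds <= n)%N by near: n; exact: nbhs_infty_ge.
    by apply: (le_lt_trans sds); rewrite ltr_nat ltnS (leq_trans dn)// leq_addr.
  rewrite invf_plt ?posrE// in sn; apply: lt_trans sn.
  set N := (n + n0).+1 in N0 *.
  have N10 : 0 < N.+1%:R :> R by rewrite ltr0n.
  rewrite -ltr_pdivlMr// -invfM ltf_pV2 ?posrE ?exprn_gt0 ?mulr_gt0//.
  by rewrite -natrM -natrX ltr_nat -mulnn ltn_mul.
- apply: integrableD => //; first by apply: integrable_gamma; lra.
  by apply: integrableZl => //; apply: integrable_gamma; lra.
- apply: aeW => s n; rewrite /= in_itv/= andbT => s_gt0.
  have [nt0 nt1] := n0t n; have mN := n0m n.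
  rewrite /f_ /g -EFinM -EFinD lee_fin.
  move: (n + n0)%N nt0 nt1 mN => N nt0 nt1 mN.
  have N0 : 0 < N.+1%:R :> R by rewrite ltr0n.
  have aN := apos _ nt1.
  rewrite ger0_norm ?divr_ge0 ?sumr_ge0// ler_pdivrMr//.
  have sE b : s `^ (m%:R + 1 - b - 1) = s ^+ m * s^-1 `^ b.
    have -> : m%:R + 1 - b - 1 = m%:R + - b by ring.
    by rewrite powRDp// powR_mulrn ?(ltW s_gt0)// powRVp// powRN.
  have -> : s `^ (m%:R + 1 - 1) = s ^+ m by rewrite addrK powR_mulrn// ltW.
  rewrite sE; under eq_bigr do rewrite pieceE//; rewrite -mulr_sumr.
  rewrite (_ : _ * a _ = s ^+ m * expR (- (2^-1 * s)) * ((1 + 2 `^ eta * s^-1 `^ eta) * a N.+1%:R)); last by ring.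
  have [sN|sN] := leP s N.+1%:R; last first.
    rewrite big1 ?mulr0.
      by rewrite !mulr_ge0 ?exprn_ge0 ?expR_ge0 ?addr_ge0 ?mulr_ge0 ?powR_ge0// ltW.
    move=> k _; have /andP[_ p1] := p01 k.
    rewrite leNgt (le_lt_trans p1)// ltr_pdivlMr// mul1r//.
  have /andP[q0 q1] : 0 <= (bin_mass R N m).[s / N.+1%:R] <= s ^+ m * expR (- (2^-1 * s)).
    by apply: bin_mass_le => //; rewrite (ltW s_gt0).
  apply: ler_pM => //; first by rewrite sumr_ge0.
  apply: (le_trans (count_le _ _)); first by rewrite divr_gt0.
  rewrite invf_div.
  have [s1|s1] := leP 1 s.
    apply: (@le_trans _ _ (a N.+1%:R)).
      by apply: a_mono; rewrite ler_pdivrMr// ler_peMr// ltW.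
    by rewrite ler_peMl ?(ltW aN)// lerDl mulr_ge0 ?powR_ge0.
  apply: (@le_trans _ _ (2 `^ eta * s^-1 `^ eta * a N.+1%:R)).
    by apply: pot => //; rewrite invf_ge1// ltW.
  by rewrite ler_wpM2r ?(ltW aN)// lerDr.
move=> _ _; rewrite intf => lim.
have /fine_cvgP[_] := lim.
apply: cvg_trans; apply: near_eq_cvg; apply: nearW => n /=.
have -> : (\int[mu]_(x in `]0%R, +oo[) f_ n x)%E =
    (mean_tail (n + n0).+1 m.+1 (J (n + n0).+1) / a (n + n0).+1%:R)%:E.
  rewrite EFinM -mean_tail_integral /f_.
  under eq_integral => s _ do rewrite EFinM.
  rewrite ge0_integralZr//.
  - by apply/measurable_EFinP; apply: measurable_sum => k; exact: measurable_piece.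
  - by move=> s _; rewrite lee_fin sumr_ge0.
  - by rewrite lee_fin invr_ge0.
by rewrite addnS.
Unshelve. all: by end_near. Qed.

(** By [bin_tail_min], a mean tail is at most [G J (n / m)]. At most [a (2 * t)] cells have mass at
    least 1 / (2 t); on the others the summand is half of that of [G J (2 * t)]. This yields a
    recursion along t, 2 t, 4 t, ... *)
Let G J t := \sum_(k < J) Num.min 1 (t * p k).

Let G_mono J t t' : t <= t' -> G J t <= G J t'.
Proof.
move=> tt'; apply: ler_sum => k _; have /andP[p0 _] := p01 k.
by rewrite le_min !ge_min lexx/= ler_wpM2r// orbT.
Qed.

Let G_step J t : 0 < t -> G J t <= a (2 * t) + G J (2 * t) / 2.
Proof.
move=> t0; have t20 : 0 < (2 * t)^-1 by rewrite invr_gt0 mulr_gt0.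
apply: (@le_trans _ _ (\sum_(k < J) ((2 * t)^-1 <= p k)%R%:R + G J (2 * t) / 2)).
  rewrite /G mulr_suml -big_split/=; apply: ler_sum => k _.
  have /andP[p0 _] := p01 k; have tp : 0 <= t * p k by rewrite mulr_ge0// ltW.
  have [h|h] := leP (2 * t)^-1 (p k).
    rewrite ge_min; apply/orP; left; rewrite lerDl divr_ge0// le_min ler01/=.
    by rewrite -mulrA mulr_ge0.
  have {}h : 2 * t * p k < 1 by rewrite mulrC -ltr_pdivlMr ?mulr_gt0// mul1r.
  rewrite /= add0r (min_idPr (ltW h)) ge_min; apply/orP; right.
  by apply: eq_ler; field.
by rewrite lerD2r (le_trans (count_le _ t20))// invrK.
Qed.

Let G_iter J t i : 0 < t ->
  G J t <= \sum_(l < i) 2^-1 ^+ l * a (2 ^+ l * (2 * t)) + 2^-1 ^+ i * G J (2 ^+ i * t).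
Proof.
move=> t0; elim: i => [|i IH]; first by rewrite big_ord0 !expr0 !mul1r add0r.
apply: (le_trans IH); rewrite big_ord_recr/= -addrA lerD2l.
have h := @G_step J (2 ^+ i * t); rewrite mulrCA in h.
have {}h := h (mulr_gt0 (exprn_gt0 i (ltr0Sn R 1)) t0).
have i0 : 0 <= 2^-1 ^+ i :> R by rewrite exprn_ge0.
have := ler_wpM2l i0 h; rewrite [2 ^+ i.+1]exprS [2^-1 ^+ i.+1]exprS -[2 * 2 ^+ i * t]mulrA [2 * (2 ^+ i * t)]mulrCA; lra.
Qed.

(** The iterated recursion is dominated by a geometric series of ratio 2 ^ (eta - 1) < 1. Its
    remainder is at most J / 2 ^ i, which vanishes as i grows, so the constant is free of [J]. *)
Let G_le : exists2 t0, 1 <= t0 & exists2 B, 0 < B &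
  forall J t, t0 <= t -> G J t <= B * a (2 * t).
Proof.
have /andP[s00 s11] := s01.
pose eta := (1 + s0) / 2.
have s0eta : s0 < eta by rewrite /eta; lra.
have [t0 t01 pot] := potter_upper s00 a_ge0 a_mono a_rv s0eta.
pose r : R := 2^-1 * 2 `^ eta.
have r0 : 0 <= r by rewrite mulr_ge0 ?powR_ge0.
have r1 : r < 1.
  rewrite /r mulrC ltr_pdivrMr// mul1r -[ltRHS]powRr1//.
  by apply: gt1_ltr_powR; rewrite ?ltr1n// /eta; lra.
have r1' : 0 < 1 - r by lra.
exists t0 => //; exists (2 `^ eta / (1 - r)); first by rewrite divr_gt0 ?powR_gt0.
move=> J t t0t; have tp : 0 < t by lra.
apply/ler_addgt0Pr => e e0.
pose i := (Num.truncn (J%:R / e)).+1.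
apply: (le_trans (G_iter J i tp)); apply: lerD.
  apply: (@le_trans _ _ (\sum_(l < i) 2 `^ eta * a (2 * t) * r ^+ l)).
    apply: ler_sum => l _.
    have l1 : 1 <= 2 ^+ l :> R by rewrite exprn_ege1// ler1n.
    have t2 : t0 <= 2 * t by lra.
    have := pot _ _ t2 l1; rewrite mulrC.
    have -> : (2 ^+ l) `^ eta = (2 `^ eta) ^+ l :> R.
      by apply: powR_expr.
    move=> h; rewrite /r exprMn.
    have -> : 2 `^ eta * a (2 * t) * (2^-1 ^+ l * 2 `^ eta ^+ l) =
      2^-1 ^+ l * (2 `^ eta * 2 `^ eta ^+ l * a (2 * t)) by ring.
    by rewrite ler_wpM2l// exprn_ge0.
  rewrite -mulr_sumr mulrAC ler_wpM2r//.
  rewrite ler_wpM2l ?powR_ge0// -[leRHS]mul1r ler_pdivlMr//.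
  have := subrX1 r i; have := exprn_ge0 i r0; lra.
have GJ : G J (2 ^+ i * t) <= J%:R.
  have -> : J%:R = \sum_(k < J) (1 : R) by rewrite sumr_const card_ord.
  by apply: ler_sum => k _; rewrite ge_min lexx.
rewrite exprVn ler_pdivrMl ?exprn_gt0//; apply: (le_trans GJ).
rewrite -ler_pdivrMr//; apply: (le_trans (ltW (truncnS_gt _))).
by rewrite -natrX ler_nat -/i ltnW// ltn_expl.
Qed.

(** Markov's inequality reduces level m to a multiple of [a (n / m)], and the lower Potter bound
    with exponent s0 / 2 compares this with [a n]. *)
Lemma mean_tail_le : exists2 K : R, 0 < K & exists2 t0 : R, 1 <= t0 & forall J n m,
  (0 < m <= n)%N -> t0 <= n%:R ->
  mean_tail n m J <= K * (m%:R `^ (s0 / 2))^-1 * a n%:R.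
Proof.
have /andP[s00 s11] := s01.
pose eta := (1 + s0) / 2; pose rho := s0 / 2.
have s0eta : s0 < eta by rewrite /eta; lra.
have rho0 : 0 < rho < s0 by rewrite /rho; lra.
have [ta ta1 [B B0 GB]] := G_le.
have [tb tb1 potu] := potter_upper s00 a_ge0 a_mono a_rv s0eta.
have [tc tc1 potl] := potter_lower a_ge0 a_mono a_rv rho0.
pose t0 := ta + tb + tc.
have t01 : 1 <= t0 by rewrite /t0; lra.
pose K := B * (2 `^ eta * 2 `^ eta) * (2 `^ rho * t0 `^ rho).
have K0 : 0 < K by rewrite /K !mulr_gt0 ?powR_gt0//; lra.
exists K => //; exists t0 => // J n m /andP[m0 mn] nt0.
have m0' : 0 < m%:R :> R by rewrite ltr0n.
have n0' : 0 < n%:R :> R by lra.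
(* For m close to n, the point n / m may lie below the Potter threshold; moving it up to [t0] costs
   the factor t0 ^ rho in [K]. *)
pose T := Num.max (n%:R / m%:R) t0.
have Tt0 : t0 <= T by rewrite le_max lexx orbT.
have mn1 : 1 <= n%:R / m%:R :> R by rewrite ler_pdivlMr// mul1r ler_nat.
have Tn : T <= n%:R.
  rewrite ge_max nt0 andbT ler_pdivrMr// ler_peMr ?(ltW n0')//.
  by rewrite ler1n.
have TM : T / n%:R <= t0 / m%:R.
  rewrite ler_pdivrMr// mulrAC -mulrA ge_max; apply/andP; split.
    by rewrite ler_peMl// divr_ge0// ltW.
  by rewrite ler_peMr//; lra.
apply: (@le_trans _ _ (G J (n%:R / m%:R))).
  by apply: ler_sum => k _; exact: bin_tail_min.
apply: (@le_trans _ _ (G J T)); first by apply: G_mono; rewrite le_max lexx.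
apply: (le_trans (GB J T _)); first by apply: le_trans Tt0; rewrite /t0; lra.
have h1 : a (2 * T) <= 2 `^ eta * 2 `^ eta * a T.
  rewrite mulrC; apply: potu; last by rewrite ler1n.
  by apply: le_trans Tt0; rewrite /t0; lra.
have h2 : a T <= 2 `^ rho * (T / n%:R) `^ rho * a n%:R.
  by apply: potl => //; apply: le_trans Tt0; rewrite /t0; lra.
have h3 : (T / n%:R) `^ rho <= t0 `^ rho * (m%:R `^ rho)^-1.
  have rho0' : 0 <= rho by case/andP: rho0 => /ltW.
  have Tn0 : 0 <= T / n%:R by rewrite divr_ge0 ?(ltW n0')//; lra.
  apply: (le_trans (le_powR rho0' Tn0 TM)).
  by rewrite powRM ?powRVp ?invr_ge0 ?(ltW m0')//; lra.
have e2 := powR_gt0 eta (ltr0Sn R 1); have r2 := powR_gt0 rho (ltr0Sn R 1).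
apply: (@le_trans _ _ (B * (2 `^ eta * 2 `^ eta * (2 `^ rho * (t0 `^ rho * (m%:R `^ rho)^-1) * a n%:R)))).
  rewrite ler_wpM2l ?(ltW B0)//; apply: (le_trans h1).
  rewrite ler_wpM2l ?(ltW (mulr_gt0 e2 e2))//; apply: (le_trans h2).
  by rewrite ler_wpM2r// ler_wpM2l// ltW.
by apply: eq_ler; rewrite /K /rho; ring.
Qed.

(** Replaces the integral test for the series of m ^ (- 1 - rho). *)
Let telescope_powR (rho : R) n : 0 < rho ->
  rho / n.+2%:R * (n.+2%:R `^ rho)^-1 <= (n.+1%:R `^ rho)^-1 - (n.+2%:R `^ rho)^-1.
Proof.
move=> rho0.
have N1 : 0 < n.+1%:R :> R by rewrite ltr0n.
have N2 : 0 < n.+2%:R :> R by rewrite ltr0n.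
have E : n.+2%:R = n.+1%:R + 1 :> R by rewrite natr1.
have h : n.+1%:R / n.+2%:R <= expR (- n.+2%:R^-1) :> R.
  apply: le_trans (expR_ge1Dx _); apply: eq_ler.
  rewrite E; move: (n.+1%:R) N1 => N N1.
  by field; rewrite gt_eqF//; lra.
have h2 : n.+1%:R `^ rho / n.+2%:R `^ rho <= expR (- (rho / n.+2%:R)).
  rewrite -powRVp// -powRM ?invr_ge0 ?(ltW N1) ?(ltW N2)//.
  have := le_powR (ltW rho0) (divr_ge0 (ltW N1) (ltW N2)) h => /le_trans; apply.
  by apply: eq_ler; rewrite -expRM; congr expR; ring.
have P1 := powR_gt0 rho N1; have P2 := powR_gt0 rho N2.
have h5 : (1 + rho / n.+2%:R) * (n.+1%:R `^ rho / n.+2%:R `^ rho) <= 1.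
  rewrite -[leRHS]expR0 -(subrr (rho / n.+2%:R)) expRD; apply: ler_pM => //.
  - by rewrite addr_ge0// divr_ge0 ?(ltW N2)// ltW.
  - exact: expR_ge1Dx.
move: {E h h2} (n.+1%:R `^ rho) P1 h5 => A A0.
move: (n.+2%:R `^ rho) P2 => B B0; move: (n.+2%:R) N2 => N N2 h5.
have -> : rho / N * B^-1 = (1 + rho / N) * (A / B) / A - B^-1 by field; nz.
by rewrite lerD2r -[leRHS]mul1r ler_wpM2r// invr_ge0 ltW.
Qed.

(** The weight 1 / m and the decay of [mean_tail_le] give a convergent series. Its tail from [A] on
    is small relative to [a n] uniformly in n, which allows the score to be cut at a fixed level. *)
Lemma tail_sum_le : exists2 K : R, 0 < K & exists2 t0 : R, 1 <= t0 & forall J n A,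
  (0 < A)%N -> t0 <= n%:R ->
  \sum_(A <= m < n) m%:R^-1 * mean_tail n m.+1 J <= K * (A%:R `^ (s0 / 2))^-1 * a n%:R.
Proof.
have /andP[s00 s11] := s01.
have [K K0 [t0 t01 H]] := mean_tail_le.
set rho := s0 / 2 in H *; have rho0 : 0 < rho by rewrite /rho; lra.
have K'0 : 0 < K * (2 / rho) by rewrite mulr_gt0// divr_gt0.
exists (K * (2 / rho)) => //; exists t0 => // J n A A0 nt0.
have n0 := a_ge0 n%:R.
have [nA|An] := leqP n A.
  rewrite big_geq//; apply: mulr_ge0 => //.
  by apply: divr_ge0; [exact: ltW|exact: powR_ge0].
pose u (m : nat) : R := - (m%:R `^ rho)^-1.
apply: (@le_trans _ _ (\sum_(A <= m < n) K * (2 / rho) * a n%:R * (u m.+1 - u m))).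
  apply: ler_sum_nat => -[|m] /andP[Am mn]; first by move: (leq_trans A0 Am).
  have M1 : 0 < m.+1%:R :> R by rewrite ltr0n.
  have M2 : 0 < m.+2%:R :> R by rewrite ltr0n.
  have h1 := H J n m.+2 mn nt0.
  have h2 := telescope_powR m rho0.
  have P2 := powR_gt0 rho M2.
  have h3 : m.+1%:R^-1 <= 2 / m.+2%:R :> R.
    rewrite -[leRHS]invrK invf_div lef_pV2 ?posrE ?divr_gt0//.
    by rewrite ler_pdivrMr// -natrM ler_nat; clear; lia.
  apply: (@le_trans _ _ (2 / m.+2%:R * (K * (m.+2%:R `^ rho)^-1 * a n%:R))).
    apply: ler_pM => //.
    apply: sumr_ge0 => k _; apply: bin_tail_ge0; exact: p01.
  rewrite [leLHS](_ : _ = K * (2 / rho) * a n%:R * (rho / m.+2%:R * (m.+2%:R `^ rho)^-1)).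
    rewrite ler_wpM2l ?(mulr_ge0 (ltW K'0) n0)//.
    by rewrite /u opprK addrC.
  move: (m.+2%:R) M2 P2 => N M2 P2; field; nz.
rewrite -mulr_sumr telescope_sumr ?(ltnW An)// /u opprK.
rewrite [leRHS]mulrAC ler_wpM2l ?(mulr_ge0 (ltW K'0) n0)//.
by rewrite addrC gerBl invr_ge0 powR_ge0.
Qed.

End Occupancy.

(** * Products of affine functions *)

Section Log1p.
Variable R : realType.
Implicit Types h : R.

(** The remainder has derivative t ^ 2 / (1 + t), at most 2 t ^ 2 in this range; the mean value
    theorem yields the cubic bound. *)
Lemma ln1p_taylor h : `|h| <= 2^-1 -> `|ln (1 + h) - h + h ^+ 2 / 2| <= 2 * `|h| ^+ 3.
Proof.
move=> hh; pose phi (t : R) := ln (1 + t) - t + t ^+ 2 / 2.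
have pos (t : R) : `|t| <= `|h| -> 2^-1 <= 1 + t.
  move=> th; have := ler_norm (- t); rewrite normrN; lra.
have dphi (t : R) : `|t| <= `|h| -> is_derive t 1 phi (t ^+ 2 / (1 + t)).
  move=> /pos t2; have t1 : 0 < 1 + t by lra.
  have d1 := is_derive1_ln t1.
  have d2 : is_derive t 1 (fun t : R => 1 + t) 1.
    have := is_deriveD (is_derive_cst (1 : R) t (1 : R)) (is_derive_id t (1 : R)).
    by rewrite add0r.
  have d3 : is_derive t 1 (fun t : R => ln (1 + t)) ((1 + t)^-1 * 1).
    exact: (@is_derive1_comp _ (@ln R) (fun t => 1 + t) t _ _ d1 d2).
  by apply: is_derive_eq; rewrite /GRing.scale/=; field; rewrite gt_eqF.
have cphi (t : R) : `|t| <= `|h| -> {for t, continuous phi}.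
  by move=> /dphi dt; apply: differentiable_continuous; apply/derivable1_diffP; exact: ex_derive.
have phi0 : phi 0 = 0 by rewrite /phi addr0 ln1 subr0 expr0n/= mul0r addr0.
rewrite -/(phi h); suff [c ch ->] : exists2 c, `|c| <= `|h| & phi h = (c ^+ 2 / (1 + c)) * h.
  have c1 := pos c ch; have c1' : 0 < 1 + c by lra.
  rewrite normrM ger0_norm ?divr_ge0 ?sqr_ge0 ?(ltW c1')// [X in _ <= _ * X]exprSr mulrA ler_wpM2r//.
  rewrite ler_pdivrMr// mulrAC -[leLHS]mul1r -real_normK ?num_real//.
  apply: ler_pM; rewrite ?exprn_ge0//; last by rewrite lerXn2r ?nnegrE.
  lra.
have [h0|h0|<-] := ltgtP 0 h; last first.
- by exists 0 => //; rewrite phi0 mulr0.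
- have ab t : h <= t <= 0 -> `|t| <= `|h|.
    by move=> /andP[ht t0]; rewrite ler0_norm// ler0_norm ?(ltW h0)// lerN2.
  have [||c] := @MVT_segment R phi (fun c => c ^+ 2 / (1 + c)) h 0 (ltW h0).
  + by move=> t; rewrite in_itv/= => /andP[ht t0]; apply: dphi; apply: ab; rewrite !ltW.
  + by apply: continuous_in_subspaceT => t /set_mem /=; rewrite in_itv/= => /ab; exact: cphi.
  rewrite in_itv/= phi0 !sub0r => cI E; exists c; first exact: ab.
  by rewrite -[LHS]opprK E mulrN opprK.
have ab t : 0 <= t <= h -> `|t| <= `|h|.
  by move=> /andP[t0 th]; rewrite ger0_norm// ger0_norm ?(ltW h0).
have [||c] := @MVT_segment R phi (fun c => c ^+ 2 / (1 + c)) 0 h (ltW h0).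
+ by move=> t; rewrite in_itv/= => /andP[ht t0]; apply: dphi; apply: ab; rewrite !ltW.
+ by apply: continuous_in_subspaceT => t /set_mem /=; rewrite in_itv/= => /ab; exact: cphi.
rewrite in_itv/= phi0 !subr0 => cI E; exists c; first exact: ab.
exact: E.
Qed.

End Log1p.

Section AffineProducts.
Variable R : realType.
Implicit Types (f : R * R) (fs : seq (R * R)) (x y : R).

Definition affine_at f x : R := f.1 + f.2 * x.
Definition affine_prod fs x : R := \prod_(f <- fs) affine_at f x.
Definition log_deriv fs x : R := \sum_(f <- fs) f.2 / affine_at f x.
(** Minus the derivative of [log_deriv], hence minus the second derivative of the logarithm of
    [affine_prod]. *)
Definition log_curv fs x : R := \sum_(f <- fs) (f.2 / affine_at f x) ^+ 2.
(** Nonconstant and nonnegative at both endpoints, hence positive on ]0, 1[. A zero at an endpoint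
    has to be allowed: 1 - sigma vanishes at 1, and M + i sigma vanishes at 0 when M = 0. *)
Definition admissible f : bool := [&& 0 <= f.1, 0 <= f.1 + f.2 & f.2 != 0].
Local Notation mid x := (Num.min x (1 - x)).

(** The zero of a factor is not inside ]0, 1[, so its value is at least its slope times the distance
    to the boundary. The relative change of a factor is therefore bounded by the displacement alone
    ([ratio_le]), and no later constant depends on the number of factors. *)
Lemma affine_at_lb f x : admissible f -> 0 < x < 1 -> `|f.2| * mid x <= affine_at f x.
Proof.
move=> /and3P[f0 f1 _] /andP[x0 x1]; rewrite /affine_at.
have [b0|b0] := leP 0 f.2.
  rewrite ger0_norm//; apply: (@le_trans _ _ (f.2 * x)); last by rewrite lerDr.
  by rewrite ler_wpM2l// ge_min lexx.
rewrite ltr0_norm//; apply: (@le_trans _ _ (- f.2 * (1 - x))).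
  by rewrite ler_wpM2l ?oppr_ge0 ?(ltW b0)// ge_min lexx orbT.
by lra.
Qed.

Lemma mid_gt0 x : 0 < x < 1 -> 0 < mid x.
Proof. by move=> /andP[x0 x1]; rewrite lt_min x0 subr_gt0. Qed.

Lemma affine_at_gt0 f x : admissible f -> 0 < x < 1 -> 0 < affine_at f x.
Proof.
move=> af x01; apply: lt_le_trans (affine_at_lb af x01).
by rewrite mulr_gt0 ?mid_gt0// normr_gt0; case/and3P: af.
Qed.

Lemma affine_at_ge0 f x : admissible f -> 0 <= x <= 1 -> 0 <= affine_at f x.
Proof.
move=> /and3P[f0 f1 _] /andP[x0 x1]; rewrite /affine_at.
have := mulr_ge0 f1 x0; have x1' : 0 <= 1 - x by lra.
by have := mulr_ge0 f0 x1'; lra.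
Qed.

Lemma ratio_le f x y : admissible f -> 0 < x < 1 ->
  `|f.2 / affine_at f x * (y - x)| <= `|y - x| / mid x.
Proof.
move=> af x01; have ax := affine_at_gt0 af x01; have mx := mid_gt0 x01.
rewrite !normrM normfV (gtr0_norm ax) mulrC ler_wpM2l//.
by rewrite ler_pdivrMr// mulrC ler_pdivlMr// affine_at_lb.
Qed.

Lemma affine_at_step f x y : 0 < affine_at f x ->
  affine_at f y = affine_at f x * (1 + f.2 / affine_at f x * (y - x)).
Proof. by rewrite /affine_at => ax; field; rewrite gt_eqF. Qed.

Lemma affine_prod_gt0 fs x : all admissible fs -> 0 < x < 1 -> 0 < affine_prod fs x.
Proof.
move=> /allP afs x01; rewrite /affine_prod big_seq; apply: prodr_gt0 => f ffs.
by apply: affine_at_gt0; rewrite ?afs.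
Qed.

Lemma affine_prod_ge0 fs x : all admissible fs -> 0 <= x <= 1 -> 0 <= affine_prod fs x.
Proof.
move=> /allP afs x01; rewrite /affine_prod big_seq; apply: prodr_ge0 => f ffs.
by apply: affine_at_ge0; rewrite ?afs.
Qed.

(* Log-concavity: 1 + t <= expR t in each factor. *)
Lemma affine_prod_le_tangent fs x y : all admissible fs -> 0 < x < 1 -> 0 <= y <= 1 ->
  affine_prod fs y <= affine_prod fs x * expR (log_deriv fs x * (y - x)).
Proof.
move=> afs x01 y01; rewrite /affine_prod /log_deriv.
elim: fs afs => [|f fs IH] /=; first by rewrite !big_nil mul0r expR0 mulr1.
move=> /andP[af afs]; rewrite !big_cons [X in expR X]mulrDl expRD mulrACA.
apply: ler_pM; [exact: affine_at_ge0|exact: affine_prod_ge0| |exact: IH].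
have ax := affine_at_gt0 af x01.
by rewrite (affine_at_step y ax) ler_wpM2l ?(ltW ax)// expR_ge1Dx.
Qed.

(** Each factor changes by 1 + h with [|h|] at most [d]. The cubic remainder of its logarithm is
    then at most 2 d h ^ 2 and joins the quadratic term, which turns 1 / 2 into (1 + 4 d) / 2 or (1
    - 4 d) / 2. *)
Lemma affine_prod_taylor fs x y d : all admissible fs -> 0 < x < 1 ->
  0 < d <= 2^-1 -> `|y - x| <= d * mid x ->
  affine_prod fs x * expR (log_deriv fs x * (y - x) -
     (1 + 4 * d) / 2 * log_curv fs x * (y - x) ^+ 2) <= affine_prod fs y
  <= affine_prod fs x * expR (log_deriv fs x * (y - x) -
     (1 - 4 * d) / 2 * log_curv fs x * (y - x) ^+ 2).
Proof.
move=> afs x01 /andP[d0 d2] yx; have mx := mid_gt0 x01.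
rewrite /affine_prod /log_deriv /log_curv.
elim: fs afs => [|f fs IH] /=.
  by rewrite !big_nil !(mul0r, mulr0, subr0, expR0, mulr1) lexx.
move=> /andP[af afs]; have /andP[IH1 IH2] := IH afs.
have ax := affine_at_gt0 af x01.
set h := f.2 / affine_at f x * (y - x).
have hd : `|h| <= d.
  by apply: (le_trans (ratio_le y af x01)); rewrite ler_pdivrMr.
have h1 : 0 < 1 + h by have := ler_norm (- h); rewrite normrN; lra.
have /(_ (le_trans hd d2)) := @ln1p_taylor _ h.
have h3 : `|h| ^+ 3 <= d * h ^+ 2.
  by rewrite exprS real_normK ?num_real// ler_wpM2r ?sqr_ge0.
rewrite ler_norml => /andP[l1 l2].
have lnE : 1 + h = expR (ln (1 + h)) by rewrite lnK.
have b1 : affine_at f x * expR (h - (1 + 4 * d) / 2 * h ^+ 2) <= affine_at f y.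
  by rewrite (affine_at_step y ax) ler_wpM2l ?(ltW ax)// -/h lnE ler_expR; lra.
have b2 : affine_at f y <= affine_at f x * expR (h - (1 - 4 * d) / 2 * h ^+ 2).
  by rewrite (affine_at_step y ax) ler_wpM2l ?(ltW ax)// -/h lnE ler_expR; lra.
have px : 0 <= affine_prod fs x by rewrite ltW// affine_prod_gt0.
have ay : 0 < affine_at f y by rewrite (affine_at_step y ax) mulr_gt0.
have py : 0 <= affine_prod fs y.
  by apply: le_trans IH1; rewrite mulr_ge0 ?expR_ge0.
rewrite /affine_prod in px py.
have split c : expR ((\sum_(j <- f :: fs) j.2 / affine_at j x) * (y - x) -
   c * (\sum_(j <- f :: fs) (j.2 / affine_at j x) ^+ 2) * (y - x) ^+ 2) =
   expR (h - c * h ^+ 2) * expR ((\sum_(j <- fs) j.2 / affine_at j x) * (y - x) -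
   c * (\sum_(j <- fs) (j.2 / affine_at j x) ^+ 2) * (y - x) ^+ 2).
  by rewrite -expRD !big_cons /h; congr expR; ring.
rewrite !split [\prod_(i <- f :: fs) affine_at i x]big_cons [\prod_(i <- f :: fs) affine_at i y]big_cons.
rewrite [X in X <= _ <= _]mulrACA [X in _ <= _ <= X]mulrACA.
apply/andP; split; apply: ler_pM => //.
- by rewrite mulr_ge0 ?expR_ge0// ltW.
- by rewrite mulr_ge0 ?expR_ge0.
- exact: ltW.
Qed.

(** Every factor changes by a ratio between 1 - d and 1 + d. Knowing the curvature at one point
    therefore determines it nearby, in particular at a random maximizer. *)
Lemma log_curv_comparison fs x y d : all admissible fs -> 0 < x < 1 -> 0 < y < 1 ->
  0 < d < 1 -> `|y - x| <= d * mid x ->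
  log_curv fs x / (1 + d) ^+ 2 <= log_curv fs y <= log_curv fs x / (1 - d) ^+ 2.
Proof.
move=> /allP afs x01 y01 /andP[d0 d1] yx; have mx := mid_gt0 x01.
rewrite /log_curv !mulr_suml big_seq [X in _ <= X <= _]big_seq [X in _ <= _ <= X]big_seq.
rewrite -!big_seq.
have key f : f \in fs -> (1 - d) * affine_at f x <= affine_at f y <= (1 + d) * affine_at f x.
  move=> /afs af; have ax := affine_at_gt0 af x01.
  have := ratio_le y af x01.
  have : `|y - x| / mid x <= d by rewrite ler_pdivrMr.
  move=> h1 /le_trans/(_ h1); rewrite ler_norml => /andP[l1 l2].
  rewrite (affine_at_step y ax) ![_ * affine_at f x]mulrC !ler_wpM2l ?(ltW ax)//; lra.
have one f c : f \in fs -> (f.2 / affine_at f x) ^+ 2 / c ^+ 2 = f.2 ^+ 2 / (c * affine_at f x) ^+ 2.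
  by move=> _; rewrite -!expr_div_n; congr (_ ^+ 2); rewrite [in RHS]invfM mulrA mulrAC.
apply/andP; split; rewrite big_seq [leRHS]big_seq; apply: ler_sum => f ffs.
- have /andP[_ k] := key f ffs; rewrite one//.
  have ax := affine_at_gt0 (afs f ffs) x01; have ay := affine_at_gt0 (afs f ffs) y01.
  have p1 : 0 < (1 + d) * affine_at f x := lt_le_trans ay k.
  rewrite [leRHS]exprMn exprVn ler_wpM2l ?sqr_ge0// lef_pV2 ?posrE ?exprn_gt0//.
  by apply: lerXn2r; rewrite ?nnegrE; [exact: ltW|exact: ltW|exact: k].
- have /andP[k _] := key f ffs; rewrite one//.
  have ax := affine_at_gt0 (afs f ffs) x01; have ay := affine_at_gt0 (afs f ffs) y01.
  have d1' : 0 < 1 - d by lra.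
  have p1 : 0 < (1 - d) * affine_at f x := mulr_gt0 d1' ax.
  rewrite [leLHS]exprMn exprVn ler_wpM2l ?sqr_ge0// lef_pV2 ?posrE ?exprn_gt0//.
  by apply: lerXn2r; rewrite ?nnegrE; [exact: ltW|exact: ltW|exact: k].
Qed.

Lemma log_deriv_ni fs x y : all admissible fs -> 0 < x < 1 -> 0 < y < 1 -> x <= y ->
  log_deriv fs y <= log_deriv fs x.
Proof.
move=> /allP afs x01 y01 xy; rewrite /log_deriv big_seq [leRHS]big_seq.
apply: ler_sum => f ffs.
have ax := affine_at_gt0 (afs f ffs) x01; have ay := affine_at_gt0 (afs f ffs) y01.
rewrite ler_pdivrMr// mulrAC ler_pdivlMr// -subr_ge0 /affine_at.
have -> : f.2 * (f.1 + f.2 * y) - f.2 * (f.1 + f.2 * x) = f.2 ^+ 2 * (y - x) by ring.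
by rewrite mulr_ge0 ?sqr_ge0 ?subr_ge0.
Qed.

Section Maximizer.
Variables (fs : seq (R * R)) (xh : R).
Hypothesis afs : all admissible fs.
Hypothesis xhmax : is_maximizer (affine_prod fs) xh.

(** Beyond a point where the score points inwards, the tangent bound makes the product strictly
    smaller than at that point. This covers maximizers at the endpoints 0 and 1 too. *)
Lemma maximizer_bracket x1 x2 : 0 < x1 < 1 -> 0 < x2 < 1 ->
  0 < log_deriv fs x1 -> log_deriv fs x2 < 0 -> x1 <= xh <= x2.
Proof.
move=> x101 x201 D1 D2; have [xh01 xhm] := xhmax.
rewrite in_itv/= in xh01.
have cl x : 0 < x < 1 -> x \in `[0, 1].
  by move=> /andP[xl xr]; rewrite in_itv/= !ltW.
rewrite !leNgt; apply/andP; split; apply/negP => lt.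
- have := xhm x1 (cl _ x101); rewrite leNgt => /negP; apply.
  apply: (le_lt_trans (affine_prod_le_tangent afs x101 xh01)).
  rewrite gtr_pMr ?affine_prod_gt0// expR_lt1.
  by rewrite pmulr_rlt0// subr_lt0.
- have := xhm x2 (cl _ x201); rewrite leNgt => /negP; apply.
  apply: (le_lt_trans (affine_prod_le_tangent afs x201 xh01)).
  rewrite gtr_pMr ?affine_prod_gt0// expR_lt1.
  by rewrite nmulr_rlt0// subr_gt0.
Qed.

(** The lower Taylor bound with d = 1 / 4 gives D t <= V t ^ 2 for all small t of either sign, which
    forces D = 0. *)
Lemma maximizer_stationary : 0 < xh < 1 -> log_deriv fs xh = 0.
Proof.
move=> xh01; have [_ xhm] := xhmax.
set D := log_deriv fs xh; set V := log_curv fs xh.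
have mx := mid_gt0 xh01.
have V0 : 0 <= V by apply: sumr_ge0 => f _; exact: sqr_ge0.
have key t : `|t| <= 4^-1 * mid xh -> D * t <= V * t ^+ 2.
  move=> tm.
  have d4 : 0 < (4^-1 : R) <= 2^-1 by apply/andP; split; lra.
  have := @affine_prod_taylor fs xh (xh + t) 4^-1 afs xh01 d4.
  rewrite addrAC subrr add0r => /(_ tm) /andP[h _].
  have xt : xh + t \in `[0, 1].
    move: tm; rewrite ler_norml in_itv/= lt_min in mx * => /andP[t1 t2].
    have m1 : mid xh <= xh by rewrite ge_min lexx.
    have m2 : mid xh <= 1 - xh by rewrite ge_min lexx orbT.
    have m0 : 0 <= mid xh by rewrite le_min; case/andP: mx => /ltW -> /ltW ->.
    by lra.
  have := le_trans h (xhm _ xt).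
  rewrite ger_pMr ?affine_prod_gt0// -[leRHS]expR0 ler_expR -/D -/V.
  by rewrite mulfV//; lra.
have key2 t : 0 <= t <= 4^-1 * mid xh -> `|D| * t <= V * t ^+ 2.
  move=> /andP[t0 tm]; have [D0|D0] := leP 0 D.
    by rewrite ger0_norm//; apply: key; rewrite ger0_norm.
  have := key (- t); rewrite normrN ger0_norm// => /(_ tm).
  by rewrite ltr0_norm// sqrrN mulrN mulNr.
apply/eqP; rewrite -normr_le0 leNgt; apply/negP => D0.
have V1 : 0 < 2 * (V + 1) by lra.
(* Small enough for V t ^ 2 to stay below [|D| * t]. *)
pose t := Num.min (4^-1 * mid xh) (`|D| / (2 * (V + 1))).
have t0 : 0 < t by rewrite lt_min mulr_gt0//= divr_gt0.
have /key2 : 0 <= t <= 4^-1 * mid xh by rewrite ltW//= ge_min lexx.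
rewrite expr2 mulrA ler_pM2r// leNgt => /negP; apply.
apply: (@le_lt_trans _ _ (V * (`|D| / (2 * (V + 1))))).
  by rewrite ler_wpM2l// ge_min lexx orbT.
rewrite mulrA ltr_pdivrMr// mulrC ltr_pM2l//; lra.
Qed.

(** Deterministic core: the curvature at [s0] and the signs of the score at two points determine the
    shape of the whole product. The term 16 d leaves room for two factors 1 + 4 d, or 1 - 4 d, one
    from the Taylor bound and one from the curvature at [xh]; with d <= 1 / 32 it stays at most 1 /
    2. *)
Lemma maximizer_sandwich s0 d W : 0 < s0 < 1 -> 0 < d <= 32^-1 -> 0 < W ->
  let r := d * mid s0 / 4 in
  `|log_curv fs s0 - W| <= d * W ->
  0 < log_deriv fs (s0 - r) -> log_deriv fs (s0 + r) < 0 ->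
  [/\ `|xh - s0| <= r,
    forall y, `|y - xh| <= r ->
      affine_prod fs xh * expR (- ((1 + 16 * d) / 2 * W * (y - xh) ^+ 2)) <= affine_prod fs y
      <= affine_prod fs xh * expR (- ((1 - 16 * d) / 2 * W * (y - xh) ^+ 2)) &
    forall y, 0 <= y <= 1 -> r <= `|y - xh| ->
      affine_prod fs y <= affine_prod fs xh * expR (- ((1 - 16 * d) / 2 * W * r ^+ 2))].
Proof.
move=> s01 /andP[d0 d32] W0 r VW D1 D2.
have m0 := mid_gt0 s01.
have r0 : 0 < r by rewrite divr_gt0// mulr_gt0.
have r4 : r = d * mid s0 / 4 by [].
have ms1 : mid s0 <= s0 by rewrite ge_min lexx.
have ms2 : mid s0 <= 1 - s0 by rewrite ge_min lexx orbT.
have rm : r <= mid s0 / 128.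
  by rewrite r4; have := ler_wpM2r (ltW m0) d32; lra.
have /andP[b1 b2] : s0 - r <= xh <= s0 + r.
  by apply: maximizer_bracket => //; lra.
have xs : `|xh - s0| <= r by rewrite ler_norml; lra.
have xh01 : 0 < xh < 1 by lra.
have mh : mid s0 / 2 <= mid xh by rewrite le_min; lra.
have st := maximizer_stationary xh01.
have d01 : 0 < d < 1 by lra.
have xsd : `|xh - s0| <= d * mid s0.
  by apply: (le_trans xs); rewrite r4; have := mulr_gt0 d0 m0; lra.
have /andP[c1 c2] := log_curv_comparison afs s01 xh01 d01 xsd.
move: VW; rewrite ler_norml => /andP[v1 v2].
have dd : 0 < d * d := mulr_gt0 d0 d0.
have d2d : d * d <= 32^-1 * d by rewrite ler_wpM2r// ltW.
set V := log_curv fs xh in c1 c2 *.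
have q1 : 0 < (1 + d) ^+ 2 by rewrite exprn_gt0//; lra.
have q2 : 0 < (1 - d) ^+ 2 by rewrite exprn_gt0//; lra.
(* One factor 1 - d comes from comparing the curvature at [s0] with [W], and (1 + d) ^ 2 from moving
   to [xh]. *)
have Vlo : (1 - 4 * d) * W <= V.
  apply: le_trans c1; rewrite ler_pdivlMr//.
  apply: (@le_trans _ _ ((1 - d) * W)); last by lra.
  rewrite mulrAC ler_wpM2r ?(ltW W0)//.
  have -> : (1 - 4 * d) * (1 + d) ^+ 2 = 1 - 2 * d - 7 * (d * d) - 4 * d * (d * d) by ring.
  have := mulr_gt0 d0 dd; lra.
have Vhi : V <= (1 + 4 * d) * W.
  apply: (le_trans c2); rewrite ler_pdivrMr//.
  apply: (@le_trans _ _ ((1 + d) * W)); first by lra.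
  rewrite [leRHS]mulrAC ler_wpM2r ?(ltW W0)//.
  have -> : (1 + 4 * d) * (1 - d) ^+ 2 = 1 + 2 * d - 7 * (d * d) + 4 * d * (d * d) by ring.
  have := mulr_gt0 d0 dd; lra.
have up c : 0 <= c -> (1 - 16 * d) / 2 * W * c <= (1 - 4 * d) / 2 * V * c.
  move=> c0; rewrite ler_wpM2r//.
  apply: (@le_trans _ _ ((1 - 4 * d) / 2 * ((1 - 4 * d) * W))); last first.
    by rewrite ler_wpM2l//; lra.
  rewrite mulrA ler_wpM2r ?(ltW W0)//; lra.
have lo c : 0 <= c -> (1 + 4 * d) / 2 * V * c <= (1 + 16 * d) / 2 * W * c.
  move=> c0; rewrite ler_wpM2r//.
  apply: (@le_trans _ _ ((1 + 4 * d) / 2 * ((1 + 4 * d) * W))).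
    by rewrite ler_wpM2l//; lra.
  rewrite mulrA ler_wpM2r ?(ltW W0)//; lra.
have p0 := affine_prod_gt0 afs xh01.
have near y : `|y - xh| <= r ->
      affine_prod fs xh * expR (- ((1 + 16 * d) / 2 * W * (y - xh) ^+ 2)) <= affine_prod fs y
      <= affine_prod fs xh * expR (- ((1 - 16 * d) / 2 * W * (y - xh) ^+ 2)).
  move=> yr.
  have ym : `|y - xh| <= d * mid xh.
    apply: (le_trans yr); rewrite r4; have := ler_wpM2l (ltW d0) mh.
    by have := mulr_gt0 d0 m0; lra.
  have d12 : 0 < d <= 2^-1 by lra.
  have := affine_prod_taylor afs xh01 d12 ym.
  rewrite st mul0r !sub0r => /andP[t1 t2].
  apply/andP; split; [apply: le_trans t1|apply: (le_trans t2)];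
    rewrite ler_wpM2l ?(ltW p0)// ler_expR lerN2; [exact/lo/sqr_ge0|exact/up/sqr_ge0].
split=> // y y01 ry.
(* Past distance [r] the tangent at xh - r or xh + r descends away from [xh], so the product is at
   most its value at that point, where the near bound applies. *)
have far x : `|x - xh| = r -> 0 < x < 1 -> log_deriv fs x * (y - x) <= 0 ->
    affine_prod fs y <= affine_prod fs xh * expR (- ((1 - 16 * d) / 2 * W * r ^+ 2)).
  move=> xr x01 Dx; apply: (le_trans (affine_prod_le_tangent afs x01 y01)).
  apply: (@le_trans _ _ (affine_prod fs x)).
    by rewrite ger_pMr ?affine_prod_gt0// -[leRHS]expR0 ler_expR.
  have /near/andP[_] : `|x - xh| <= r by rewrite xr.
  by rewrite -real_normK ?num_real// xr.
have [yx|yx] := leP y xh.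
  have x01 : 0 < xh - r < 1 by lra.
  apply: (far (xh - r)) => //; first by rewrite addrAC subrr add0r normrN gtr0_norm.
  rewrite ler0_norm ?subr_le0// in ry.
  rewrite mulr_ge0_le0 -?st ?subr_le0//; last by lra.
  by apply: log_deriv_ni => //; lra.
have x01 : 0 < xh + r < 1 by lra.
apply: (far (xh + r)) => //; first by rewrite addrAC subrr add0r gtr0_norm.
rewrite gtr0_norm ?subr_gt0// in ry.
rewrite mulr_le0_ge0 -?st ?subr_ge0//; last by lra.
by apply: log_deriv_ni => //; lra.
Qed.

End Maximizer.

End AffineProducts.

(** * The likelihood as a product of affine functions *)

Section LikelihoodFactors.
Variables (R : realType) (T : eqType) (M : R).
Hypothesis M0 : 0 <= M.
Implicit Types (s : seq T).

Definition num_ge s m : nat := \sum_(x <- undup s) (m <= count_mem x s)%N.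

Definition lik_factors s : seq (R * R) :=
  [seq (M, i%:R) | i <- index_iota 1 (num_distinct s)] ++
  flatten [seq [seq (m%:R, -1) | m <- index_iota 1 (count_mem x s)] | x <- undup s].

Lemma lik_factors_admissible s : all (@admissible R) (lik_factors s).
Proof.
rewrite all_cat; apply/andP; split.
  apply/allP => f /mapP[i]; rewrite mem_index_iota => /andP[i1 _] ->.
  by rewrite /admissible /= M0 addr_ge0//= pnatr_eq0 -lt0n.
apply/allP => f /flattenP[l /mapP[x _ ->] /mapP[m]]; rewrite mem_index_iota => /andP[m1 _] ->.
by rewrite /admissible /= subr_ge0 ler1n m1 oppr_eq0 oner_neq0 ler0n.
Qed.

Lemma rising_affine (x : R) c : rising (1 - x) c.-1 = \prod_(1 <= m < c) (m%:R + -1 * x).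
Proof.
rewrite big_add1 big_mkord /rising; apply: eq_bigr => i _.
by rewrite -natr1; ring.
Qed.

Lemma likelihoodE s (x : R) : likelihood M s x =
  (rising (M + 1) (size s).-1)^-1 * affine_prod (lik_factors s) x.
Proof.
rewrite /likelihood /affine_prod /lik_factors big_cat big_flatten !big_map /=.
rewrite mulrAC [LHS]mulrC; congr (_ * (_ * _)).
by apply: eq_bigr => y _; rewrite rising_affine big_map.
Qed.

Lemma rising_gt0 n : 0 < rising (M + 1) n.
Proof. by apply: prodr_gt0 => i _; rewrite ltr_wpDr// ltr_wpDl. Qed.

(** A value of multiplicity c contributes the levels 1, ..., c - 1, so level m occurs once for each
    value seen at least m.+1 times. *)
Lemma sum_counts (h : nat -> R) s :
  \sum_(x <- undup s) \sum_(1 <= m < count_mem x s) h m =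
  \sum_(1 <= m < size s) (num_ge s m.+1)%:R * h m.
Proof.
transitivity (\sum_(x <- undup s) \sum_(1 <= m < size s) (m < count_mem x s)%N%:R * h m).
  apply: eq_bigr => x _; rewrite (big_nat_widen _ _ (size s)) ?count_size// big_mkcond/=.
  by apply: eq_bigr => m _; case: ifP; rewrite ?mul1r ?mul0r.
rewrite exchange_big/=; apply: eq_bigr => m _.
by rewrite /num_ge natr_sum mulr_suml.
Qed.

Lemma log_deriv_lik s (x : R) : log_deriv (lik_factors s) x =
  \sum_(1 <= i < num_distinct s) i%:R / (M + i%:R * x) -
  \sum_(1 <= m < size s) (num_ge s m.+1)%:R / (m%:R - x).
Proof.
rewrite /log_deriv /lik_factors big_cat big_flatten !big_map /=; congr (_ + _).
rewrite -sum_counts -sumrN; apply: eq_bigr => y _; rewrite big_map -sumrN.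
by apply: eq_bigr => m _; rewrite /affine_at/= !mulN1r.
Qed.

Lemma log_curv_lik s (x : R) : log_curv (lik_factors s) x =
  \sum_(1 <= i < num_distinct s) (i%:R / (M + i%:R * x)) ^+ 2 +
  \sum_(1 <= m < size s) (num_ge s m.+1)%:R / (m%:R - x) ^+ 2.
Proof.
rewrite /log_curv /lik_factors big_cat big_flatten !big_map /=; congr (_ + _).
rewrite -(sum_counts (fun m => (m%:R - x) ^- 2)); apply: eq_bigr => y _; rewrite big_map.
by apply: eq_bigr => m _; rewrite /affine_at/= mulN1r mulN1r sqrrN exprVn.
Qed.

(** The early terms cost at most [c] each and the later ones [e]. The successor in [N.+1] accounts
    for the sum having K - 1 terms instead of K. *)
Lemma sum_near_const (r : nat -> R) (c e : R) (N K : nat) : 0 <= e ->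
  (forall i, (0 < i)%N -> 0 <= r i <= c) ->
  (forall i, (0 < i)%N -> (N <= i)%N -> c - r i <= e) ->
  `|\sum_(1 <= i < K) r i - K%:R * c| <= e * K%:R + c * N.+1%:R.
Proof.
move=> e0 rc re; have c0 : 0 <= c.
  by have /andP[] := rc 1%N isT; exact: le_trans.
have key k : 0 <= k.+1%:R * c - \sum_(1 <= i < k.+1) r i <= e * k.+1%:R + c * (minn k N).+1%:R.
  elim: k => [|k /andP[IH1 IH2]].
    by rewrite big_geq// min0n mul1r subr0 c0 !mulr1 lerDr.
  rewrite big_nat_recr//=; have /andP[r0 r1] := rc k.+1 isT.
  have -> : k.+2%:R = k.+1%:R + 1 :> R by rewrite natr1.
  apply/andP; split; first by lra.
  have [kN|Nk] := leqP N k.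
    have := re k.+1 isT (leqW kN) => h.
    by rewrite (minn_idPr (leqW kN)); move: IH2; rewrite (minn_idPr kN); lra.
  rewrite (minn_idPl Nk); move: IH2; rewrite (minn_idPl (ltnW Nk)).
  have -> : k.+2%:R = k.+1%:R + 1 :> R by rewrite natr1.
  lra.
case: K => [|k].
  by rewrite big_geq// mul0r subr0 normr0 mulr0 add0r mulr_ge0.
have /andP[k1 k2] := key k.
rewrite distrC ger0_norm//; apply: (le_trans k2); rewrite lerD2l ler_wpM2l// ler_nat ltnS geq_minr.
by [].
Qed.

(** The terms tend to 1 / x, and the influence of [M] is confined to [C]. As [C] is free of [K], the
    bound can be evaluated at the random number of distinct values. *)
Lemma linear_factor_sums (x e : R) : 0 < x < 1 -> 0 < e ->
  exists C : R, forall K : nat,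
  `|\sum_(1 <= i < K) i%:R / (M + i%:R * x) - K%:R * x^-1| <= e * K%:R + C /\
  `|\sum_(1 <= i < K) (i%:R / (M + i%:R * x)) ^+ 2 - K%:R * x^-1 ^+ 2| <= e * K%:R + C.
Proof.
(* The second entry is for the squares, whose difference is at most e' times 2 / x. *)
move=> /andP[x0 x1] e0; pose e' := Num.min e (e * x / 2).
have e'0 : 0 < e' by rewrite lt_min e0 divr_gt0// mulr_gt0.
have ee1 : e' <= e by rewrite ge_min lexx.
have ee2 : e' <= e * x / 2 by rewrite ge_min lexx orbT.
have [N NM] := nat_ub (M / (x ^+ 2 * e')).
pose r i : R := i%:R / (M + i%:R * x).
have xi0 : 0 <= x^-1 by rewrite invr_ge0 ltW.
have rc i : (0 < i)%N -> 0 <= r i <= x^-1.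
  move=> i0; have i0' : 0 < i%:R :> R by rewrite ltr0n.
  have ix : 0 < i%:R * x by rewrite mulr_gt0.
  rewrite /r divr_ge0 ?addr_ge0 ?(ltW ix)//=.
  rewrite ler_pdivrMr ?ltr_wpDl// mulrDr mulrCA mulVf ?gt_eqF// mulr1 lerDr mulr_ge0//.
have re i : (0 < i)%N -> (N <= i)%N -> x^-1 - r i <= e'.
  move=> i0 Ni; have i0' : 0 < i%:R :> R by rewrite ltr0n.
  have ix : 0 < i%:R * x by rewrite mulr_gt0.
  have Mix : 0 < M + i%:R * x by rewrite ltr_wpDl.
  have -> : x^-1 - r i = M / (x * (M + i%:R * x)) by rewrite /r; field; nz.
  rewrite ler_pdivrMr ?mulr_gt0//.
  have : M / (x ^+ 2 * e') <= i%:R by apply: (le_trans NM); rewrite ler_nat.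
  rewrite ler_pdivrMr ?mulr_gt0 ?exprn_gt0// => /le_trans; apply.
  have -> : e' * (x * (M + i%:R * x)) = i%:R * (x ^+ 2 * e') + e' * x * M by ring.
  by rewrite lerDl !mulr_ge0// ltW.
exists ((x^-1 + x^-1 ^+ 2) * N.+1%:R) => K; split.
  apply: (le_trans (sum_near_const K (ltW e'0) rc re)); apply: lerD.
    by rewrite ler_wpM2r.
  by rewrite ler_wpM2r// lerDl sqr_ge0.
apply: (@le_trans _ _ (e * K%:R + x^-1 ^+ 2 * N.+1%:R)); last first.
  by rewrite lerD2l ler_wpM2r// lerDr.
apply: (@sum_near_const (fun i => r i ^+ 2)); first exact: ltW.
  by move=> i /rc/andP[r0 r1]; rewrite sqr_ge0/= lerXn2r.
move=> i i0 Ni; have /andP[r0 r1] := rc i i0; have := re i i0 Ni => h.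
rewrite subr_sqr; apply: (@le_trans _ _ (e' * (2 * x^-1))).
  apply: ler_pM => //; rewrite ?subr_ge0 ?addr_ge0//; lra.
rewrite mulrA ler_pdivrMr// -ler_pdivlMr//.
Qed.

End LikelihoodFactors.

(** * Comparison of the posterior with a normal distribution *)

Section Density.
Variables (R : realType) (Pi : probability (measurableTypeR R) R) (g : R -> R).
Local Notation mu := (@lebesgue_measure R).
Local Notation I01 := (`]0%R, 1%R[%classic : set R).
Hypothesis mg : measurable_fun I01 g.
Hypothesis PiE : forall A : set R, measurable A ->
  Pi A = (\int[mu]_(x in A `&` I01) (g x)%:E)%E.

Let g1 := g \_ I01.

Let mg1 : measurable_fun setT g1.
Proof. by apply/(measurable_restrictT _ _).1. Qed.

Let PiE1 (A : set R) : measurable A -> Pi A = (\int[mu]_(x in A) (g1 x)%:E)%E.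
Proof.
move=> mA; rewrite PiE// [LHS]integral_mkcondr; apply: eq_integral => x _.
by rewrite /g1 /patch; case: ifP.
Qed.

Let dom : Pi `<< mu.
Proof.
apply/null_content_dominatesP => A mA muA0; rewrite PiE1//.
by apply: null_set_integral => //; apply/measurable_EFinP; exact: measurable_funTS.
Qed.

(** The Radon-Nikodym derivative of [Pi] agrees with [g1] almost everywhere because both have the
    same integrals over measurable sets. *)
Lemma integral_density (U : set R) (f : R -> \bar R) : measurable U -> Pi.-integrable U f ->
  (\int[Pi]_(x in U) f x = \int[mu]_(x in U) (f x * (g1 x)%:E))%E.
Proof.
move=> mU fi.
rewrite -(Radon_Nikodym_change_of_variables dom)//=.
have mf := measurable_int _ fi.
apply: ae_eq_integral => //.
- apply: emeasurable_funM => //; apply: (measurable_int mu).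
  apply: (integrableS _ _ (@subsetT _ _)) => //=.
  by apply: Radon_Nikodym_integrable; exact: dom.
- by apply: emeasurable_funM => //; apply/measurable_EFinP; exact: measurable_funTS.
- apply: ae_eqe_mul2l => /=.
  have dom' : charge_of_finite_measure Pi `<< mu := dom.
  rewrite (Radon_NikodymE dom'); case: cid => /= h [h1 h2 h3].
  apply: integral_ae_eq => //=.
  + exact: integrableS h2.
  + by apply/measurable_EFinP; exact: measurable_funTS.
  + by move=> E EU mE; rewrite -h3//= PiE1.
Qed.

Lemma Rintegral_density (B : set R) (f : R -> R) C : measurable B ->
  measurable_fun setT f -> (forall x, 0 < x < 1 -> `|f x| <= C) ->
  \int[Pi]_(x in B `&` I01) f x = \int[mu]_(x in B) ((fun x => f x * g x) \_ I01) x.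
Proof.
move=> mB mf fC; rewrite /Rintegral; congr fine.
have mBI : measurable (B `&` I01) by exact: measurableI.
rewrite integral_density//.
  rewrite [LHS]integral_mkcondr; apply: eq_integral => x _.
  rewrite /g1 /patch; have [h|h] := pselect (I01 x).
    by rewrite !(mem_set h).
  by rewrite !(memNset h).
apply: measurable_bounded_integrable => //.
- have PB1 : (Pi (B `&` I01) <= 1)%E by apply: probability_le1.
  exact: le_lt_trans PB1 (ltry 1).
- exact: measurable_funTS.
- exists C; split; first exact: num_real.
  move=> c Cc x [_ /=]; rewrite in_itv/= => x01.
  by apply: ltW; apply: le_lt_trans Cc; exact: fC.
Qed.

End Density.

(** * Gaussian weights and moments *)

Section GaussianMoments.
Variables (R : realType) (m s : R).
Hypothesis s_gt0 : 0 < s.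
Local Notation mu := (@lebesgue_measure R).
Implicit Types x y : R.

(** Half of the exponent pays for the polynomial: it is at most 2 (1 + y ^ 2) ^ 2, hence at most 512
    (1 + y ^ 2 / 16) ^ 2 with 512 = 2 * 16 ^ 2, hence at most 512 expR (y ^ 2 / 8). *)
Lemma poly_gauss_bound y : (1 + `|y|) * (1 + y ^+ 2) * expR (- (y ^+ 2 / 4)) <=
  512 * expR (- (y ^+ 2 / 8)).
Proof.
have -> : - (y ^+ 2 / 4) = - (y ^+ 2 / 8) + - (y ^+ 2 / 8) by field.
rewrite expRD mulrA ler_wpM2r ?expR_ge0// expRN ler_pdivrMr ?expR_gt0//.
have -> : y ^+ 2 / 8 = y ^+ 2 / 16 * 2 by field.
rewrite -[2 in X in _ <= X]/(2%:R) expRM_natr.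
have h := expR_ge1Dx (y ^+ 2 / 16).
have y2 : `|y| <= 1 + y ^+ 2.
  by rewrite -(real_normK (num_real y)); have := sqr_ge0 (`|y| - 1); have := sqr_ge0 `|y|; lra.
have y20 := sqr_ge0 y.
apply: (@le_trans _ _ (512 * (1 + y ^+ 2 / 16) ^+ 2)).
  apply: (@le_trans _ _ (2 * (1 + y ^+ 2) * (1 + y ^+ 2))).
    by rewrite ler_wpM2r//; lra.
  have := mulr_ge0 y20 y20; lra.
have y16 : 0 <= 1 + y ^+ 2 / 16 by apply: addr_ge0 => //; apply: divr_ge0.
rewrite ler_pM2l; last by rewrite ltr0n.
apply: lerXn2r h; rewrite nnegrE ?expR_ge0 //.
Qed.

Lemma normal_pdf_scaled x : normal_pdf m s x =
  normal_peak s * expR (- (((x - m) / s) ^+ 2 / 2)).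
Proof.
rewrite normal_pdfE ?gt_eqF// /normal_fun; congr (_ * expR _).
by rewrite -mulr_natr; field; rewrite gt_eqF.
Qed.

Lemma normal_peak2 : normal_peak (2 * s) = normal_peak s / 2.
Proof.
rewrite /normal_peak exprMn -mulrA -mulrnAr sqrtrM ?sqr_ge0// sqrtr_sqr ger0_norm//.
by rewrite invfM mulrC.
Qed.

Lemma normal_peak_le : normal_peak s <= s^-1.
Proof.
rewrite /normal_peak lef_pV2 ?posrE//; last first.
  by rewrite sqrtr_gt0 pmulrn_lgt0// mulr_gt0 ?exprn_gt0 ?pi_gt0.
rewrite -[leLHS](ger0_norm (ltW s_gt0)) -sqrtr_sqr ler_sqrt; last first.
  by rewrite mulrn_wge0// mulr_ge0 ?sqr_ge0 ?pi_ge0.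
rewrite -mulrnAr ler_peMr ?sqr_ge0//.
by have := pi_ge2 R; lra.
Qed.

Lemma normal_peak_pos : 0 < normal_peak s.
Proof. by apply: normal_peak_gt0; rewrite gt_eqF. Qed.

(** A normal density of doubled standard deviation absorbs the weight. Its peak is halved, which
    turns 512 into 1024. *)
Lemma normal_wide_bound x : (1 + `|(x - m) / s|) * normal_pdf m s x <= 1024 * normal_pdf m (2 * s) x.
Proof.
rewrite normal_pdf_scaled; set y := (x - m) / s.
have -> : normal_pdf m (2 * s) x = normal_peak s / 2 * expR (- (y ^+ 2 / 8)).
  rewrite normal_pdfE ?mulf_neq0 ?gt_eqF//.
  rewrite -normal_peak2 /normal_fun; congr (_ * expR _).
  by rewrite -mulr_natr /y; field; rewrite gt_eqF.
rewrite mulrCA [leRHS](_ : _ = normal_peak s * (512 * expR (- (y ^+ 2 / 8)))); last by field.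
rewrite ler_wpM2l ?(ltW normal_peak_pos)//; apply: le_trans (poly_gauss_bound y).
have y20 := sqr_ge0 y; have y0 := normr_ge0 y.
apply: ler_pM; rewrite ?expR_ge0 ?addr_ge0//.
  by rewrite ler_peMr ?addr_ge0// lerDl.
by rewrite ler_expR lerN2; lra.
Qed.

Lemma integrable_normal_first : mu.-integrable setT (fun x => ((x - m) * normal_pdf m s x)%:E).
Proof.
have K : mu.-integrable setT (fun x => ((1024 * s)%:E * (normal_pdf m (2 * s) x)%:E)%E).
  by apply: integrableZl => //; exact: integrable_normal_pdf.
apply: le_integrable K => //.
  apply/measurable_EFinP; apply: measurable_funM; last exact: measurable_normal_pdf.
  exact: measurable_funD.
move=> x _; rewrite /= lee_fin normrM (ger0_norm (normal_pdf_ge0 _ _ _)).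
have -> : `|x - m| = s * `|(x - m) / s|.
  by rewrite normrM normfV (gtr0_norm s_gt0) mulrCA divff ?mulr1// gt_eqF.
apply: le_trans (ler_norm _); rewrite (_ : 1024 * s * _ = s * (1024 * normal_pdf m (2 * s) x)); last by ring.
rewrite -mulrA ler_wpM2l ?(ltW s_gt0)//.
by apply: le_trans (normal_wide_bound x); rewrite ler_wpM2r ?normal_pdf_ge0// lerDr.
Qed.

(** On an interval symmetric about [m] the primitive - s ^ 2 normal_pdf takes equal values at the
    ends; dominated convergence extends this to the line. *)
Lemma normal_first_moment : \int[mu]_x ((x - m) * normal_pdf m s x) = 0.
Proof.
pose f (x : R) := (x - m) * normal_pdf m s x.
pose F (k : nat) := `[m - k.+1%:R, m + k.+1%:R]%classic : set R.
have F0 k : \int[mu]_(x in F k) f x = 0.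
  rewrite /Rintegral /F.
  have -> : (\int[mu]_(x in `[(m - k.+1%:R)%R, (m + k.+1%:R)%R]) (f x)%:E)%E =
     (- (s ^+ 2 * normal_pdf m s (m + k.+1%:R)) - - (s ^+ 2 * normal_pdf m s (m - k.+1%:R)))%:E.
    apply: (@FTC_closed _ _ (fun x => - (s ^+ 2 * normal_pdf m s x))).
    - by rewrite ltrBlDr -addrA ltrDl addr_gt0 ?ltr0Sn.
    - move=> x _; rewrite /f.
      have e : normal_pdf m s = (fun x => normal_peak s * expR (- (((x - m) / s) ^+ 2 / 2))).
        by apply/funext => z; exact: normal_pdf_scaled.
      by rewrite e; apply: is_derive_eq; rewrite /GRing.scale/=; field; rewrite gt_eqF.
    - move=> x _; apply: continuousM; last by apply: continuous_normal_pdf; rewrite gt_eqF.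
      by apply: continuousB; [exact: cvg_id|exact: cst_continuous].
  rewrite /= !normal_pdf_scaled.
  have -> : (m - k.+1%:R - m) / s = - ((m + k.+1%:R - m) / s) by ring.
  by rewrite sqrrN subrr.
have fi := integrable_normal_first.
have [] := @dominated_convergence _ _ R mu setT measurableT
  (fun k x => ((f \_ (F k)) x)%:E) (EFin \o f) (fun x => `|(f x)%:E|%E).
- move=> k; apply/measurable_EFinP; apply/(measurable_restrictT _ _).1; first exact: measurable_itv.
  by apply: measurable_funTS; apply/measurable_EFinP; case/integrableP: fi.
- by case/integrableP: fi.
- apply: aeW => x _; apply: cvg_near_cst.
  have [d xd] := nat_ub `|x - m|.
  exists d => // k /= dk; rewrite /patch mem_set// /F/= in_itv/=.
  have : `|x - m| <= k.+1%:R by apply: le_trans xd _; rewrite ler_nat ltnW.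
  by rewrite ler_norml => /andP[h1 h2]; lra.
- by apply: integrable_abse.
- apply: aeW => x k _; rewrite /patch; case: ifP => _ //.
  by rewrite abse0 abse_ge0.
move=> _ _ lim.
have lim0 : (fun k => (\int[mu]_x ((f \_ (F k)) x)%:E)%E) = fun=> 0%E.
  apply/funext => k; have := F0 k; rewrite /Rintegral => h.
  rewrite (_ : (\int[mu]_x _)%E = (\int[mu]_(x in F k) (f x)%:E)%E); last first.
    by rewrite [RHS]integral_mkcond; apply: eq_integral => x _; rewrite /patch; case: ifP.
  rewrite -[LHS]fineK ?h//; apply: integrable_fin_num => //; first exact: measurable_itv.
  by apply: integrableS fi => //; exact: measurable_itv.
rewrite lim0 in lim.
by rewrite /Rintegral (_ : (\int[mu]_x _)%E = 0%E)//; apply/esym; apply: (cvg_unique _ (cvg_cst 0%E) lim).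
Qed.

End GaussianMoments.

Section Comparison.
Variables (R : realType) (m s A Bc : R) (F : R -> R).
Local Notation mu := (@lebesgue_measure R).
Local Notation I01 := (`]0%R, 1%R[%classic : set R).
Local Notation phi := (normal_pdf m s).
Local Notation wide := (fun x : R => A * normal_pdf m (2 * s) x + Bc * \1_I01 x).
Hypothesis s_gt0 : 0 < s.
Hypothesis A_ge0 : 0 <= A.
Hypothesis Bc_ge0 : 0 <= Bc.
Hypothesis mF : measurable_fun setT F.
(** One weighted bound serves both conclusions: the 1 in the weight gives total variation and
    [|x - m| / s] the first moment. The bound [wide] has integral A + Bc; its second part
    accommodates the posterior far from [m], which is merely bounded on ]0, 1[. *)
Hypothesis close : forall x, `|F x - phi x| * (1 + `|x - m| / s) <= wide x.

Let mphi : measurable_fun setT phi.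
Proof. exact: measurable_normal_pdf. Qed.

Let wide_ge0 x : 0 <= wide x.
Proof. by rewrite addr_ge0// mulr_ge0 ?normal_pdf_ge0. Qed.

Let iphi : mu.-integrable setT (EFin \o phi).
Proof. by apply: integrable_normal_pdf; rewrite gt_eqF. Qed.

Let integral_wide : (\int[mu]_x (wide x)%:E = (A + Bc)%:E)%E.
Proof.
under eq_integral do rewrite EFinD !EFinM.
rewrite ge0_integralD//=; first last.
- by apply: measurable_funeM; exact/measurable_EFinP.
- by move=> x _; rewrite -EFinM lee_fin mulr_ge0.
- by apply: measurable_funeM; apply/measurable_EFinP; exact: measurable_normal_pdf.
- by move=> x _; rewrite -EFinM lee_fin mulr_ge0 ?normal_pdf_ge0.
rewrite !ge0_integralZl//=.
- rewrite integral_normal_pdf ?mulf_neq0 ?gt_eqF// integral_indic// setIT.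
  have e1 : mu I01 = 1%E by rewrite [LHS]lebesgue_measure_itv/= lte_fin ltr01 oppr0 adde0.
  by rewrite [X in (_ + _ * X)%E]e1 !mule1 -EFinD.
- exact/measurable_EFinP.
- by apply/measurable_EFinP; exact: measurable_normal_pdf.
- by move=> x _; rewrite lee_fin normal_pdf_ge0.
Qed.

Let iwide : mu.-integrable setT (EFin \o wide).
Proof.
apply/integrableP; split.
  apply/measurable_EFinP; apply: measurable_funD; apply: measurable_funM => //.
  exact: measurable_normal_pdf.
under eq_integral do rewrite /= ger0_norm//.
by rewrite integral_wide ltry.
Qed.

Let dF x : `|F x - phi x| <= wide x.
Proof.
apply: le_trans (close x); rewrite ler_peMr// lerDl.
by rewrite divr_ge0 ?(ltW s_gt0).
Qed.

Let idF : mu.-integrable setT (EFin \o (fun x => F x - phi x)).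
Proof.
apply: le_integrable iwide => //.
  by apply/measurable_EFinP; apply: measurable_funB.
by move=> x _; rewrite /= lee_fin (ger0_norm (wide_ge0 x)).
Qed.

Lemma comparison_integrable : mu.-integrable setT (EFin \o F).
Proof.
rewrite (_ : EFin \o F = (EFin \o (fun x => F x - phi x)) \+ (EFin \o phi)).
  exact: integrableD.
by apply/funext => x /=; rewrite -EFinD subrK.
Qed.

Lemma comparison_set (B : set (measurableTypeR R)) : measurable B ->
  `|\int[mu]_(x in B) F x - \int[mu]_(x in B) phi x| <= A + Bc.
Proof.
move=> mB; have sub f : mu.-integrable setT f -> mu.-integrable B f.
  by move=> h; apply: integrableS h.
have iFB := sub _ comparison_integrable.
have iphiB := sub _ iphi; have idFB := sub _ idF.
rewrite -RintegralB//; apply: le_trans (le_normr_Rintegral mB idFB) _.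
rewrite /Rintegral -lee_fin fineK.
  rewrite -integral_wide.
  apply: (@le_trans _ _ (\int[mu]_(x in B) (wide x)%:E)%E).
    apply: ge0_le_integral => //.
    - by apply/measurable_EFinP; apply: measurable_funTS; apply: (measurableT_comp (@normr_measurable _ _)); apply: measurable_funB.
    - by apply/measurable_EFinP; apply: measurable_funTS; apply/measurable_EFinP; exact: measurable_int iwide.
    - by move=> x _; rewrite lee_fin.
  apply: ge0_subset_integral => //; first exact: measurable_int iwide.
  by move=> x _; rewrite lee_fin.
apply: integrable_fin_num => //.
exact: integrable_abse idFB.
Qed.

(** The normal law has first moment 0 about its mean, so only F - phi contributes. *)
Lemma comparison_first : mu.-integrable setT (EFin \o (fun x => (x - m) * F x)) /\
  `|\int[mu]_x ((x - m) * F x)| <= (A + Bc) * s.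
Proof.
have mxm : measurable_fun setT (fun x : R => x - m) by exact: measurable_funB.
have b x : `|(x - m) * (F x - phi x)| <= s * wide x.
  rewrite normrM; have -> : `|x - m| = s * (`|x - m| / s) by field; rewrite gt_eqF.
  rewrite -mulrA ler_wpM2l ?(ltW s_gt0)//; apply: le_trans (close x).
  by rewrite mulrC ler_wpM2l// lerDr.
have iw : mu.-integrable setT (EFin \o (fun x => s * wide x)).
  rewrite (_ : _ \o _ = (fun x => s%:E * (EFin \o wide) x)%E); last by apply/funext => x /=; rewrite EFinM.
  exact: integrableZl.
have id : mu.-integrable setT (EFin \o (fun x => (x - m) * (F x - phi x))).
  apply: le_integrable iw => //.
    by apply/measurable_EFinP; apply: measurable_funM => //; apply: measurable_funB.
  by move=> x _; rewrite /= lee_fin (ger0_norm (mulr_ge0 (ltW s_gt0) (wide_ge0 x))).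
have i1 := integrable_normal_first m s_gt0.
split.
  rewrite (_ : EFin \o _ = (EFin \o (fun x => (x - m) * (F x - phi x))) \+ (fun x => ((x - m) * phi x)%:E)).
    exact: integrableD.
  by apply/funext => x /=; rewrite -EFinD; congr _%:E; ring.
have -> : \int[mu]_x ((x - m) * F x) = \int[mu]_x ((x - m) * (F x - phi x)).
  rewrite -[RHS]addr0 -(normal_first_moment m s_gt0) -RintegralD//.
  by apply: eq_Rintegral => x _ /=; ring.
apply: le_trans (le_normr_Rintegral measurableT id) _.
rewrite /Rintegral -lee_fin fineK; last first.
  by apply: integrable_fin_num => //; exact: integrable_abse id.
apply: (@le_trans _ _ (\int[mu]_x (s * wide x)%:E)%E).
  apply: ge0_le_integral => //.
  - by apply/measurable_EFinP; apply: (measurableT_comp (@normr_measurable _ _)); apply: measurable_funM => //; apply: measurable_funB.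
  - exact: measurable_int iw.
  - by move=> x _; rewrite lee_fin.
under eq_integral do rewrite EFinM.
rewrite ge0_integralZl//=.
- by rewrite integral_wide -EFinM mulrC.
- exact: measurable_int iwide.
- by move=> x _; rewrite lee_fin.
- by rewrite lee_fin ltW.
Qed.

End Comparison.

Section Posterior.
Variables (R : realType) (Pi : probability (measurableTypeR R) R) (g f : R -> R).
Local Notation mu := (@lebesgue_measure R).
Local Notation I01 := (`]0%R, 1%R[%classic : set R).
Hypothesis mg : measurable_fun I01 g.
Hypothesis g_ge0 : forall x, x \in `]0, 1[ -> 0 <= g x.
Hypothesis PiE : forall A : set R, measurable A ->
  Pi A = (\int[mu]_(x in A `&` I01) (g x)%:E)%E.
Variables (b g0 m s d r omega : R).
Hypothesis g_le : forall x, x \in `]0, 1[ -> g x <= b.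
Hypothesis g0_gt0 : 0 < g0.
Hypothesis s_gt0 : 0 < s.
Hypothesis d_ge0 : 0 <= d.
Hypothesis d_le : d <= 32^-1.
Hypothesis r_ge0 : 0 <= r.
Hypothesis r_lt : r < m.
Hypothesis r_lt1 : m + r < 1.
Hypothesis g_near : forall x, `|x - m| <= r -> `|g x - g0| <= omega.
Hypothesis mf : measurable_fun setT f.
Hypothesis f_ge0 : forall x, 0 <= x <= 1 -> 0 <= f x.
Hypothesis f_le : forall x, 0 <= x <= 1 -> f x <= f m.
Hypothesis fm_gt0 : 0 < f m.
Hypothesis f_near : forall x, `|x - m| <= r ->
  f m * expR (- ((1 + 16 * d) / 2 * ((x - m) / s) ^+ 2)) <= f x <=
  f m * expR (- ((1 - 16 * d) / 2 * ((x - m) / s) ^+ 2)).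
Hypothesis f_far : forall x, 0 <= x <= 1 -> r <= `|x - m| ->
  f x <= f m * expR (- ((1 - 16 * d) / 2 * (r / s) ^+ 2)).

(** [q] dominates the likelihood ratio and the Gaussian weight beyond distance [r]. In [A] the three
    terms stand for the variation of the prior density, the error in the curvature and the Gaussian
    tail. In [Bc], one s^-1 bounds the normal peak and 1 + s^-1 the weight on ]0, 1[. [F] is the
    unnormalized posterior density, scaled so that it resembles the normal density near [m]. *)
Let q := expR (- ((r / s) ^+ 2 / 8)).
Let A := 1024 * (omega / g0 + 8 * d + q).
Let Bc := b / g0 * q * (s^-1 * (1 + s^-1)).
Let c := normal_peak s / (g0 * f m).
Let F (x : R) := c * ((fun x => f x * g x) \_ I01) x.

Let peak_gt0 : 0 < normal_peak s.
Proof. exact: normal_peak_pos. Qed.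

Let in01 x : `|x - m| <= r -> 0 < x < 1.
Proof. by have h1 := r_lt; have h2 := r_lt1; rewrite ler_norml => /andP[]; lra. Qed.

Let omega_ge0 : 0 <= omega.
Proof. by apply: le_trans (g_near (x := m) _); rewrite // subrr normr0. Qed.

Let b_ge0 : 0 <= b.
Proof.
have m01 : m \in `]0, 1[ by rewrite in_itv/= in01// subrr normr0.
by apply: le_trans (g_le m01); exact: g_ge0.
Qed.

Let A_ge0 : 0 <= A.
Proof.
apply: mulr_ge0; first exact: ler0n.
apply: addr_ge0; last exact: expR_ge0.
apply: addr_ge0; first by apply: divr_ge0; last exact: ltW.
by apply: mulr_ge0; first exact: ler0n.
Qed.

Let Bc_ge0 : 0 <= Bc.
Proof.
have s0 := ltW s_gt0; have g00 := ltW g0_gt0.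
by rewrite /Bc !mulr_ge0 ?expR_ge0// ?addr_ge0 ?invr_ge0.
Qed.

Let mF : measurable_fun setT F.
Proof.
apply: measurable_funM => //; apply/(measurable_restrictT _ _).1; first exact: measurable_itv.
by apply: measurable_funM => //; exact: measurable_funTS.
Qed.

(** With t = 8 d y ^ 2, both bounds are the Gaussian times expR (- t) and expR t. As d <= 1 / 32, t
    is at most y ^ 2 / 4, so a quarter of y ^ 2 remains in the exponent. *)
Lemma gauss_perturb (y l : R) :
  expR (- ((1 + 16 * d) / 2 * y ^+ 2)) <= l <= expR (- ((1 - 16 * d) / 2 * y ^+ 2)) ->
  `|l - expR (- (y ^+ 2 / 2))| <= 8 * d * y ^+ 2 * expR (- (y ^+ 2 / 4)) /\
  l <= expR (- (y ^+ 2 / 4)).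
Proof.
have d0 := d_ge0; have d1 := d_le; have y0 := sqr_ge0 y.
have dy : 0 <= d * y ^+ 2 by apply: mulr_ge0.
have dy' : 8 * d * y ^+ 2 <= y ^+ 2 / 4.
  by rewrite [leRHS]mulrC ler_wpM2r//; lra.
set e := expR (- (y ^+ 2 / 2)); have e0 : 0 < e by exact: expR_gt0.
set t := 8 * d * y ^+ 2 in dy' *.
have -> : - ((1 + 16 * d) / 2 * y ^+ 2) = - (y ^+ 2 / 2) + - t by rewrite /t; field.
have -> : - ((1 - 16 * d) / 2 * y ^+ 2) = - (y ^+ 2 / 2) + t by rewrite /t; field.
have t0 : 0 <= t by rewrite /t; lra.
rewrite !expRD -/e => /andP[l1 l2].
have et : e * expR t <= expR (- (y ^+ 2 / 4)).
  by rewrite /e -expRD ler_expR; lra.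
split; last exact: le_trans et.
have h1 := expR_ge1Dx (- t).
have eN : expR t * expR (- t) = 1 by rewrite -expRD subrr expR0.
have ee : e <= expR (- (y ^+ 2 / 4)) by rewrite ler_expR; lra.
have E : t * (e * expR t) <= t * expR (- (y ^+ 2 / 4)) by rewrite ler_wpM2l.
have E2 : t * e <= t * expR (- (y ^+ 2 / 4)) by rewrite ler_wpM2l.
rewrite ler_norml; apply/andP; split.
  have : e * (1 + - t) <= e * expR (- t) by rewrite ler_wpM2l ?(ltW e0).
  lra.
have : expR t * (1 + - t) <= expR t * expR (- t) by rewrite ler_wpM2l ?expR_ge0.
rewrite eN => h.
have : e * (expR t * (1 + - t)) <= e * 1 by rewrite ler_wpM2l ?(ltW e0).
lra.
Qed.

Let normed x : `|x - m| / s = `|(x - m) / s|.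
Proof. by rewrite normrM normfV (gtr0_norm s_gt0). Qed.

Let wideE x : normal_pdf m (2 * s) x = normal_peak s / 2 * expR (- (((x - m) / s) ^+ 2 / 8)).
Proof.
rewrite normal_pdf_scaled ?mulr_gt0// normal_peak2//; congr (_ * expR _).
by field; rewrite gt_eqF.
Qed.

Let FE x : x \in `]0, 1[ -> F x = normal_peak s * (f x / f m * (g x / g0)).
Proof.
move=> x01; rewrite /F patchT ?inE// /c; field.
by rewrite !gt_eqF.
Qed.

Let F_far x : r <= `|x - m| -> F x <= b / g0 * q * s^-1 * \1_I01 x.
Proof.
move=> rx; rewrite indicE; case: (boolP (x \in I01)) => [|h]; last first.
  by rewrite /F patchE (negbTE h) mulr0 mulr0.
rewrite inE => x01; rewrite FE// mulr1.
have /andP[x0 x1] : 0 < x < 1 by move: x01; rewrite /= in_itv.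
have x01' : 0 <= x <= 1 by rewrite !ltW.
have s0 := ltW s_gt0; have g00 := ltW g0_gt0; have f0 := ltW fm_gt0.
have d1 := d_le; have q2 := sqr_ge0 (r / s).
rewrite [leRHS](_ : _ = s^-1 * (q * (b / g0))); last by ring.
apply: ler_pM; rewrite ?(ltW peak_gt0) ?mulr_ge0 ?invr_ge0// ?f_ge0 ?g_ge0//.
  exact: normal_peak_le.
apply: ler_pM; rewrite ?mulr_ge0 ?invr_ge0// ?f_ge0 ?g_ge0//.
  rewrite ler_pdivrMr// mulrC; apply: le_trans (f_far x01' rx) _.
  rewrite ler_wpM2l// ler_expR lerN2.
  rewrite mulrC; have : 8^-1 <= (1 - 16 * d) / 2 by lra.
  by move=> h; rewrite ler_wpM2r.
by rewrite ler_wpM2r ?invr_ge0// g_le.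
Qed.

Let F_ge0 x : 0 <= F x.
Proof.
have g00 := ltW g0_gt0; have f0 := ltW fm_gt0.
rewrite /F mulr_ge0 ?divr_ge0 ?mulr_ge0 ?(ltW peak_gt0)// patchE; case: ifP => //.
rewrite inE => x01; rewrite mulr_ge0 ?g_ge0// f_ge0//.
by move: x01; rewrite /= in_itv/= => /andP[? ?]; rewrite !ltW.
Qed.

Lemma posterior_close x : `|F x - normal_pdf m s x| * (1 + `|x - m| / s) <=
  A * normal_pdf m (2 * s) x + Bc * \1_I01 x.
Proof.
set y := (x - m) / s; rewrite normed -/y.
have y1 : 0 < 1 + `|y| by rewrite ltr_pwDl.
have P0 := poly_gauss_bound y.
have g00 := ltW g0_gt0; have pk0 := ltW peak_gt0.
have y20 := sqr_ge0 y; have w0 := omega_ge0; have dd := d_ge0.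
have [xr|xr] := leP `|x - m| r.
  have x01 : x \in `]0, 1[ by rewrite in_itv/= in01.
  apply: (@le_trans _ _ (A * normal_pdf m (2 * s) x)); last by rewrite lerDl; apply: mulr_ge0.
  rewrite FE// normal_pdf_scaled// wideE -/y -mulrBr normrM (ger0_norm pk0).
  set l := f x / f m; have l0 : 0 <= l by rewrite divr_ge0 ?(ltW fm_gt0)// f_ge0//; have /andP[? ?] := in01 xr; rewrite !ltW.
  have [] : `|l - expR (- (y ^+ 2 / 2))| <= 8 * d * y ^+ 2 * expR (- (y ^+ 2 / 4)) /\
    l <= expR (- (y ^+ 2 / 4)).
    apply: gauss_perturb; rewrite /l ler_pdivlMr// ler_pdivrMr//.
    by rewrite ![_ * f m]mulrC; exact: f_near.
  set e := expR (- (y ^+ 2 / 4)) => l1 l2; have e0 : 0 <= e by exact: expR_ge0.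
  have h : `|l * (g x / g0) - expR (- (y ^+ 2 / 2))| <= (omega / g0 + 8 * d) * ((1 + y ^+ 2) * e).
    (* Separates the variation of the prior density from the deviation of the likelihood. *)
    rewrite (_ : l * (g x / g0) - _ = l * ((g x - g0) / g0) + (l - expR (- (y ^+ 2 / 2)))); last by field; rewrite gt_eqF.
    apply: le_trans (ler_normD _ _) _.
    have -> : (omega / g0 + 8 * d) * ((1 + y ^+ 2) * e) = e * (omega / g0) + (8 * d * y ^+ 2 * e) + (omega / g0 * (y ^+ 2 * e) + 8 * d * e) by ring.
    apply: (@le_trans _ _ (e * (omega / g0) + 8 * d * y ^+ 2 * e)); last by rewrite lerDl; apply: addr_ge0; apply: mulr_ge0 => //; [exact: divr_ge0|exact: mulr_ge0|exact: mulr_ge0].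
    apply: lerD => //; rewrite normrM (ger0_norm l0); apply: ler_pM => //.
    by rewrite normrM normfV (gtr0_norm g0_gt0) ler_wpM2r ?invr_ge0// g_near.
  rewrite (_ : A * _ = normal_peak s * ((omega / g0 + 8 * d + q) * (512 * expR (- (y ^+ 2 / 8))))); last by rewrite /A; field; rewrite gt_eqF.
  rewrite -[leLHS]mulrA ler_wpM2l//; apply: (@le_trans _ _ ((omega / g0 + 8 * d) * ((1 + y ^+ 2) * e) * (1 + `|y|))).
    by rewrite ler_wpM2r ?(ltW y1).
  rewrite -mulrA; apply: ler_pM.
  - by apply: addr_ge0; [exact: divr_ge0|apply: mulr_ge0; first exact: ler0n].
  - by rewrite !mulr_ge0 ?(ltW y1) ?addr_ge0.
  - by rewrite lerDl expR_ge0.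
  - by apply: le_trans P0; rewrite -/e mulrC mulrA.
(* Far from [m] both densities are small and are bounded separately. *)
have xr' := ltW xr; have s0 := ltW s_gt0.
apply: (@le_trans _ _ ((F x + normal_pdf m s x) * (1 + `|y|))).
  rewrite ler_wpM2r ?(ltW y1)//; apply: le_trans (ler_normB _ _) _.
  by rewrite !ger0_norm ?F_ge0 ?normal_pdf_ge0.
rewrite mulrDl addrC; apply: lerD.
  rewrite normal_pdf_scaled// wideE -/y.
  rewrite (_ : A * _ = normal_peak s * ((omega / g0 + 8 * d + q) * (512 * expR (- (y ^+ 2 / 8))))); last by rewrite /A; field; rewrite gt_eqF.
  rewrite -[leLHS]mulrA ler_wpM2l//.
  apply: (@le_trans _ _ (q * (512 * expR (- (y ^+ 2 / 8))))); last first.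
    apply: ler_wpM2r; last by rewrite lerDr; apply: addr_ge0; [exact: divr_ge0|apply: mulr_ge0; first exact: ler0n].
    by apply: mulr_ge0; [exact: ler0n|exact: expR_ge0].
  apply: (@le_trans _ _ (q * ((1 + `|y|) * (1 + y ^+ 2) * expR (- (y ^+ 2 / 4))))); last first.
    by rewrite ler_wpM2l ?expR_ge0.
  have qy : expR (- (y ^+ 2 / 4)) <= q.
    rewrite ler_expR lerN2; have : (r / s) ^+ 2 <= y ^+ 2.
      rewrite -[y ^+ 2](real_normK (num_real _)) -normed; apply: lerXn2r; rewrite ?nnegrE ?divr_ge0//.
      by rewrite ler_wpM2r ?invr_ge0.
    lra.
  have -> : expR (- (y ^+ 2 / 2)) = expR (- (y ^+ 2 / 4)) * expR (- (y ^+ 2 / 4)).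
    by rewrite -expRD; congr expR; field.
  set e := expR (- (y ^+ 2 / 4)) in qy *; have e0 : 0 <= e by exact: expR_ge0.
  rewrite -[leLHS]mulrA ler_pM// ?mulr_ge0 ?(ltW y1)//.
  by rewrite [leRHS]mulrC ler_wpM2l// ler_peMr ?(ltW y1)// lerDl.
rewrite /Bc; apply: (@le_trans _ _ (b / g0 * q * s^-1 * \1_I01 x * (1 + `|y|))).
  by rewrite ler_wpM2r ?(ltW y1)// F_far.
rewrite indicE; case: (boolP (x \in I01)) => [|h]; last by rewrite !mulr0 mul0r.
rewrite inE => /=; rewrite in_itv/= => /andP[x0 x1]; rewrite !mulr1 !mulrA.
rewrite ler_wpM2l//; first by rewrite !mulr_ge0 ?expR_ge0 ?invr_ge0.
rewrite lerD2l -normed -[leRHS]mul1r ler_wpM2r ?invr_ge0//.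
have h1 := r_ge0; have h2 := r_lt; have h3 := r_lt1.
by rewrite ler_norml; lra.
Qed.

Let kappa := A + Bc.
Hypothesis kappa_le : kappa <= 2^-1.

Let iF : mu.-integrable setT (EFin \o F).
Proof. exact: (comparison_integrable s_gt0 A_ge0 Bc_ge0 mF posterior_close). Qed.

(** The posterior density is F / z. Comparison with the total mass 1 of the normal law keeps [z] at
    least 1 / 2. *)
Let z := \int[mu]_x F x.

Let z_near : `|z - 1| <= kappa.
Proof.
have := comparison_set s_gt0 A_ge0 Bc_ge0 mF posterior_close measurableT.
by rewrite [X in _ - X](_ : _ = 1)// /Rintegral integral_normal_pdf ?gt_eqF.
Qed.

Let z_ge : 2^-1 <= z.
Proof. by have h := kappa_le; move: z_near; rewrite ler_norml => /andP[]; lra. Qed.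

Let Z := \int[Pi]_(x in I01) f x.

Let c_gt0 : 0 < c.
Proof. by rewrite divr_gt0 ?mulr_gt0. Qed.

Let f_norm_le x : 0 < x < 1 -> `|f x| <= f m.
Proof.
by move=> /andP[? ?]; rewrite ger0_norm ?f_ge0 ?f_le// !ltW.
Qed.

Let FZ : \int[mu]_x ((fun x => f x * g x) \_ I01) x = c^-1 * z.
Proof.
rewrite /z -RintegralZl//; apply: eq_Rintegral => x _.
by rewrite /F mulrA mulVf ?mul1r// gt_eqF.
Qed.

Let ZE : Z = c^-1 * z.
Proof. by have := Rintegral_density mg PiE measurableT mf f_norm_le; rewrite setTI FZ. Qed.

Lemma posterior_set (B : set (measurableTypeR R)) : measurable B ->
  \int[Pi]_(x in B `&` I01) (f x / Z) = z^-1 * \int[mu]_(x in B) F x.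
Proof.
move=> mB; have mfZ : measurable_fun setT (fun x => f x / Z) by exact: measurable_funM.
rewrite (@Rintegral_density _ _ _ mg PiE B (fun x => f x / Z) (f m / Z))//; last first.
  have Z0 : 0 < Z by rewrite ZE mulr_gt0 ?invr_gt0//; apply: lt_le_trans z_ge.
  by move=> x x01; rewrite normrM normfV (gtr0_norm Z0) ler_pM2r ?invr_gt0// f_norm_le.
rewrite -RintegralZl//; last by apply: integrableS iF.
apply: eq_Rintegral => x _; rewrite /F ZE /patch; case: ifP => _; last by rewrite !mulr0.
by have z0 : 0 < z by [apply: lt_le_trans z_ge]; field; rewrite !gt_eqF.
Qed.

Lemma posterior_mean_integral :
  \int[Pi]_(x in I01) (x * (f x / Z)) - m = z^-1 * \int[mu]_x ((x - m) * F x).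
Proof.
have mfZ : measurable_fun setT (fun x : R => x * (f x / Z)) by apply: measurable_funM => //; exact: measurable_funM.
have z0 : 0 < z by apply: lt_le_trans z_ge.
have [i1 _] := comparison_first s_gt0 A_ge0 Bc_ge0 mF posterior_close.
have := @Rintegral_density _ _ _ mg PiE setT (fun x : R => x * (f x / Z)) (f m / Z) measurableT mfZ; rewrite setTI => ->; last first.
  have Z0 : 0 < Z by rewrite ZE mulr_gt0 ?invr_gt0.
  move=> x x01; have /andP[x0 x1] := x01.
  rewrite !normrM normfV (gtr0_norm Z0) (gtr0_norm x0) -[leRHS]mul1r ler_pM// ?(ltW x0) ?(ltW x1)//.
    by rewrite divr_ge0 ?(ltW Z0).
  by rewrite ler_pM2r ?invr_gt0// f_norm_le.
have i2 : mu.-integrable setT (EFin \o (fun x => m * F x)).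
  rewrite (_ : _ \o _ = (fun x => m%:E * (EFin \o F) x)%E); last by apply/funext => x /=; rewrite EFinM.
  exact: integrableZl.
have i3 : mu.-integrable setT (EFin \o (fun x => x * F x)).
  rewrite (_ : _ \o _ = (EFin \o (fun x => (x - m) * F x)) \+ (EFin \o (fun x => m * F x))).
    exact: integrableD.
  by apply/funext => x /=; rewrite -EFinD; congr _%:E; ring.
have e : \int[mu]_x (x * F x) = \int[mu]_x ((x - m) * F x) + m * z.
  by rewrite /z -RintegralZl// -RintegralD//; apply: eq_Rintegral => x _ /=; ring.
have -> : \int[mu]_x ((fun x => x * (f x / Z) * g x) \_ I01) x = z^-1 * \int[mu]_x (x * F x).
  rewrite -RintegralZl//; apply: eq_Rintegral => x _; rewrite /F ZE /patch; case: ifP => _; last by rewrite !mulr0.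
  by field; rewrite !gt_eqF.
by rewrite e; field; rewrite gt_eqF.
Qed.

Lemma posterior_normal (B : set (measurableTypeR R)) : measurable B ->
  `|\int[Pi]_(x in B `&` I01) (f x / Z) - fine (normal_prob m s B)| <= 4 * kappa.
Proof.
move=> mB; rewrite posterior_set//.
have hk := comparison_set s_gt0 A_ge0 Bc_ge0 mF posterior_close mB.
have nE : \int[mu]_(x in B) normal_pdf m s x = fine (normal_prob m s B) by [].
have n0 : 0 <= fine (normal_prob m s B) by rewrite fine_ge0.
have n1 : fine (normal_prob m s B) <= 1 by apply: fine_prob_le1.
rewrite nE -/kappa in hk; set p := \int[mu]_(x in B) F x in hk *.
set n := fine _ in hk n0 n1 *.
have zp : 0 < z by have := z_ge; lra.
(* One [kappa] comes from the set [B] and one from the normalization; dividing by z >= 1 / 2 doubles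
   both. *)
rewrite (_ : z^-1 * p - n = z^-1 * ((p - n) + n * (1 - z))); last by field; rewrite gt_eqF.
rewrite normrM gtr0_norm ?invr_gt0// mulrC ler_pdivrMr//.
apply: le_trans (ler_normD _ _) _; rewrite normrM (ger0_norm n0) distrC.
have h : n * `|1 - z| <= kappa by rewrite distrC -[leRHS]mul1r ler_pM.
have := z_ge; have k0 : 0 <= kappa by rewrite addr_ge0.
rewrite distrC in hk => hz.
have : 4 * kappa * 2^-1 <= 4 * kappa * z by rewrite ler_wpM2l// mulr_ge0.
lra.
Qed.

(** Away from [m] the integrand is at most the second part of the wide bound, so contraction follows
    without estimating normal tails. *)
Lemma posterior_far (B : set (measurableTypeR R)) : measurable B ->
  (forall x, x \in `]0, 1[ -> B x -> r <= `|x - m|) ->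
  `|\int[Pi]_(x in B `&` I01) (f x / Z)| <= 2 * kappa.
Proof.
move=> mB Bfar; rewrite posterior_set//.
have zp : 0 < z by have := z_ge; lra.
have I0 : 0 <= \int[mu]_(x in B) F x by apply: Rintegral_ge0 => x _; exact: F_ge0.
rewrite ger0_norm ?mulr_ge0 ?invr_ge0 ?(ltW zp)// mulrC ler_pdivrMr//.
suff h : \int[mu]_(x in B) F x <= kappa.
  have k0 := le_trans I0 h; apply: le_trans h _; have hz := z_ge.
  have : 2 * kappa * 2^-1 <= 2 * kappa * z by rewrite ler_wpM2l// mulr_ge0.
  lra.
have FB x : B x -> F x <= Bc * \1_I01 x.
  move=> Bx; rewrite indicE; case: (boolP (x \in I01)) => [|h]; last first.
    by rewrite /F patchE (negbTE h) !mulr0.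
  rewrite inE => x01; apply: le_trans (F_far (Bfar x x01 Bx)) _.
  rewrite indicE mem_set// !mulr1 /Bc ler_wpM2l ?mulr_ge0 ?expR_ge0 ?invr_ge0 ?(ltW g0_gt0)//.
  by rewrite ler_peMr ?invr_ge0 ?(ltW s_gt0)// lerDl invr_ge0 ltW.
have mI01 : measurable (I01 : set (measurableTypeR R)) by exact: measurable_itv.
rewrite /Rintegral -lee_fin fineK; last by apply: integrable_fin_num => //; apply: integrableS iF.
apply: (@le_trans _ _ (\int[mu]_(x in B) (Bc * \1_I01 x)%:E)%E).
  apply: ge0_le_integral => //.
  - by move=> x _; rewrite lee_fin.
  - by apply/measurable_EFinP; exact: measurable_funTS.
  - by apply/measurable_EFinP; apply: measurable_funTS; apply: measurable_funM.
under eq_integral do rewrite EFinM.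
rewrite ge0_integralZl//=; last by apply/measurable_EFinP; exact: measurable_funTS.
rewrite integral_indic//.
apply: (@le_trans _ _ (Bc%:E * 1)%E); last by rewrite mule1 lee_fin /kappa lerDr.
rewrite lee_wpmul2l ?lee_fin//.
have <- : mu I01 = 1%E by rewrite [LHS]lebesgue_measure_itv/= lte_fin ltr01 oppr0 adde0.
by apply: le_measure; rewrite ?inE//; exact: measurableI.
Qed.

Lemma posterior_mean_near :
  `|\int[Pi]_(x in I01) (x * (f x / Z)) - m| <= 2 * kappa * s.
Proof.
rewrite posterior_mean_integral.
have [_ hk] := comparison_first s_gt0 A_ge0 Bc_ge0 mF posterior_close.
have zp : 0 < z by have := z_ge; lra.
rewrite normrM gtr0_norm ?invr_gt0// mulrC ler_pdivrMr//; apply: le_trans hk _.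
have ks : 0 <= kappa * s by rewrite mulr_ge0 ?addr_ge0// ltW.
have := z_ge; rewrite -/kappa => hz.
have : 2 * (kappa * s) * 2^-1 <= 2 * (kappa * s) * z by rewrite ler_wpM2l// mulr_ge0.
lra.
Qed.

End Posterior.

(** The [kappa] of the comparison as a function of its parameters, so that the others can be fixed
    before [s]. *)
Definition posterior_error (R : realType) (b g0 d r omega s : R) : R :=
  1024 * (omega / g0 + 8 * d + expR (- ((r / s) ^+ 2 / 8))) +
  b / g0 * expR (- ((r / s) ^+ 2 / 8)) * (s^-1 * (1 + s^-1)).

(** From expR (- u) <= 4 / u ^ 2 with u = (r / s) ^ 2 / 8, the exponential is at most 256 s ^ 4 / r
    ^ 4, which outweighs the factor of order s ^ (- 2) in the far term. *)
Lemma posterior_error_limit (R : realType) (b g0 d r omega e : R) : 0 <= b -> 0 < g0 ->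
  0 < r -> 0 < e ->
  exists2 s1, 0 < s1 & forall s, 0 < s < s1 ->
    posterior_error b g0 d r omega s <= 1024 * (omega / g0 + 8 * d) + e.
Proof.
move=> b0 g00 r0 e0.
pose K := (1024 + b / g0 * 2) * (256 / r ^+ 4).
have K0 : 0 < K.
  apply: mulr_gt0; last by apply: divr_gt0; [rewrite ltr0n|exact: exprn_gt0].
  by apply: ltr_pwDl; [rewrite ltr0n|rewrite mulr_ge0// divr_ge0// ltW].
exists (Num.min 1 (e / K)); first by rewrite lt_min ltr01 divr_gt0.
move=> s /andP[s0]; rewrite lt_min => /andP[s1 sK].
rewrite /posterior_error mulrDr -addrA lerD2l.
set q := expR _.
have s0' := ltW s0; have s1' := ltW s1.
have qs : q <= 256 / r ^+ 4 * s ^+ 4.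
  set u := (r / s) ^+ 2 / 8; have u0 : 0 < u by rewrite divr_gt0// exprn_gt0 ?divr_gt0.
  have -> : 256 / r ^+ 4 * s ^+ 4 = 4 / u ^+ 2 by rewrite /u; field; rewrite !gt_eqF.
  rewrite /q expRN -/u -[leLHS]mul1r ler_pdivrMr ?expR_gt0// mulrAC ler_pdivlMr ?exprn_gt0// mul1r.
  have h := expR_ge1Dx (u / 2).
  have -> : u = u / 2 * 2 by field.
  rewrite -[2 in X in _ <= _ * expR X]/(2%:R) expRM_natr.
  have uh : 0 <= u / 2 by rewrite divr_ge0 ?(ltW u0).
  have h2 : u / 2 <= expR (u / 2) by lra.
  have -> : (u / 2 * 2) ^+ 2 = 4 * (u / 2) ^+ 2 by ring.
  by rewrite ler_pM2l; [apply: lerXn2r h2; rewrite nnegrE ?expR_ge0|rewrite ltr0n].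
have Ke : K * s <= e by rewrite mulrC -ler_pdivlMr// ltW.
apply: le_trans Ke.
have c0 : 0 <= 256 / r ^+ 4 by apply: divr_ge0; [exact: ler0n|rewrite exprn_ge0// ltW].
have s4 : s ^+ 4 <= s.
  by rewrite -[leRHS]expr1 ler_wiXn2l.
have s3 : s ^+ 4 * (s^-1 * (1 + s^-1)) <= 2 * s.
  have -> : s ^+ 4 * (s^-1 * (1 + s^-1)) = s ^+ 2 * (s + 1) by field; rewrite gt_eqF.
  have : s ^+ 2 <= s by rewrite -[leRHS]expr1 ler_wiXn2l.
  have := sqr_ge0 s; nra.
rewrite (_ : K * s = 1024 * (256 / r ^+ 4 * s) + b / g0 * (256 / r ^+ 4 * (2 * s))); last by rewrite /K; ring.
apply: lerD.
  by rewrite ler_pM2l ?ltr0n//; apply: le_trans qs _; rewrite ler_wpM2l.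
rewrite -[leLHS]mulrA ler_wpM2l ?divr_ge0 ?(ltW g00)//.
have sp : 0 <= s^-1 * (1 + s^-1) by rewrite mulr_ge0 ?addr_ge0 ?invr_ge0.
apply: (@le_trans _ _ (256 / r ^+ 4 * s ^+ 4 * (s^-1 * (1 + s^-1)))).
  by rewrite ler_wpM2r.
rewrite -[leLHS]mulrA.
by rewrite ler_wpM2l.
Qed.

Section PosteriorBounds.
Variables (R : realType) (T : eqType) (Pi : probability (measurableTypeR R) R) (g : R -> R).
Local Notation mu := (@lebesgue_measure R).
Local Notation I01 := (`]0%R, 1%R[%classic : set R).
Local Notation mid x := (Num.min x (1 - x)).
Hypothesis mg : measurable_fun I01 g.
Hypothesis g_ge0 : forall x, x \in `]0, 1[ -> 0 <= g x.
Hypothesis PiE : forall A : set R, measurable A ->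
  Pi A = (\int[mu]_(x in A `&` I01) (g x)%:E)%E.
Variables (b M s0 d omega W xh : R) (xs : seq T).
Hypothesis g_le : forall x, x \in `]0, 1[ -> g x <= b.
Hypothesis M0 : 0 <= M.
Hypothesis s01 : 0 < s0 < 1.
Hypothesis g0_gt0 : 0 < g s0.
Hypothesis d01 : 0 < d <= 32^-1.
Hypothesis W_gt0 : 0 < W.
Let r := d * mid s0 / 4.
Hypothesis g_near : forall x, `|x - s0| <= 2 * r -> `|g x - g s0| <= omega.
Hypothesis xhmax : is_maximizer (likelihood M xs) xh.
Hypothesis curv : `|log_curv (lik_factors M xs) s0 - W| <= d * W.
Hypothesis left_pos : 0 < log_deriv (lik_factors M xs) (s0 - r).
Hypothesis right_neg : log_deriv (lik_factors M xs) (s0 + r) < 0.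
Let s := Num.sqrt (1 / W).
Let kappa := posterior_error b (g s0) d r omega s.
Hypothesis kappa_le : kappa <= 2^-1.

(** The window of radius [r] is centred at [xh], which itself is within [r] of [s0]; hence the
    radius 2 r in the condition on the prior density and in the far sets. *)
Lemma likelihood_bounds : [/\ `|xh - s0| <= r,
  forall B : set (measurableTypeR R), measurable B ->
    `|posterior Pi M xs B - normal_of_variance xh (1 / W) B| <= 4 * kappa,
  forall B : set (measurableTypeR R), measurable B -> (forall x, B x -> 2 * r <= `|x - s0|) ->
    `|posterior Pi M xs B| <= 2 * kappa &
  `|posterior_mean Pi M xs - xh| <= 2 * kappa * s].
Proof.
have afs := lik_factors_admissible M0 xs.
set c := (rising (M + 1) (size xs).-1)^-1.
have c0 : 0 < c by rewrite invr_gt0 rising_gt0.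
have LE x : likelihood M xs x = c * affine_prod (lik_factors M xs) x by exact: likelihoodE.
have [xh01 xhm] := xhmax.
have amax : is_maximizer (affine_prod (lik_factors M xs)) xh.
  by split=> // y /xhm; rewrite !LE ler_pM2l.
have [near0 sand far] := maximizer_sandwich afs amax s01 d01 W_gt0 curv left_pos right_neg.
have near1 : `|xh - s0| <= r := near0.
have m0 := mid_gt0 s01; have /andP[s00 s0lt] := s01; have /andP[d0 d1] := d01.
have [ms0 ms1] : mid s0 <= s0 /\ mid s0 <= 1 - s0 by rewrite !ge_min !lexx orbT.
have dm : d * mid s0 <= 32^-1 * mid s0 by rewrite ler_wpM2r// ltW.
have r0 : 0 < r by rewrite divr_gt0// mulr_gt0.
have r_mid : r <= mid s0 / 128 by rewrite /r; lra.
have /andP[n1 n2] : s0 - r <= xh <= s0 + r by move: near0; rewrite ler_distl.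
have xh_in : 0 < xh < 1 by lra.
have s_gt0 : 0 < s by rewrite sqrtr_gt0 divr_gt0.
have sq x : W * x ^+ 2 = (x / s) ^+ 2.
  by rewrite expr_div_n sqr_sqrtr ?divr_ge0 ?(ltW W_gt0)// div1r invrK mulrC.
have ml : measurable_fun setT (likelihood M xs).
  rewrite (_ : likelihood M xs = fun x => c * affine_prod (lik_factors M xs) x); last exact/funext.
  apply: measurable_funM => //; apply: measurable_prod => f _.
  by apply: measurable_funD => //; apply: measurable_funM.
have l0 x : 0 <= x <= 1 -> 0 <= likelihood M xs x.
  by move=> x01; rewrite LE mulr_ge0 ?(ltW c0)// affine_prod_ge0.
have lm x : 0 <= x <= 1 -> likelihood M xs x <= likelihood M xs xh by move=> x01; exact: xhm.
have lp : 0 < likelihood M xs xh by rewrite LE mulr_gt0// affine_prod_gt0.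
have dw := ltW d0; have rw := ltW r0.
have rx : r < xh by lra.
have rx1 : xh + r < 1 by lra.
have gn x : `|x - xh| <= r -> `|g x - g s0| <= omega.
  move=> h; apply: g_near; rewrite -(subrK xh x) -addrA.
  by apply: le_trans (ler_normD _ _) _; lra.
have ln x : `|x - xh| <= r ->
  likelihood M xs xh * expR (- ((1 + 16 * d) / 2 * ((x - xh) / s) ^+ 2)) <= likelihood M xs x <=
  likelihood M xs xh * expR (- ((1 - 16 * d) / 2 * ((x - xh) / s) ^+ 2)).
  by move=> /sand; rewrite !LE -!mulrA !ler_pM2l// -!sq !mulrA.
have lf x : 0 <= x <= 1 -> r <= `|x - xh| -> likelihood M xs x <=
  likelihood M xs xh * expR (- ((1 - 16 * d) / 2 * (r / s) ^+ 2)).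
  move=> x01 xr; have h := far x x01 xr; rewrite -/r -[_ * W * _]mulrA sq in h.
  by rewrite !LE -[leRHS]mulrA ler_pM2l.
split=> //.
- move=> B mB.
  exact: (posterior_normal mg g_ge0 PiE g_le g0_gt0 s_gt0 dw d1 rw rx rx1 gn ml l0 lm lp ln lf kappa_le mB).
- move=> B mB Bf.
  apply: (posterior_far mg g_ge0 PiE g_le g0_gt0 s_gt0 dw d1 rw rx rx1 gn ml l0 lm lp ln lf kappa_le mB).
  move=> x _ /Bf h; have := ler_normD (x - xh) (xh - s0); rewrite addrA subrK; lra.
- exact: (posterior_mean_near mg g_ge0 PiE g_le g0_gt0 s_gt0 dw d1 rw rx rx1 gn ml l0 lm lp ln lf kappa_le).
Qed.

End PosteriorBounds.

(** * Laws of large numbers *)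

Section HighProbability.
Variables (R : realType) (d : measure_display) (Omega : measurableType d).
Variable P : probability Omega R.
Implicit Types (S : nat -> Omega -> Prop) (e : R).

(* The exceptional set B may depend on e, and S n itself need not be measurable. *)
Definition bad_le S e := exists N, forall n, (N <= n)%N ->
  exists2 B : set Omega, measurable B & (forall w, ~ B w -> S n w) /\ fine (P B) <= e.

Definition whp S := forall e, 0 < e -> bad_le S e.

Lemma bad_le_mono S S' e : bad_le S e ->
  (exists N, forall n w, (N <= n)%N -> S n w -> S' n w) -> bad_le S' e.
Proof.
move=> [N1 h] [N2 SS]; exists (maxn N1 N2) => n; rewrite geq_max => /andP[n1 n2].
have [B mB [hB PB]] := h n n1; exists B => //; split=> // w /hB; exact: SS.
Qed.

Lemma bad_le_and S S' e e' : bad_le S e -> bad_le S' e' ->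
  bad_le (fun n w => S n w /\ S' n w) (e + e').
Proof.
move=> [N1 h1] [N2 h2]; exists (maxn N1 N2) => n; rewrite geq_max => /andP[n1 n2].
have [B1 m1 [H1 P1]] := h1 n n1; have [B2 m2 [H2 P2]] := h2 n n2.
exists (B1 `|` B2); first exact: measurableU.
split=> [w /not_orP[b1 b2]|]; first by split; [exact: H1|exact: H2].
apply: le_trans (lerD P1 P2).
rewrite -lee_fin EFinD !fineK ?fin_num_measure//; last exact: measurableU.
exact: measureU2.
Qed.

Lemma whp_mono S S' : whp S ->
  (exists N, forall n w, (N <= n)%N -> S n w -> S' n w) -> whp S'.
Proof. by move=> h SS e e0; apply: bad_le_mono SS; exact: h. Qed.

Lemma whp_and S S' : whp S -> whp S' -> whp (fun n w => S n w /\ S' n w).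
Proof.
move=> h h' e e0; have e2 : 0 < e / 2 by rewrite divr_gt0.
by have := bad_le_and (h _ e2) (h' _ e2); rewrite -splitr.
Qed.

Lemma whp_eventually S : (exists N, forall n w, (N <= n)%N -> S n w) -> whp S.
Proof.
move=> [N h] e e0; exists N => n Nn; exists set0 => //.
by rewrite measure0; split=> [w _|]; [exact: h|exact: ltW].
Qed.

Lemma whp_all (S : nat -> nat -> Omega -> Prop) A : (forall m, whp (S m)) ->
  whp (fun n w => forall m, (m < A)%N -> S m n w).
Proof.
move=> h; elim: A => [|A IH]; first by apply: whp_eventually; exists 0%N.
apply: (whp_mono (whp_and IH (h A))); exists 0%N => n w _ [h1 h2] m.
by rewrite ltnS leq_eqVlt => /orP[/eqP->//|]; exact: h1.
Qed.

(** The deviation set is contained in the measurable exceptional set, and outer probability is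
    monotone and agrees with [P] there. *)
Lemma cvg_in_probability_whp (Y : nat -> Omega -> R) c :
  (forall e, 0 < e -> whp (fun n w => `|Y n w - c| <= e)) -> cvg_in_probability P Y c.
Proof.
move=> h eps eps0; apply/fine_cvgP; split.
  have [N hN] := h eps eps0 1 ltr01; exists N => // n /= Nn; have [B mB [hB PB]] := hN n Nn.
  rewrite ge0_fin_numE ?mu_ext_ge0//; apply: (@le_lt_trans _ _ (P B)).
    rewrite -(measurable_mu_extE P mB); apply: le_mu_ext => w /= hw.
    by apply: contrapT => /hB; rewrite leNgt hw.
  exact: le_lt_trans (probability_le1 P mB) (ltry 1).
apply/cvgr0Pnorm_le => e e0; have [N hN] := h eps eps0 e e0; exists N => // n /= Nn.
have [B mB [hB PB]] := hN n Nn.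
rewrite ger0_norm ?fine_ge0 ?mu_ext_ge0//; apply: le_trans PB.
have PBE : P B = (P^*)%mu B by rewrite measurable_mu_extE.
have le : ((P^*)%mu [set w | (eps < `|Y n w - c|)%R] <= P B)%E.
  rewrite PBE; apply: le_mu_ext => w /= hw.
  by apply: contrapT => /hB; rewrite leNgt hw.
apply: fine_le => //; last exact: fin_num_measure.
rewrite ge0_fin_numE ?mu_ext_ge0//; apply: le_lt_trans le _.
exact: le_lt_trans (probability_le1 P mB) (ltry 1).
Qed.

End HighProbability.

(** * From values of the sample to cells *)

Section SampleCounts.
Variables (T : choiceType) (A : nat -> set T).
Hypothesis A_disj : forall i j x, A i x -> A j x -> i = j.
Hypothesis A_sub : forall k x y, A k x -> A k y -> x = y.

(** A cell holds at most one point, so counting cells counts values. For m = 0 the cells that are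
    not hit would be counted as well. *)
Lemma num_ge_cells (s : seq T) J m : (0 < m)%N ->
  (forall x, x \in s -> exists2 k, (k < J)%N & A k x) ->
  num_ge s m = (\sum_(k < J) (m <= count (fun x => x \in A k) s))%N.
Proof.
move=> m0 cov; rewrite /num_ge.
have one x : x \in undup s -> (\sum_(k < J) (x \in A k) = 1)%N.
  rewrite mem_undup => /cov[k kJ Akx]; rewrite (bigD1 (Ordinal kJ))//= mem_set// big1// => i ik.
  rewrite memNset// => Aix; move/eqP: ik; apply; apply: val_inj => /=; exact: A_disj Aix Akx.
rewrite big_seq (eq_bigr (fun x => \sum_(k < J) (x \in A k) * (m <= count_mem x s))%N); last first.
  by move=> x /one e; rewrite -big_distrl /= e mul1n.
rewrite -big_seq exchange_big; apply: eq_bigr => k _ /=.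
have [[x xs Akx]|nx] := pselect (exists2 x, x \in s & A k x).
  have eqA y : (y \in A k) = (y == x).
    by apply/idP/eqP => [|->]; [rewrite inE => Aky; exact: A_sub Aky Akx|rewrite mem_set].
  rewrite (bigD1_seq x) ?undup_uniq ?mem_undup//= mem_set// mul1n big1 ?addn0.
    by congr (_ <= _)%N; apply: eq_count => y; rewrite eqA.
  by move=> y yx; rewrite eqA (negbTE yx).
have nA y : y \in s -> (y \in A k) = false.
  by move=> ys; apply: memNset => Aky; apply: nx; exists y.
rewrite big_seq big1 => [|y]; last by rewrite mem_undup => /nA ->.
rewrite (eq_in_count (a2 := pred0)) ?count_pred0; last exact: nA.
by rewrite leqNgt m0.
Qed.

End SampleCounts.

Section SeriesSigns.
Variables (R : realType) (s0 : R).
Hypothesis s01 : 0 < s0 < 1.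
Local Notation c m := (gcoef s0 m).

Lemma nat_sub_ge (y : R) m : (0 < m)%N -> 0 <= y -> (1 - y) * m%:R <= m%:R - y.
Proof.
move=> m0 y0; have m1 : 1 <= m%:R :> R by rewrite ler1n.
by rewrite mulrBl mul1r lerD2l lerN2 ler_peMr.
Qed.

(** At [s0] both parts of the limit equal c 0 / s0, by telescoping. As y moves away they move in
    opposite directions, and a termwise comparison with [s0] gives the sign. *)
Lemma score_limit y : 0 < y < 1 -> exists S, [/\
  \sum_(1 <= m < n) c m * (m%:R - y)^-1 @[n --> \oo] --> S,
  y < s0 -> 0 < c 0 * y^-1 - S & s0 < y -> c 0 * y^-1 - S < 0].
Proof.
move=> /andP[y0 y1]; have s01' := s01; have /andP[s00 s0lt] := s01.
have c0 : 0 < c 0 by exact: gcoef_gt0.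
pose u m := c m * (m%:R - y)^-1.
have my m : (0 < m)%N -> 0 < m%:R - y.
  by move=> m0; have := nat_sub_ge m0 (ltW y0); apply: lt_le_trans; rewrite mulr_gt0 ?subr_gt0 ?ltr0n.
have ms m : (0 < m)%N -> 0 < m%:R - s0 by exact: gap_gt0.
have u0 m : (0 < m)%N -> 0 <= u m.
  by move=> m0; rewrite mulr_ge0 ?gcoef_ge0// invr_ge0 ltW ?my.
have uK n : \sum_(1 <= m < n) u m <= (1 + (1 - y)^-1) * (c 0 / s0).
  have y1' : 0 < 1 - y by rewrite subr_gt0.
  apply: (@le_trans _ _ ((1 + (1 - y)^-1) * \sum_(1 <= m < n) c m / (m%:R - s0))); last first.
    by rewrite ler_wpM2l ?gcoef_sum_le// addr_ge0 ?invr_ge0 ?(ltW y1').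
  rewrite mulr_sumr big_nat_cond [leRHS]big_nat_cond; apply: ler_sum => m /andP[/andP[m0 _] _].
  rewrite /u mulrCA ler_wpM2l ?gcoef_ge0// ler_pdivlMr ?ms// mulrC ler_pdivrMr ?my//.
  have m1 : 1 <= m%:R :> R by rewrite ler1n.
  have : 1 <= (1 - y)^-1 * (m%:R - y) by rewrite mulrC ler_pdivlMr// mul1r; lra.
  by rewrite mulrDl mul1r; lra.
have lim := bounded_series_cvg u0 uK.
set S := lim _ in lim; exists S.
have SE : \sum_(1 <= m < n) u m @[n --> \oo] --> S by exact: lim.
split=> // [ys|sy].
  have : S <= c 0 / s0.
    apply: (cvgr_to_le SE); apply: nearW => n.
    apply: le_trans (gcoef_sum_le s01 n).
    rewrite big_nat_cond [leRHS]big_nat_cond; apply: ler_sum => m /andP[/andP[m0 _] _].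
    by rewrite ler_wpM2l ?gcoef_ge0// lef_pV2 ?posrE ?my ?ms//; lra.
  have : c 0 / s0 < c 0 / y by rewrite ltr_pM2l// ltf_pV2 ?posrE.
  lra.
have Sn n : \sum_(1 <= m < n) u m <= S.
  by rewrite -(cvg_lim _ SE)//; apply: nondecreasing_cvgn_le; [exact: partial_sum_nd|exact: cvgP SE].
have : c 0 / s0 <= S.
  (* The telescoped partial sums fall short of c 0 / s0 by c n / s0, which can be made arbitrarily
     small. *)
  apply/ler_addgt0Pl => e e0; have [n hn] := gcoef_small s01 (mulr_gt0 e0 s00).
  have : (c 0 - c n) / s0 <= S.
    rewrite -(gcoef_telescope s01); apply: le_trans (Sn n.+1).
    rewrite big_nat_cond [leRHS]big_nat_cond; apply: ler_sum => m /andP[/andP[m0 _] _].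
    by rewrite ler_wpM2l ?gcoef_ge0// lef_pV2 ?posrE ?my ?ms//; lra.
  have : c n / s0 <= e by rewrite ler_pdivrMr// ltW.
  rewrite mulrBl; lra.
have : c 0 / y < c 0 / s0 by rewrite ltr_pM2l// ltf_pV2 ?posrE//.
lra.
Qed.

Lemma tau2_sq_gt0 : 0 < tau2_sq s0.
Proof.
have s01' := s01; have /andP[s00 s0lt] := s01.
have : 0 <= tau2_sq s0 - c 0 / s0 ^+ 2.
  apply: (cvgr_to_ge (tau2_sq_cvg s01)); apply: nearW => n.
  by apply: sumr_ge0 => m _; rewrite divr_ge0 ?gcoef_ge0 ?sqr_ge0.
have : 0 < c 0 / s0 ^+ 2 by rewrite divr_gt0 ?gcoef_gt0 ?exprn_gt0.
lra.
Qed.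

End SeriesSigns.

Section Sampling.
Variables (R : realType) (d d' : measure_display) (Omega : measurableType d) (T : measurableType d').
Variables (P : probability Omega R) (P0 : probability T R) (X : nat -> {RV P >-> T}).
Hypothesis iidX : iid_from X P0.
Variable A : nat -> set T.
Hypothesis mA : forall k, measurable (A k).
Hypothesis A_disj : forall i j x, A i x -> A j x -> i = j.
Hypothesis A_sub : forall k x y, A k x -> A k y -> x = y.
Let p k := fine (P0 (A k)).
Variable J : nat -> nat.
(** The inverse square makes the union bound over n draws vanish, and it puts the omitted cells
    below every level s / n in [mean_tail_cvg]. *)
Hypothesis J_mass : forall n, 1 - \sum_(k < J n) p k <= (n.+1%:R ^+ 2)^-1.
Hypothesis J_small : forall n k, (J n <= k)%N -> p k < (n.+1%:R ^+ 2)^-1.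
Variables (s0 : R) (a : R -> R).
Hypothesis s01 : 0 < s0 < 1.
Hypothesis a_ge0 : forall t, 0 <= a t.
Hypothesis a_mono : forall x y, x <= y -> a x <= a y.
Hypothesis a_rv : forall u, 0 < u -> a (t * u) / a t @[t --> +oo%R] --> u `^ s0.
Hypothesis count_le : forall (x : R) (J : nat), 0 < x -> \sum_(k < J) (x <= p k)%R%:R <= a x^-1.
Hypothesis count_eq : forall (x : R) (J : nat), 0 < x ->
  (forall k, (J <= k)%N -> p k < x) -> \sum_(k < J) (x <= p k)%R%:R = a x^-1.

Let p01 k : 0 <= p k <= 1.
Proof. by rewrite fine_prob_ge0 fine_prob_le1. Qed.

Definition sample n w : seq T := mkseq (fun i => X i w) n.

(** The measurable counterpart of [num_ge]: only the first [J n] cells are counted. Both agree with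
    high probability. *)
Let Zt n m w : R := \sum_(k < J n) \1_[set w | (m <= hits X (A k) n w)%N] w.

Lemma union_bound (F : nat -> set Omega) n : (forall i, measurable (F i)) ->
  fine (P (\big[setU/set0]_(i < n) F i)) <= \sum_(i < n) fine (P (F i)).
Proof.
move=> mF; elim: n => [|n IH]; first by rewrite !big_ord0 measure0.
have mU : measurable (\big[setU/set0]_(i < n) F i) by exact: bigsetU_measurable.
rewrite !big_ord_recr /=; apply: le_trans (lerD IH (lexx _)).
rewrite -lee_fin EFinD !fineK ?fin_num_measure//; last exact: measurableU.
exact: measureU2.
Qed.

Let cover n := \big[setU/set0]_(k < J n) A k.

Let mcover n : measurable (cover n).
Proof. exact: bigsetU_measurable. Qed.

Let cover_mass n : fine (P0 (~` cover n)) <= (n.+1%:R ^+ 2)^-1.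
Proof.
rewrite fine_probC// /cover measure_bigsetU//.
  by rewrite -sum_fine// => i _; exact: fin_num_measure.
move=> i j _ _ [x [Ai Aj]]; exact: A_disj Ai Aj.
Qed.

Lemma sample_in_cells : whp P (fun n w => forall i, (i < n)%N -> exists2 k, (k < J n)%N & A k (X i w)).
Proof.
move=> e e0; have [N eN] := nat_ub e^-1; exists N => n Nn.
have mB i : measurable (X i @^-1` (~` cover n)) by apply: measurable_RV_preimage; exact: measurableC.
exists (\big[setU/set0]_(i < n) (X i @^-1` (~` cover n))); first exact: bigsetU_measurable.
split=> [w nB i i_n|].
  have : ~ (X i @^-1` (~` cover n)) w.
    by move=> h; apply: nB; rewrite (bigD1 (Ordinal i_n))//=; left.
  rewrite /preimage /= => /contrapT; rewrite /cover -bigcup_mkord => -[k /= kJ Ak].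
  by exists k.
apply: le_trans (union_bound n mB) _.
apply: (@le_trans _ _ (\sum_(i < n) (n.+1%:R ^+ 2)^-1)).
  apply: ler_sum => i _; have [_ iid2] := iidX.
  by have -> : P (X i @^-1` (~` cover n)) = P0 (~` cover n) by rewrite -(iid2 i)//; exact: measurableC.
rewrite sumr_const card_ord -[leLHS]mulr_natl.
have n1 : 0 < n.+1%:R :> R by rewrite ltr0n.
have h : e^-1 <= n.+1%:R by apply: le_trans eN _; rewrite ler_nat ltnW.
have nn : n%:R <= n.+1%:R :> R by rewrite ler_nat.
rewrite ler_pdivrMr ?exprn_gt0//; apply: le_trans nn _.
rewrite expr2 mulrA ler_peMl ?(ltW n1)//.
by rewrite -ler_pdivrMl// mulr1.
Qed.

Lemma num_ge_hits : whp P (fun n w => forall m, (0 < m)%N -> (num_ge (sample n w) m)%:R = Zt n m w).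
Proof.
apply: (whp_mono sample_in_cells); exists 0%N => n w _ cov m m0.
rewrite (num_ge_cells A_disj A_sub (J := J n))//; last first.
  by move=> x /mapP[i]; rewrite mem_iota add0n => /cov[k kJ Ak] ->; exists k.
rewrite natr_sum; apply: eq_bigr => k _; rewrite indicE; congr (_%:R).
have -> : count (fun x => x \in A k) (sample n w) = hits X (A k) n w.
  by rewrite /sample /mkseq count_map -sum1_count big_mkcond /= -[n in iota _ n]subn0 -/(index_iota 0 n) big_mkord.
by congr nat_of_bool; apply/idP/idP => [h|]; [rewrite inE|rewrite inE].
Qed.

Let Zt_mean n m : has_mean P (Zt n m) (mean_tail p n m (J n)).
Proof.
rewrite /Zt /mean_tail.
have -> : \sum_(k < J n) (bin_tail R n m).[p k] =
    \sum_(k < J n) fine (P [set w | (m <= hits X (A k) n w)%N]).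
  by apply: eq_bigr => k _; rewrite (prob_hits iidX).
by apply: has_mean_sum => k; apply: has_mean_indic; exact: (measurable_hits iidX _ _ (mA k)).
Qed.

Let a_cvgy : a t @[t --> +oo%R] --> +oo%R.
Proof. by have /andP[s00 _] := s01; exact: rv_cvgy s00 a_ge0 a_mono a_rv. Qed.

Lemma a_large (K : R) : exists N, forall n, (N <= n)%N -> K <= a n%:R.
Proof.
have [M [_ hM]] := (cvgryPge _).1 a_cvgy K.
have [N hN] := nat_ub M; exists N.+1 => n Nn; apply: hM.
by apply: le_lt_trans hN _; rewrite ltr_nat.
Qed.

(** Variance and mean are of order a n, while the deviation allowed is e * a n; Chebyshev's bound is
    of order 1 / a n. *)
Let lln m e : 0 < e -> whp P (fun n w => `|Zt n m.+1 w / a n%:R - gcoef s0 m| <= e).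
Proof.
move=> e0 e' e'0.
have e2 : 0 < e / 2 by rewrite divr_gt0.
have lim := mean_tail_cvg s01 a_ge0 a_mono a_rv p01 count_le count_eq (m := m) J_small.
have [N1 _ hN1] := (cvgrPdist_le _ _).1 lim _ e2.
set c := gcoef s0 m in lim hN1 *.
have c0 : 0 <= c by apply: gcoef_ge0.
(* The size of a n at which Chebyshev's bound falls below [e']; the added 1 keeps a n positive. *)
have [N2 hN2] := a_large (((c + e / 2) / ((e / 2) ^+ 2 * e')) + 1).
exists (maxn N1 N2) => n; rewrite geq_max => /andP[n1 n2].
have := hN1 n n1; have := hN2 n n2; set an := a n%:R => an1.
have q0 : 0 <= (c + e / 2) / ((e / 2) ^+ 2 * e').
  by apply: divr_ge0; [apply: addr_ge0 => //; exact: ltW|apply: mulr_ge0; [exact: sqr_ge0|exact: ltW]].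
have an0 : 0 < an by lra.
move=> /= close.
pose F k := [set w | (m.+1 <= hits X (A k) n w)%N].
have mF k : measurable (F k) by exact: (measurable_hits iidX _ _ (mA k)).
have mean : \sum_(k < J n) fine (P (F k)) = mean_tail p n m.+1 (J n).
  by apply: eq_bigr => k _; rewrite (prob_hits iidX).
set E := mean_tail p n m.+1 (J n) in close mean.
have mZ : measurable_fun setT (Zt n m.+1).
  by apply: measurable_sum => k; apply: measurable_indic; exact: mF.
pose B := [set w | e / 2 * an <= `|Zt n m.+1 w - E|].
have mB : measurable B.
  rewrite -[B]setTI; apply: measurable_fun_le => //.
  by apply: (measurableT_comp (@normr_measurable _ _)); apply: measurable_funB.
exists B => //; split=> [w nB|].
  have h : `|Zt n m.+1 w - E| < e / 2 * an by rewrite ltNge; apply/negP.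
  rewrite (_ : _ - c = (Zt n m.+1 w - E) / an - (c - E / an)); last by field; rewrite gt_eqF.
  apply: le_trans (ler_normB _ _) _; rewrite [leRHS](splitr e); apply: lerD => //.
  by rewrite normrM normfV (gtr0_norm an0) ler_pdivrMr// ltW.
have t0 : 0 < e / 2 * an by rewrite mulr_gt0.
apply: le_trans (chebyshev_neg_corr (J := J n) mB mF t0 _ _) _.
- move=> i j _ _ ij; apply: (neg_corr_hits iidX) => //.
  by apply/seteqP; split=> x // -[Ai Aj]; move/eqP: ij; apply; exact: A_disj Ai Aj.
- by move=> w; rewrite /B /= mean.
rewrite mean.
have EE : E <= (c + e / 2) * an.
  by rewrite -ler_pdivrMr//; move: close; rewrite ler_distlC => /andP[]; lra.
rewrite ler_pdivrMr ?exprn_gt0//; apply: le_trans EE _.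
have h : (c + e / 2) / ((e / 2) ^+ 2 * e') <= an by lra.
rewrite (_ : e' * _ = an * ((e / 2) ^+ 2 * e') * an); last by ring.
by rewrite ler_wpM2r ?(ltW an0)// -ler_pdivrMr// mulr_gt0 ?exprn_gt0.
Qed.

(** Markov's inequality for the whole weighted tail. The cut [A0] depends on the probability [e], so
    the conclusion is [bad_le] at that [e] and not [whp]. *)
Let tail dl e : 0 < dl -> 0 < e -> exists A0, forall B, (A0 <= B)%N ->
  bad_le P (fun n w => \sum_(B <= m < n) m%:R^-1 * Zt n m.+1 w <= dl * a n%:R) e.
Proof.
move=> dl0 e0.
have [K K0 [t0 t01 hK]] := tail_sum_le s01 a_ge0 a_mono a_rv p01 count_le.
have /andP[s00 _] := s01.
have sh : 0 < s0 / 2 by rewrite divr_gt0.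
have [N1 hN1] := nat_ub t0.
have [N2 hN2] := a_large 1.
have [A0 hA0] : exists A0, forall B, (A0 <= B)%N -> (0 < B)%N /\ K / B%:R `^ (s0 / 2) <= dl * e.
  have [A0 hA0] := nat_ub ((K / (dl * e)) `^ (s0 / 2)^-1).
  exists A0.+1 => B AB; split; first exact: leq_ltn_trans AB.
  have B0 : 0 < B%:R :> R by rewrite ltr0n; exact: leq_ltn_trans AB.
  rewrite ler_pdivrMr ?powR_gt0// mulrC -ler_pdivrMr ?mulr_gt0//.
  have -> : K / (dl * e) = ((K / (dl * e)) `^ (s0 / 2)^-1) `^ (s0 / 2).
    by rewrite -powRrM mulVf ?gt_eqF// powRr1// divr_ge0 ?mulr_ge0 ?(ltW K0) ?(ltW dl0) ?(ltW e0).
  apply: le_powR; rewrite ?powR_ge0 ?(ltW sh)//.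
  by apply: le_trans hA0 _; rewrite ler_nat ltnW.
exists A0 => B AB; have [B0 hB] := hA0 B AB.
exists (maxn N1 N2) => n; rewrite geq_max => /andP[n1 n2].
have an1 := hN2 n n2; have an0 : 0 < a n%:R by lra.
have tn : t0 <= n%:R by apply: le_trans hN1 _; rewrite ler_nat.
pose f w := \sum_(B <= m < n) m%:R^-1 * Zt n m.+1 w.
have mf : measurable_fun setT f.
  apply: measurable_sum => m; apply: measurable_funM => //.
  by apply: measurable_sum => k; apply: measurable_indic; exact: (measurable_hits iidX _ _ (mA k)).
have f0 w : 0 <= f w.
  by apply: sumr_ge0 => m _; rewrite mulr_ge0 ?invr_ge0//; apply: sumr_ge0 => k _; rewrite indicE.
pose D := [set w | dl * a n%:R <= f w].
have mD : measurable D by rewrite -[D]setTI; apply: measurable_fun_le.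
exists D => //; split=> [w nD|]; first by rewrite leNgt; apply/negP => /ltW; exact: nD.
have hm : has_mean P f (\sum_(B <= m < n) m%:R^-1 * mean_tail p n m.+1 (J n)).
  by apply: has_mean_sum => m; apply: has_meanZ.
have da : 0 < dl * a n%:R by rewrite mulr_gt0.
apply: le_trans (markov_has_mean mD hm f0 da _) _ => //.
rewrite ler_pdivrMr//; apply: le_trans (hK _ _ _ B0 tn) _.
by rewrite mulrCA mulrA ler_wpM2r.
Qed.

Let distinct n w : R := (num_distinct (sample n w))%:R.

Lemma num_distinct_lln e : 0 < e -> whp P (fun n w => `|distinct n w / a n%:R - gcoef s0 0| <= e).
Proof.
move=> e0; apply: (whp_mono (whp_and num_ge_hits (lln 0 e0))).
exists 0%N => n w _ [h]; rewrite -h// /distinct; congr (`|_ / _ - _| <= _).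
congr (_%:R); rewrite /num_ge /num_distinct -sum1_size big_seq [RHS]big_seq.
by apply: eq_bigr => x; rewrite mem_undup -has_pred1 has_count => ->.
Qed.

Lemma distinct_sum_lln (k : nat -> R) l :
  (forall e, 0 < e -> exists C : R, forall K : nat, `|\sum_(1 <= i < K) k i - K%:R * l| <= e * K%:R + C) ->
  forall e, 0 < e -> whp P (fun n w =>
    `|(\sum_(1 <= i < num_distinct (sample n w)) k i) / a n%:R - gcoef s0 0 * l| <= e).
Proof.
move=> kl e e0; set c := gcoef s0 0; have c0 : 0 <= c by apply: gcoef_ge0.
have c1 : 0 < c + 1 by rewrite ltr_wpDl.
have l1 : 0 < `|l| + 1 by rewrite ltr_wpDl.
have e3 : 0 < e / 3 by rewrite divr_gt0.
have [C hC] := kl (e / 3 / (c + 1)) (divr_gt0 e3 c1).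
have [N1 hN1] := a_large (`|C| / (e / 3) + 1).
(* Tolerance 1 bounds the number of terms by (c + 1) a n, for the error per term; the finer
   tolerance serves the main term. *)
apply: (whp_mono (whp_and (num_distinct_lln ltr01) (num_distinct_lln (divr_gt0 e3 l1)))).
exists N1 => n w Nn [h1 h2]; have an1 := hN1 n Nn.
have C0 : 0 <= `|C| / (e / 3) by rewrite divr_ge0 ?(ltW e3).
set an := a n%:R in an1 h1 h2 *; have an0 : 0 < an by lra.
set K := num_distinct (sample n w) in h1 h2 *; rewrite -/c /distinct -/K in h1 h2.
have -> : (\sum_(1 <= i < K) k i) / an - c * l =
    (\sum_(1 <= i < K) k i - K%:R * l) / an + l * (K%:R / an - c) by field; rewrite gt_eqF.
apply: le_trans (ler_normD _ _) _.
have p1 : `|(\sum_(1 <= i < K) k i - K%:R * l) / an| <= e / 3 + e / 3.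
  rewrite normrM normfV (gtr0_norm an0) ler_pdivrMr//; apply: le_trans (hC K) _.
  rewrite mulrDl; apply: lerD.
    rewrite -mulrA ler_wpM2l ?(ltW e3)// mulrC ler_pdivrMr// mulrC -ler_pdivrMr//.
    by move: h1; rewrite ler_distl => /andP[].
  apply: le_trans (ler_norm _) _; rewrite mulrC -ler_pdivrMr//; lra.
have p2 : `|l * (K%:R / an - c)| <= e / 3.
  rewrite normrM; apply: (@le_trans _ _ ((`|l| + 1) * (e / 3 / (`|l| + 1)))).
    by apply: ler_pM => //; rewrite lerDl.
  by rewrite mulrCA mulfV ?mulr1// gt_eqF.
lra.
Qed.

(** Levels below a fixed cut [B] obey finitely many laws of large numbers; the levels from [B] on
    are controlled by [tail] since the weights are of order 1 / m. *)
Lemma weighted_lln (h : nat -> R) D S : 0 < D ->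
  (forall m, (0 < m)%N -> 0 <= h m <= D / m%:R) ->
  \sum_(1 <= m < n) gcoef s0 m * h m @[n --> \oo] --> S ->
  forall e, 0 < e -> whp P (fun n w =>
    `|(\sum_(1 <= m < n) (num_ge (sample n w) m.+1)%:R * h m) / a n%:R - S| <= e).
Proof.
move=> D0 hD lim e e0 e' e'0.
have e4 : 0 < e / 4 by rewrite divr_gt0.
have e'2 : 0 < e' / 2 by rewrite divr_gt0.
have [A0 hA0] := tail (divr_gt0 e4 D0) e'2.
have [N0 _ hN0] := (cvgrPdist_le _ _).1 lim _ e4.
(* Past the cut of [tail] and past the index where the limiting series is within e / 4 of [S]. The
   successor makes B positive, so that the tolerance e / 4 / (B * D) used for each level makes
   sense. *)
pose B := (maxn A0 N0).+1.
have AB : (A0 <= B)%N by rewrite leqW// leq_maxl.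
have NB : (N0 <= B)%N by rewrite leqW// leq_maxr.
have BD : 0 < B%:R * D by rewrite mulr_gt0 ?ltr0n.
have [N1 hN1] := a_large 1.
have close := hN0 B NB; rewrite /= in close.
have W := whp_and num_ge_hits (whp_all B (fun m => lln m (divr_gt0 e4 BD))).
rewrite (splitr e'); apply: (bad_le_mono (bad_le_and (hA0 B AB) (W _ e'2))).
exists (maxn N1 B) => n w; rewrite geq_max => /andP[n1 nB] [ht [hZ hl]].
have an1 := hN1 n n1; set an := a n%:R in ht hl an1 *; have an0 : 0 < an by lra.
rewrite (eq_big_nat _ _ (F2 := fun m => Zt n m.+1 w * h m)); last first.
  by move=> m _; rewrite hZ.
rewrite (big_cat_nat (n := B))//= mulrDl.
set S1 := (\sum_(1 <= m < B) _) / an; set S2 := (\sum_(B <= m < n) _) / an.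
set S0 := \sum_(1 <= m < B) _ in close.
have Z0 m : 0 <= Zt n m w by apply: sumr_ge0 => k _; rewrite indicE.
have b2 : 0 <= S2 <= e / 4.
  apply/andP; split.
    rewrite /S2 divr_ge0 ?(ltW an0)// big_nat_cond sumr_ge0// => m /andP[/andP[Bm _] _].
    by rewrite mulr_ge0//; have /andP[] := hD m (leq_trans (ltn0Sn _) Bm).
  rewrite /S2 ler_pdivrMr//; apply: (@le_trans _ _ (D * \sum_(B <= m < n) m%:R^-1 * Zt n m.+1 w)).
    rewrite mulr_sumr big_nat_cond [leRHS]big_nat_cond; apply: ler_sum => m /andP[/andP[Bm _] _].
    by rewrite mulrA [leRHS]mulrC ler_wpM2l//; have /andP[] := hD m (leq_trans (ltn0Sn _) Bm).
  by rewrite -ler_pdivlMl//; apply: le_trans ht _; rewrite mulrA mulrC [D^-1 * _]mulrC mulrC.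
have b1 : `|S1 - S0| <= e / 4.
  rewrite /S1 /S0 mulr_suml -sumrB; apply: le_trans (ler_norm_sum _ _ _) _.
  apply: (@le_trans _ _ (\sum_(1 <= m < B) e / 4 / (B%:R * D) * D)).
    rewrite big_nat_cond [leRHS]big_nat_cond; apply: ler_sum => m /andP[/andP[m1 mB] _].
    have /andP[h0 h1] := hD m m1.
    have -> : Zt n m.+1 w * h m / an - gcoef s0 m * h m = (Zt n m.+1 w / an - gcoef s0 m) * h m by ring.
    rewrite normrM (ger0_norm h0); apply: ler_pM => //; first exact: hl.
    by apply: le_trans h1 _; rewrite ler_pdivrMr ?ltr0n// ler_peMr ?ler1n// ltW.
  rewrite sumr_const_nat -[leLHS]mulr_natl.
  apply: (@le_trans _ _ (B%:R * (e / 4 / (B%:R * D) * D))).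
    by rewrite ler_wpM2r ?ler_nat ?leq_subr// mulr_ge0 ?(ltW D0)// divr_ge0 ?(ltW BD)// ltW.
  by rewrite le_eqVlt; apply/orP; left; apply/eqP; field; rewrite !gt_eqF ?ltr0n.
move: close b1; rewrite distrC !ler_norml => /andP[c1 c2] /andP[d1 d2]; have /andP[f1 f2] := b2.
lra.
Qed.

Variable M : R.
Hypothesis M0 : 0 <= M.
Let factors n w := lik_factors M (sample n w).

Lemma log_deriv_lln y S : 0 < y < 1 ->
  \sum_(1 <= m < n) gcoef s0 m * (m%:R - y)^-1 @[n --> \oo] --> S ->
  forall e, 0 < e -> whp P (fun n w =>
    `|log_deriv (factors n w) y / a n%:R - (gcoef s0 0 * y^-1 - S)| <= e).
Proof.
move=> y01 lim e e0; have /andP[y0 y1] := y01.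
have e2 : 0 < e / 2 by rewrite divr_gt0.
have y1' : 0 < 1 - y by rewrite subr_gt0.
have h1 : whp P (fun n w =>
    `|(\sum_(1 <= i < num_distinct (sample n w)) i%:R / (M + i%:R * y)) / a n%:R - gcoef s0 0 * y^-1| <= e / 2).
  apply: distinct_sum_lln => // t t0; have [C hC] := linear_factor_sums M0 y01 t0.
  by exists C => K; have [] := hC K.
have hD m : (0 < m)%N -> 0 <= (m%:R - y)^-1 <= (1 - y)^-1 / m%:R.
  move=> m0; have h := nat_sub_ge m0 (ltW y0).
  have q : 0 < (1 - y) * m%:R by rewrite mulr_gt0 ?ltr0n.
  have q' := lt_le_trans q h.
  by rewrite -invfM lef_pV2 ?posrE// h andbT invr_ge0 ltW.
have iy : 0 < (1 - y)^-1 by rewrite invr_gt0.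
apply: (whp_mono (whp_and h1 (weighted_lln iy hD lim e2))); exists 0%N => n w _ [].
rewrite /factors log_deriv_lik size_mkseq mulrBl.
set u := _ / a n%:R; set v := _ / a n%:R => hu hv.
rewrite (_ : _ - _ = (u - gcoef s0 0 * y^-1) - (v - S)); last by ring.
by apply: le_trans (ler_normB _ _) _; rewrite [leRHS]splitr lerD.
Qed.

Lemma log_curv_lln e : 0 < e ->
  whp P (fun n w => `|log_curv (factors n w) s0 / a n%:R - tau2_sq s0| <= e).
Proof.
move=> e0; have /andP[y0 y1] := s01.
have e2 : 0 < e / 2 by rewrite divr_gt0.
have y1' : 0 < 1 - s0 by rewrite subr_gt0.
have h1 : whp P (fun n w =>
    `|(\sum_(1 <= i < num_distinct (sample n w)) (i%:R / (M + i%:R * s0)) ^+ 2) / a n%:R - gcoef s0 0 * s0^-1 ^+ 2| <= e / 2).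
  apply: distinct_sum_lln => // t t0; have [C hC] := linear_factor_sums M0 s01 t0.
  by exists C => K; have [] := hC K.
have hD m : (0 < m)%N -> 0 <= ((m%:R - s0) ^+ 2)^-1 <= ((1 - s0) ^+ 2)^-1 / m%:R.
  move=> m0; have h := nat_sub_ge m0 (ltW y0).
  have q : 0 < (1 - s0) * m%:R by rewrite mulr_gt0 ?ltr0n.
  have q' := lt_le_trans q h.
  rewrite invr_ge0 sqr_ge0/= -invfM lef_pV2 ?posrE ?exprn_gt0// ?mulr_gt0 ?exprn_gt0 ?ltr0n//.
  apply: (@le_trans _ _ (((1 - s0) * m%:R) ^+ 2)); last first.
    by apply: lerXn2r => //; rewrite nnegrE ltW.
  by rewrite exprMn ler_wpM2l ?sqr_ge0// -[leLHS]expr1 ler_weXn2l// ler1n.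
have iy : 0 < ((1 - s0) ^+ 2)^-1 by rewrite invr_gt0 exprn_gt0.
apply: (whp_mono (whp_and h1 (weighted_lln iy hD (tau2_sq_cvg s01) e2))); exists 0%N => n w _ [].
rewrite /factors log_curv_lik size_mkseq mulrDl.
set u := _ / a n%:R; set v := _ / a n%:R => hu hv.
rewrite (_ : _ - _ = (u - gcoef s0 0 * s0^-1 ^+ 2) + (v - (tau2_sq s0 - gcoef s0 0 / s0 ^+ 2))); last first.
  by rewrite exprVn; ring.
by apply: le_trans (ler_normD _ _) _; rewrite [leRHS]splitr lerD.
Qed.

Lemma likelihood_regular dl r : 0 < dl -> 0 < r -> 0 < s0 - r -> s0 + r < 1 ->
  whp P (fun n w => [/\
    `|log_curv (factors n w) s0 - a n%:R * tau2_sq s0| <= dl * (a n%:R * tau2_sq s0),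
    0 < log_deriv (factors n w) (s0 - r) & log_deriv (factors n w) (s0 + r) < 0]).
Proof.
move=> dl0 r0 sr sr1; have t0 := tau2_sq_gt0 s01; have /andP[s00 s0lt] := s01.
have y1 : 0 < s0 - r < 1 by lra.
have y2 : 0 < s0 + r < 1 by lra.
have [S1 [l1 g1 _]] := score_limit s01 y1; have [S2 [l2 _ g2]] := score_limit s01 y2.
have {}g1 : 0 < gcoef s0 0 * (s0 - r)^-1 - S1 by apply: g1; lra.
have {}g2 : gcoef s0 0 * (s0 + r)^-1 - S2 < 0 by apply: g2; lra.
set G1 := _ - S1 in g1; set G2 := _ - S2 in g2.
(* A tolerance of half the limit preserves the sign of the score. *)
have g1' : 0 < G1 / 2 by lra.
have g2' : 0 < - G2 / 2 by lra.
have [N hN] := a_large 1.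
apply: (whp_mono (whp_and (log_curv_lln (mulr_gt0 dl0 t0))
  (whp_and (log_deriv_lln y1 l1 g1') (log_deriv_lln y2 l2 g2')))).
exists N => n w Nn [h1 [h2 h3]]; have an1 := hN n Nn.
set an := a n%:R in h1 h2 h3 an1 *; have an0 : 0 < an by lra.
split.
- have -> : log_curv (factors n w) s0 - an * tau2_sq s0 =
      an * (log_curv (factors n w) s0 / an - tau2_sq s0) by field; rewrite gt_eqF.
  by rewrite normrM (gtr0_norm an0) mulrCA ler_pM2l.
- have : 0 < log_deriv (factors n w) (s0 - r) / an.
    by move: h2; rewrite -/G1 ler_distl => /andP[]; lra.
  by rewrite pmulr_lgt0 ?invr_gt0.
- have : log_deriv (factors n w) (s0 + r) / an < 0.
    by move: h3; rewrite -/G2 ler_distl => /andP[]; lra.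
  by rewrite pmulr_llt0 ?invr_gt0.
Qed.

End Sampling.

Lemma le_sum_ord (R : realType) (u : nat -> R) J k : (forall i, 0 <= u i) -> (J <= k)%N ->
  \sum_(i < J) u i <= \sum_(i < k) u i.
Proof. by move=> u0 Jk; rewrite -(subnKC Jk) big_split_ord /= lerDl sumr_ge0. Qed.

(** * Atoms of a discrete distribution *)

Section Atoms.
Variables (R : realType) (d : measure_display) (T : measurableType d) (P0 : probability T R).
Variables (D : set T) (f : T -> nat).
Hypothesis m1 : forall x : T, measurable [set x].
Hypothesis PD : P0 D = 1%E.
Hypothesis f_inj : {in D &, injective f}.

(** The countable set [D] is indexed by the injection [f]. A cell is a singleton, possibly of mass
    0, or empty when k is not a value of [f] on [D]. *)
Definition atom k : set T := [set x | D x /\ f x = k].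
Local Notation p k := (fine (P0 (atom k))).
Let E (u : R) := [set x : T | 0 < fine (P0 [set x]) /\ 1 / fine (P0 [set x]) <= u].

Lemma atom_disj i j x : atom i x -> atom j x -> i = j.
Proof. by move=> [_ <-] [_ <-]. Qed.

Lemma atom_sub k x y : atom k x -> atom k y -> x = y.
Proof. by move=> [Dx fx] [Dy fy]; apply: f_inj; rewrite ?inE// fx fy. Qed.

Lemma atom_point k x : atom k x -> atom k = [set x].
Proof. by move=> Ax; apply/seteqP; split=> [y Ay|y ->//]; exact: atom_sub Ay Ax. Qed.

Lemma measurable_atom k : measurable (atom k).
Proof.
have [[x Ax]|nA] := pselect (exists x, atom k x); first by rewrite (atom_point Ax).
suff -> : atom k = set0 by [].
by apply/seteqP; split=> x // Ax; apply: nA; exists x.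
Qed.

Let D_atoms : D = \bigcup_k atom k.
Proof. by apply/seteqP; split=> [x Dx|x [k _ []//]]; exists (f x). Qed.

Let mD : measurable D.
Proof. by rewrite D_atoms; apply: bigcup_measurable => k _; exact: measurable_atom. Qed.

Let triv : trivIset setT atom.
Proof. by move=> i j _ _ [x [Ai Aj]]; exact: atom_disj Ai Aj. Qed.

Let psum n : \sum_(k < n) p k = fine (P0 (\big[setU/set0]_(k < n) atom k)).
Proof.
rewrite measure_bigsetU//; last exact: measurable_atom.
by rewrite -sum_fine// => i _; rewrite fin_num_measure//; exact: measurable_atom.
Qed.

Let psum_le1 n : \sum_(k < n) p k <= 1.
Proof. by rewrite psum fine_prob_le1//; apply: bigsetU_measurable => k _; exact: measurable_atom. Qed.

Let psum_cvg : \sum_(k < n) p k @[n --> \oo] --> (1 : R).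
Proof.
have h := measure_sigma_additive (mu := P0) measurable_atom triv.
have {}h : (\sum_(0 <= i < n) P0 (atom i))%E @[n --> \oo] --> (1 : R)%:E.
  by rewrite -PD D_atoms; exact: h.
have [_] := (fine_cvgP _ _).1 h; apply: cvg_trans; apply: near_eq_cvg; apply: nearW => n /=.
by rewrite big_mkord -sum_fine// => i _; rewrite fin_num_measure//; exact: measurable_atom.
Qed.

(** A single index serves both claims: the mass of a later cell is part of the mass missed by the
    first [J]. *)
Lemma atoms_exhaust (e : R) : 0 < e -> exists J, 1 - \sum_(k < J) p k < e /\
  forall k, (J <= k)%N -> p k < e.
Proof.
move=> e0; have [J _ hJ] := (cvgrPdist_lt _ _).1 psum_cvg _ e0.
have le : 1 - \sum_(k < J) p k < e by have := hJ J (leqnn J); apply: le_lt_trans; exact: ler_norm.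
exists J; split=> // k Jk; apply: le_lt_trans le.
have := psum_le1 k.+1; rewrite big_ord_recr /= => h.
have := le_sum_ord (fun i => fine_prob_ge0 P0 (atom i)) Jk.
lra.
Qed.

Let atom_mass k x : atom k x -> p k = fine (P0 [set x]).
Proof. by move=> /atom_point ->. Qed.

Let E_D u x : E u x -> D x.
Proof.
move=> [p0 _]; apply: contrapT => nD; move: p0; apply/negP; rewrite -leNgt.
have <- : fine (P0 (~` D)) = 0 by rewrite fine_probC// PD subrr.
by apply: le_fine_prob => //; [exact: measurableC|move=> y ->].
Qed.

(** A point counted by [alpha0] has positive mass, hence lies in [D] and in one of the first [J]
    cells. Finiteness comes along because [fset_set] is meaningful only on finite sets. *)
Lemma alpha0_count (x : R) (J : nat) : 0 < x -> (forall k, (J <= k)%N -> p k < x) ->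
  finite_set (E x^-1) /\ \sum_(k < J) (x <= p k)%R%:R = alpha0 P0 x^-1.
Proof.
move=> x0 Jx; pose F k := atom k `&` E x^-1.
have Efin k y : atom k y -> E x^-1 y <-> x <= p k.
  move=> Ay; rewrite (atom_mass Ay) /E /= div1r; split=> [[p0]|xp]; first by rewrite lef_pV2.
  by have p0 := lt_le_trans x0 xp; split=> //; rewrite lef_pV2.
have FE k : #|` fset_set (F k)| = (x <= p k)%R :> nat.
  case: (boolP (x <= p k)) => xp; last first.
    suff -> : F k = set0 by rewrite fset_set0 cardfs0.
    by apply/seteqP; split=> y // -[Ay] /(Efin _ _ Ay); move/negP: xp.
  have [y Ay] : exists y, atom k y.
    apply: contrapT => h; have k0 : atom k = set0 by apply/seteqP; split=> y // Ay; apply: h; exists y.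
    by move: xp; rewrite k0 measure0 leNgt x0.
  suff -> : F k = [set y] by rewrite fset_set1 cardfs1.
  rewrite /F (atom_point Ay); apply/seteqP; split=> [z []//|z ->]; split=> //.
  exact/(Efin _ _ Ay).
have Ff k : finite_set (F k).
  have [[y Ay]|nA] := pselect (exists y, atom k y).
    by apply: sub_finite_set (finite_set1 y) => z []; rewrite (atom_point Ay).
  by apply: sub_finite_set (finite_set0 T) => z [Az]; case: nA; exists z.
have EU : E x^-1 = \big[setU/set0]_(k < J) F k.
  rewrite -bigcup_mkord; apply/seteqP; split=> [y Ey|y [k _ []]//].
  have Ay : atom (f y) y by split=> //; exact: E_D Ey.
  exists (f y) => //=; rewrite ltnNge; apply/negP => /Jx; rewrite ltNge => /negP; apply.
  exact/(Efin _ _ Ay).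
split; first by rewrite EU -bigcup_mkord; apply: bigcup_finite.
rewrite /alpha0 -/(E x^-1) EU -(@trivIset_sum_card _ F)//.
  by rewrite natr_sum; apply: eq_bigr => k _; rewrite FE.
by move=> i j _ _ [y [[Ai _] [Aj _]]]; exact: atom_disj Ai Aj.
Qed.

Lemma alpha0_mono (u v : R) : u <= v -> alpha0 P0 u <= alpha0 P0 v.
Proof.
move=> uv; have fE w : finite_set (E w).
  have [w0|w0] := ltP 0 w.
    have w0' : 0 < w^-1 by rewrite invr_gt0.
    have [J [_ hJ]] := atoms_exhaust w0'.
    by have [+ _] := alpha0_count w0' hJ; rewrite invrK.
  apply: sub_finite_set (finite_set0 T) => y [y0].
  by rewrite leNgt (le_lt_trans w0)// divr_gt0.
rewrite /alpha0 ler_nat; apply: fsubset_leq_card; rewrite -fset_set_sub; [|exact: fE|exact: fE].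
by move=> y [y0 yu]; split=> //; exact: le_trans uv.
Qed.

Lemma alpha0_count_le (x : R) (J : nat) : 0 < x -> \sum_(k < J) (x <= p k)%R%:R <= alpha0 P0 x^-1.
Proof.
move=> x0; have [J1 [_ h1]] := atoms_exhaust x0.
have [|_ <-] := @alpha0_count x (maxn J J1) x0.
  by move=> k; rewrite geq_max => /andP[_]; exact: h1.
by apply: (@le_sum_ord _ (fun k => (x <= p k)%R%:R)) => //; exact: leq_maxl.
Qed.

End Atoms.

(** * Choice of the constants and conclusion *)

(** The order of the quantifiers is the point: [omega] fixes the neighbourhood on which the prior
    density is nearly constant, this limits [d] and [r], and only then is [s] taken small. *)
Lemma posterior_error_small (R : realType) (b g0 e : R) : 0 <= b -> 0 < g0 -> 0 < e ->
  exists2 d0, 0 < d0 & exists2 omega, 0 < omega & forall d r, 0 < d <= d0 -> 0 < r ->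
  exists2 s1, 0 < s1 & forall s, 0 < s < s1 -> posterior_error b g0 d r omega s <= e.
Proof.
move=> b0 g00 e0; have := fun d r omega => @posterior_error_limit R b g0 d r omega (e / 2) b0 g00.
have : 0 < 1024 :> R by rewrite ltr0n.
move: (1024 : R) => K K0 h; have e2 : 0 < e / 2 by rewrite divr_gt0.
(* The curvature and the prior each receive e / 4, and the limit in [s] receives e / 2. *)
exists (e / (K * 32)); first by rewrite divr_gt0 ?mulr_gt0.
exists (g0 * (e / (K * 4))); first by rewrite mulr_gt0 ?divr_gt0 ?mulr_gt0.
move=> d r /andP[d0 dd] r0; have [s1 s10 hs] := h d r (g0 * (e / (K * 4))) r0 e2.
exists s1 => // s /hs /le_trans; apply.
have h1 : K * (g0 * (e / (K * 4)) / g0 + 8 * d) = e / 4 + 8 * (K * d) by field; rewrite !gt_eqF.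
have h2 : K * d <= e / 32.
  by apply: le_trans (ler_wpM2l (ltW K0) dd) _; rewrite le_eqVlt; apply/orP; left; apply/eqP; field; rewrite gt_eqF.
by rewrite h1; lra.
Qed.

Lemma small_error (R : realFieldType) (e : R) : 0 < e ->
  exists2 e1, 0 < e1 & forall k, k <= e1 -> [/\ k <= 2^-1, 4 * k <= e & 2 * k <= e].
Proof.
move=> e0; exists (Num.min (e / 4) 2^-1); first by rewrite lt_min divr_gt0 /= ?invr_gt0.
by move=> k; rewrite le_min => /andP[k1 k2]; split; lra.
Qed.

Lemma radius_bounds (R : realFieldType) (s d : R) : 0 < s < 1 -> 0 < d <= 32^-1 ->
  let r := d * Num.min s (1 - s) / 4 in [/\ 0 < r, 0 < s - r, s + r < 1 & 2 * r < d].
Proof.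
move=> /andP[s0 s1] /andP[d0 d1]; set m := Num.min s (1 - s).
have m0 : 0 < m by rewrite lt_min s0 subr_gt0.
have [ms ms1] : m <= s /\ m <= 1 - s by rewrite !ge_min !lexx orbT.
have dm : d * m <= 32^-1 * m by rewrite ler_wpM2r// ltW.
have dm1 : d * m <= d * 1 by rewrite ler_wpM2l ?(ltW d0)//; lra.
have dm0 : 0 < d * m by rewrite mulr_gt0.
by split; lra.
Qed.

Theorem theorem2 (R : realType) (d d' : measure_display)
  (Omega : measurableType d) (T : measurableType d')
  (P : probability Omega R) (P0 : probability T R)
  (X : nat -> {RV P >-> T})
  (sigma0 beta0 C M : R) (L0 : R -> R)
  (Pi : probability (measurableTypeR R) R) (g : R -> R)
  (sigma_hat : nat -> Omega -> R) :
  discrete_probability P0 ->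
  iid_from X P0 ->
  0 < sigma0 < 1 ->
  slowly_varying L0 ->
  continuously_differentiable L0 ->
  beta0 < sigma0 ->
  0 < C ->
  (forall u, 1 < u -> `|alpha0 P0 u - u `^ sigma0 * L0 u| <= C * u `^ beta0) ->
  (forall delta, 0 < delta -> exists Cdelta : R, forall u, 1 < u ->
     `|derive1 L0 u| <= Cdelta * u `^ (-1 + delta)) ->
  0 <= M ->
  (* g is a Lebesgue density on ]0, 1[ of the prior Pi *)
  measurable_fun (`]0, 1[ : set R) g ->
  (forall x, x \in `]0, 1[ -> 0 <= g x) ->
  (forall A : set R, measurable A ->
     Pi A = (\int[lebesgue_measure]_(x in A `&` `]0%R, 1%R[) (g x)%:E)%E) ->
  (exists b : R, forall x, x \in `]0, 1[ -> g x <= b) ->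
  0 < g sigma0 ->
  {for sigma0, continuous g} ->
  (forall n w, (0 < n)%N ->
     is_maximizer (likelihood M (mkseq (fun i => X i w) n)) (sigma_hat n w)) ->
  [/\ cvg_in_probability P
        (fun n w =>
           sup [set `|posterior Pi M (mkseq (fun i => X i w) n) B -
                      normal_of_variance (sigma_hat n w)
                        (1 / (alpha0 P0 n%:R * tau2_sq sigma0)) B|
               | B in [set B : set R | measurable B /\ B `<=` `]0, 1[]])
        0,
      forall eps : R, 0 < eps ->
        cvg_in_probability P
          (fun n w => posterior Pi M (mkseq (fun i => X i w) n)
                        [set s | eps < `|s - sigma0|]) 0 &
      cvg_in_probability P
        (fun n w => Num.sqrt (alpha0 P0 n%:R) *
           (posterior_mean Pi M (mkseq (fun i => X i w) n) - sigma_hat n w)) 0].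
Proof.
move=> [m1 [D Dc PD]] iidX s01 sv [L0d _] b0s _ La _ M0 mg g_ge0 PiE [b gb] gs0 gcont hmax.
have /countable_injP[f f_inj] := Dc.
have e_pos n : 0 < (n.+1%:R ^+ 2)^-1 :> R by rewrite invr_gt0 exprn_gt0 ?ltr0n.
have [J hJ] := choice (fun n => atoms_exhaust m1 PD f_inj (e_pos n)).
have J1 n : 1 - \sum_(k < J n) fine (P0 (atom D f k)) <= (n.+1%:R ^+ 2)^-1 by have [/ltW] := hJ n.
have J2 n k : (J n <= k)%N -> fine (P0 (atom D f k)) < (n.+1%:R ^+ 2)^-1 by have [_] := hJ n; apply.
have a_ge0 t : 0 <= alpha0 P0 t by rewrite /alpha0.
have a_mono := alpha0_mono m1 PD f_inj.
have a_rv : forall u, 0 < u -> alpha0 P0 (t * u) / alpha0 P0 t @[t --> +oo%R] --> u `^ sigma0.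
  apply: (regularly_varying sv _ b0s La) => u u1.
  by apply: differentiable_continuous; apply/derivable1_diffP; exact: L0d.
have cle := alpha0_count_le m1 PD f_inj.
have ceq (x : R) (K : nat) : 0 < x -> (forall k, (K <= k)%N -> fine (P0 (atom D f k)) < x) ->
    \sum_(k < K) (x <= fine (P0 (atom D f k)))%R%:R = alpha0 P0 x^-1.
  by move=> x0 h; have [] := alpha0_count m1 PD f_inj x0 h.
have mA := measurable_atom m1 f_inj.
have Ad := @atom_disj _ _ D f.
have As := atom_sub f_inj.
have t0 := tau2_sq_gt0 s01; have /andP[s00 s0lt] := s01.
pose an n : R := alpha0 P0 n%:R.
have large := a_large s01 a_ge0 a_mono a_rv.
have b0 : 0 <= b.
  by apply: le_trans (ltW gs0) _; apply: gb; rewrite in_itv/=.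
(* All three conclusions are read off one event. Here [e] is at once the error allowed and the
   distance from [sigma0] at which sets count as far. *)
have core e : 0 < e -> whp P (fun n w => [/\
    forall B : set (measurableTypeR R), measurable B ->
      `|posterior Pi M (sample X n w) B - normal_of_variance (sigma_hat n w) (1 / (an n * tau2_sq sigma0)) B| <= e,
    forall B : set (measurableTypeR R), measurable B -> (forall x, B x -> e <= `|x - sigma0|) ->
      `|posterior Pi M (sample X n w) B| <= e &
    `|posterior_mean Pi M (sample X n w) - sigma_hat n w| <= e * Num.sqrt (1 / (an n * tau2_sq sigma0))]).
  move=> e0; have [e1 e10 kap_le] := small_error e0.
  have [d0 d00 [omega om0 hd]] := posterior_error_small b0 gs0 e10.
  have [del del0 hdel] : exists2 del, 0 < del & forall x, `|x - sigma0| < del -> `|g x - g sigma0| <= omega.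
    have [del /= del0 h] := (cvgrPdist_le _ _).1 gcont _ om0.
    by exists del => // x hx; rewrite distrC; apply: h; rewrite /ball/= distrC.
  (* The entries serve the sandwich, the posterior error, the continuity of the prior density, and
     the inclusion of the far sets, in this order. The last two work through 2 r < dl. *)
  pose dl := Num.min (Num.min 32^-1 d0) (Num.min del e).
  have dl0 : 0 < dl by rewrite !lt_min invr_gt0 ltr0n d00 del0 e0.
  have [dl1 dl2 dl3 dl4] : [/\ dl <= 32^-1, dl <= d0, dl <= del & dl <= e].
    by split; rewrite !ge_min lexx ?orbT.
  have dl01 : 0 < dl <= 32^-1 by rewrite dl0 dl1.
  pose r := dl * Num.min sigma0 (1 - sigma0) / 4.
  have [r0 sr1 sr2 rdl] := radius_bounds s01 dl01; rewrite -/r in r0 sr1 sr2 rdl.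
  have [s1 s10 hs] := hd dl r (introT andP (conj dl0 dl2)) r0.
  (* From here on the standard deviation [s] lies below [s1]; the added 1 makes the inequality
     strict. *)
  have [N hN] := large ((s1 ^+ 2 * tau2_sq sigma0)^-1 + 1).
  have near2 x : `|x - sigma0| <= 2 * r -> `|g x - g sigma0| <= omega.
    by move=> h; apply: hdel; exact: le_lt_trans h (lt_le_trans rdl dl3).
  have far2 x : e <= `|x - sigma0| -> 2 * r <= `|x - sigma0|.
    by apply: le_trans; exact: le_trans (ltW rdl) dl4.
  apply: (whp_mono (likelihood_regular iidX mA Ad As J1 J2 s01 a_ge0 a_mono a_rv cle ceq M0 dl0 r0 sr1 sr2)).
  exists (maxn N 1) => n w; rewrite geq_max => /andP[Nn n1] [c1 c2 c3].
  have an1 := hN n Nn; rewrite -/(an n) in an1 c1.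
  have st0 : 0 < s1 ^+ 2 * tau2_sq sigma0 by rewrite mulr_gt0 ?exprn_gt0.
  have sti0 : 0 < (s1 ^+ 2 * tau2_sq sigma0)^-1 by rewrite invr_gt0.
  have an0 : 0 < an n by apply: lt_le_trans an1; rewrite ltr_wpDl ?(ltW sti0).
  have W0 : 0 < an n * tau2_sq sigma0 by rewrite mulr_gt0.
  set s := Num.sqrt _.
  have sg : 0 < s by rewrite sqrtr_gt0 divr_gt0.
  have ss1 : s < s1.
    rewrite -[ltRHS](ger0_norm (ltW s10)) -sqrtr_sqr ltr_sqrt ?exprn_gt0//.
    rewrite div1r invf_plt ?posrE ?exprn_gt0// -ltr_pdivrMr// -invfM.
    by apply: lt_le_trans an1; rewrite ltrDl.
  have kap : posterior_error b (g sigma0) dl r omega s <= e1 by apply: hs; rewrite sg ss1.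
  have [kap2 kap4 kap5] := kap_le _ kap.
  have [h1 h2 h3 h4] := likelihood_bounds mg g_ge0 PiE gb M0 s01 gs0 dl01 W0 near2 (hmax n w n1) c1 c2 c3 kap2.
  split.
  - by move=> B mB; apply: le_trans (h2 B mB) _.
  - by move=> B mB hB; apply: le_trans (h3 B mB _) _ => // x /hB; exact: far2.
  - by apply: le_trans h4 _; rewrite ler_wpM2r ?(ltW sg).
split.
- apply: cvg_in_probability_whp => e e0; apply: (whp_mono (core e e0)).
  exists 0%N => n w _ [h _ _]; rewrite subr0.
  set S := [set _ | _ in _].
  (* A bound on [sup] needs a nonempty bounded set, and the empty Borel set supplies an element;
     since all elements are absolute values, the supremum is nonnegative. *)
  have [y Sy] : S !=set0 by eexists; exists set0 => //; split => //; exact: measurable0.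
  have Sub : ubound S e by move=> _ [B [mB _] <-]; exact: h.
  have y0 : 0 <= y by case: Sy => B _ <-.
  rewrite ger0_norm; first by apply: sup_le_ub Sub; exists y.
  by apply: le_trans y0 _; apply: ub_le_sup Sy; exists e.
- move=> eps eps0; apply: cvg_in_probability_whp => e e0.
  (* At most eps, so that the set counts as far; at most [e], for the error. *)
  have e10 : 0 < Num.min eps e by rewrite lt_min eps0 e0.
  apply: (whp_mono (core _ e10)); exists 0%N => n w _ [_ h _]; rewrite subr0.
  apply: le_trans (h _ _ _) _; last by rewrite ge_min lexx orbT.
  + rewrite (_ : [set _ | _] = ~` [set x | `|x - sigma0| <= eps]); last first.
      by apply/seteqP; split=> x /=; rewrite ltNge => /negP.
    apply: measurableC; rewrite -[X in measurable X]setTI; apply: measurable_fun_le => //.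
    by apply: (measurableT_comp (@normr_measurable _ _)); apply: measurable_funB.
  + by move=> x /ltW; apply: le_trans; rewrite ge_min lexx.
- apply: cvg_in_probability_whp => e e0.
  have st : 0 < Num.sqrt (tau2_sq sigma0) by rewrite sqrtr_gt0.
  have [N hN] := large 1.
  (* The factor sqrt tau2 cancels against the standard deviation 1 / sqrt (a n * tau2), and sqrt (a
     n) cancels the rest, leaving [e]. *)
  apply: (whp_mono (core _ (mulr_gt0 e0 st))); exists N => n w Nn [_ _ h].
  have an0 : 0 < an n by apply: lt_le_trans (hN n Nn).
  rewrite subr0 normrM ger0_norm ?sqrtr_ge0//.
  apply: le_trans (ler_wpM2l (sqrtr_ge0 _) h) _.
  rewrite -/(an n) div1r sqrtrV ?mulr_ge0 ?(ltW an0) ?(ltW t0)// sqrtrM ?(ltW an0)//.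
  rewrite le_eqVlt; apply/orP; left; apply/eqP; field.
  by rewrite !gt_eqF ?sqrtr_gt0.
Qed.
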